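(* Let $|q|<1$ and let $(\alpha_n(a,k),\beta_n(a,k))_{n\ge 0}$ be sequences depending on parameters $a,k$ such that both $(\alpha_n(a,k),\beta_n(a,k))$ and $(\alpha_n(1/a,1/k),\beta_n(1/a,1/k))$ are WP-Bailey pairs (with base $q$). Let $z$ satisfy $|qa|<|z|<|a/q|$, and assume the parameters are such that no denominator below vanishes and all infinite series below converge absolutely. Then \begin{multline*} \sum_{n=1}^{\infty} \frac{(q\sqrt{k},-q\sqrt{k},z;q)_{n}(q;q)_{n-1}}{(\sqrt{k},-\sqrt{k}, q k,q k/z;q)_{n}}\left( \frac{q a}{ z }\right )^{n} \beta_n(a,k) - \sum_{n=1}^{\infty}\frac{(q/\sqrt{k},-q/\sqrt{k},1/z;q)_{n}(q;q)_{n-1}}{(1/\sqrt{k},-1/\sqrt{k}, q/k,q z/k;q)_{n}}\left( \frac{q z}{ a }\right )^{n}\beta_n(1/a,1/k)\\ - \sum_{n=1}^{\infty}\frac{(z;q)_{n}(q;q)_{n-1}}{(q a ,q a/z;q)_n}\left (\frac{q a}{z}\right)^{n}\alpha_n(a,k) +\sum_{n=1}^{\infty}\frac{(1/z;q)_{n}(q;q)_{n-1}}{(q/a ,q z/a;q)_n}\left (\frac{q z}{a}\right)^{n}\alpha_n(1/a,1/k)\\ =\frac{(a-k)(1-1/z)(1-ak/z)}{(1-a)(1-k)(1-a/z)(1-k/z)} +\frac{z}{k}\,\frac{(z,q/z,k/a,qa/k,ak/z,qz/(ak),q,q;q)_{\infty}}{(z/k,qk/z,z/a,qa/z,a,q/a,k,q/k;q)_{\infty}}.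 \end{multline*}
   Context: Notation: $(x;q)_n=(1-x)(1-xq)\cdots(1-xq^{n-1})$, $(x;q)_0=1$, $(x;q)_\infty=\prod_{j\ge0}(1-xq^j)$, and $(x_1,\dots,x_m;q)_n=(x_1;q)_n\cdots(x_m;q)_n$ (also for $n=\infty$). A WP-Bailey pair (with parameters $a,k$ and base $q$) is a pair of sequences $(\alpha_n(a,k,q),\beta_n(a,k,q))_{n\ge0}$ with $\alpha_0=\beta_0=1$ and, for $n>0$, $$\beta_n(a,k,q)=\sum_{j=0}^{n}\frac{(k/a;q)_{n-j}(k;q)_{n+j}}{(q;q)_{n-j}(aq;q)_{n+j}}\alpha_j(a,k,q).$$ *)

(* Defs.v *)
From Stdlib Require Import Reals ClassicalEpsilon.
Open Scope R_scope.

Definition Cpx : Type := (R * R)%type.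

Definition RtoC (x : R) : Cpx := (x, 0).
Definition Czero : Cpx := (0, 0).
Definition Cone : Cpx := (1, 0).
Definition Cadd (u v : Cpx) : Cpx := (fst u + fst v, snd u + snd v).
Definition Copp (u : Cpx) : Cpx := (- fst u, - snd u).
Definition Csub (u v : Cpx) : Cpx := Cadd u (Copp v).
Definition Cmul (u v : Cpx) : Cpx :=
  (fst u * fst v - snd u * snd v, fst u * snd v + snd u * fst v).
(* Cinv 0 = 0 (junk value); the theorem assumes all denominators nonzero. *)
Definition Cinv (u : Cpx) : Cpx :=
  let d := fst u * fst u + snd u * snd u in (fst u / d, - snd u / d).
Definition Cdiv (u v : Cpx) : Cpx := Cmul u (Cinv v).
Fixpoint Cpow (u : Cpx) (n : nat) : Cpx :=
  match n with O => Cone | S m => Cmul u (Cpow u m) end.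
Definition Cnorm (u : Cpx) : R := sqrt (fst u * fst u + snd u * snd u).

Declare Scope C_scope.
Delimit Scope C_scope with C.
Infix "+" := Cadd : C_scope.
Infix "-" := Csub : C_scope.
Notation "- x" := (Copp x) : C_scope.
Infix "*" := Cmul : C_scope.
Infix "/" := Cdiv : C_scope.
Infix "^" := Cpow : C_scope.
Notation "/ x" := (Cinv x) : C_scope.

Definition Ccv (u : nat -> Cpx) (l : Cpx) : Prop :=
  Un_cv (fun n => fst (u n)) (fst l) /\ Un_cv (fun n => snd (u n)) (snd l).

(** The limit of a sequence (meaningful when it converges). *)
Definition Clim (u : nat -> Cpx) : Cpx :=
  epsilon (inhabits Czero) (fun l => Ccv u l).

Fixpoint Csum1 (f : nat -> Cpx) (N : nat) : Cpx :=
  match N with O => Czero | S m => Cadd (Csum1 f m) (f (S m)) end.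

Fixpoint Rsum_abs1 (f : nat -> Cpx) (N : nat) : R :=
  match N with O => 0 | S m => Rsum_abs1 f m + Cnorm (f (S m)) end.

Definition abs_summable1 (f : nat -> Cpx) : Prop :=
  exists l : R, Un_cv (Rsum_abs1 f) l.

Definition series1 (f : nat -> Cpx) : Cpx := Clim (Csum1 f).

Fixpoint qpoch (x q : Cpx) (n : nat) : Cpx :=
  match n with
  | O => Cone
  | S m => Cmul (qpoch x q m) (Csub Cone (Cmul x (Cpow q m)))
  end.
Definition qpinf (x q : Cpx) : Cpx := Clim (qpoch x q).

Definition WP_Bailey_pair (a k q : Cpx) (alpha beta : nat -> Cpx) : Prop :=
  alpha 0%nat = Cone /\ beta 0%nat = Cone /\
  forall n : nat, (0 < n)%nat ->
    beta n =
    List.fold_right Cadd Czero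
      (List.map (fun j =>
         Cmul (Cdiv (Cmul (qpoch (Cdiv k a) q (n - j)) (qpoch k q (n + j)))
                    (Cmul (qpoch q q (n - j)) (qpoch (Cmul a q) q (n + j))))
              (alpha j))
         (List.seq 0 (S n))).

(* Main.v *)
(** Write W_n beta_n and V_n alpha_n for the terms of the series over beta_n
    and alpha_n. Substituting the definition of beta_n gives coefficients
    W_n c_(n,j) of alpha_j which, summed over n >= j, form a nonterminating
    very-well-poised 6phi5. A single telescoping identity for the shift
    (a,k) -> (aq,kq) shows that for j >= 1 the sum is V_j, and that for j = 0
    it is the sum over n >= 1 of E(q^n), where
    E(x) = e(x) - e(x/z) and e(x) = 1/(1-kx) - 1/(1-ax).
    Replacing (a,k,z) by (1/a,1/k,1/z) turns E(q^n) into -E(q^-n), so the left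
    side of the theorem is the sum of E(q^n) over all nonzero integers n, while
    the rational term on the right side is -E(1). The bilateral sum of E(q^n)
    is the limit of the partial fraction expansions, in a, of truncations of
    theta(a/k) theta(ak/z) / (theta(a) theta(a/z)), where
    theta(x) = (x,q/x;q)_oo. *)

Require Import Defs.
From Stdlib Require Import Reals Lra Lia Arith Classical ClassicalEpsilon.
From Coquelicot Require Complex.

Local Open Scope C_scope.
Local Arguments Cnorm _%_C_scope.
Local Arguments qpoch (_ _)%_C_scope _%_nat_scope.

(** One certificate serves all rows because [vwp_term] is already divided by 1 - c, where c stands
    for q^j. For j >= 1 the first term 1 of the 6phi5 absorbs the inhomogeneous part of the
    recurrence in a -> aq, and iterating towards a q^i -> 0 determines the row. At c = 1 the
    multiplier of the recurrence is 1, so the inhomogeneous parts simply accumulate, and they are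
    the summands E(q^n). Truncating theta keeps the bilateral sum free of complex analysis: a
    rational function with simple poles is expanded exactly, and its value at a zero is subtracted,
    which removes the constant and turns simple fractions into values of e. The two families of
    poles carry residues with opposite limits, as for an elliptic function with two poles; hence the
    difference e(x) - e(x/z). The sums are carried to the limit by dominated convergence, so many
    estimates aim at bounds uniform in several indices. Two cases escape this argument: z an
    integral power of q, where the two families of poles meet, and q = 0, where negative powers of q
    are lost. *)

Lemma Cpx_ext (u v : Cpx) : fst u = fst v -> snd u = snd v -> u = v.
Proof. destruct u, v; simpl; intros -> ->; reflexivity. Qed.

Lemma Cpx_field_theory :
  field_theory Czero Cone Cadd Cmul Csub Copp Cdiv Cinv (@eq Cpx).
Proof.
  constructor; [constructor|..]; intros; unfold Cdiv, Csub;
    try (apply Cpx_ext; simpl; ring); try reflexivity.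
  - intros H; apply (f_equal fst) in H; simpl in H; lra.
  - destruct p as [x y].
    assert (Hd : (x * x + y * y <> 0)%R).
    { intros E; apply H; unfold Czero; f_equal; nra. }
    apply Cpx_ext; simpl; field; exact Hd.
Qed.

Add Field Cpx_field : Cpx_field_theory.

(** * Norm, inverses and powers of complex numbers *)

Lemma Cnorm_Cmod u : Cnorm u = Complex.Cmod u.
Proof. unfold Cnorm, Complex.Cmod; f_equal; ring. Qed.

Lemma Cnorm_ge0 u : (0 <= Cnorm u)%R.
Proof. apply sqrt_pos. Qed.

Lemma Cnorm_add u v : (Cnorm (u + v) <= Cnorm u + Cnorm v)%R.
Proof. rewrite !Cnorm_Cmod; exact (Complex.Cmod_triangle u v). Qed.

Lemma Cnorm_mul u v : Cnorm (u * v) = (Cnorm u * Cnorm v)%R.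
Proof. rewrite !Cnorm_Cmod; exact (Complex.Cmod_mult u v). Qed.

Lemma Cnorm_opp u : Cnorm (- u) = Cnorm u.
Proof. rewrite !Cnorm_Cmod; exact (Complex.Cmod_opp u). Qed.

Lemma Cnorm_0 : Cnorm Czero = 0%R.
Proof. unfold Cnorm; simpl; replace (0 * 0 + 0 * 0)%R with 0%R by ring; apply sqrt_0. Qed.

Lemma Cnorm_1 : Cnorm Cone = 1%R.
Proof. unfold Cnorm; simpl; replace (1 * 1 + 0 * 0)%R with 1%R by ring; apply sqrt_1. Qed.

Lemma Cnorm_eq0 u : Cnorm u = 0%R -> u = Czero.
Proof. rewrite Cnorm_Cmod; exact (Complex.Cmod_eq_0 u). Qed.

Lemma Cnorm_gt0 u : u <> Czero -> (0 < Cnorm u)%R.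
Proof.
  intros H; destruct (Cnorm_ge0 u) as [L|L]; [exact L|].
  exfalso; apply H, Cnorm_eq0; auto.
Qed.

Lemma Cnorm_neq0 u : (0 < Cnorm u)%R -> u <> Czero.
Proof. intros H ->; rewrite Cnorm_0 in H; lra. Qed.

Lemma Cmul_neq0 u v : u <> Czero -> v <> Czero -> u * v <> Czero.
Proof.
  intros Hu Hv; apply Cnorm_neq0; rewrite Cnorm_mul.
  apply Rmult_lt_0_compat; apply Cnorm_gt0; assumption.
Qed.

Lemma Cone_neq0 : Cone <> Czero.
Proof. apply Cnorm_neq0; rewrite Cnorm_1; lra. Qed.

Lemma Copp_neq0 u : u <> Czero -> - u <> Czero.
Proof. intros H; apply Cnorm_neq0; rewrite Cnorm_opp; apply Cnorm_gt0; auto. Qed.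

Lemma Cmul_eq0 u v : u * v = Czero -> u = Czero \/ v = Czero.
Proof.
  intros H; destruct (classic (u = Czero)) as [E|E]; auto.
  destruct (classic (v = Czero)) as [F|F]; auto.
  exfalso; exact (Cmul_neq0 _ _ E F H).
Qed.

Lemma Cinv_neq0 u : u <> Czero -> / u <> Czero.
Proof.
  intros H E; apply Cone_neq0; replace Cone with (u * / u) by (field; exact H).
  rewrite E; ring.
Qed.

Lemma Cinv_0 : / Czero = Czero.
Proof. apply Cpx_ext; simpl; unfold Rdiv; ring. Qed.

(** The convention 1/0 = 0 makes this true at u = 0 as well, so a limit can be rewritten termwise
    even if some denominators of the sequence vanish. *)
Lemma Cinv_div u v : v <> Czero -> / (u / v) = v / u.
Proof.
  intros Hv; destruct (classic (u = Czero)) as [->|Hu]; [|field; auto].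
  replace (Czero / v) with Czero by (field; auto).
  unfold Cdiv; rewrite Cinv_0; ring.
Qed.

Lemma sub_neq0_of_div x y : y <> Czero -> Cone - x / y <> Czero -> y - x <> Czero.
Proof.
  intros Hy H E; apply H; replace (Cone - x / y) with ((y - x) / y) by (field; auto).
  rewrite E; unfold Cdiv; ring.
Qed.

Lemma Cnorm_inv u : u <> Czero -> Cnorm (/ u) = (/ Cnorm u)%R.
Proof.
  intros H; pose proof (Cnorm_gt0 u H) as P.
  apply (Rmult_eq_reg_l (Cnorm u)); [|lra].
  rewrite <- Cnorm_mul, Rinv_r by lra.
  replace (u * / u) with Cone by (field; exact H); apply Cnorm_1.
Qed.

Lemma Cnorm_div u v : v <> Czero -> Cnorm (u / v) = (Cnorm u / Cnorm v)%R.
Proof. intros H; unfold Cdiv; rewrite Cnorm_mul, Cnorm_inv; auto. Qed.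

Lemma Cnorm_sub u v : (Cnorm (u - v) <= Cnorm u + Cnorm v)%R.
Proof. unfold Csub; rewrite <- (Cnorm_opp v); apply Cnorm_add. Qed.

Lemma Cnorm_sub_ge u v : (Cnorm u - Cnorm v <= Cnorm (u - v))%R.
Proof.
  pose proof (Cnorm_add (u - v) v) as H.
  replace (u - v + v) with u in H by ring; lra.
Qed.

Lemma Cnorm_sub_sym u v : Cnorm (u - v) = Cnorm (v - u).
Proof. rewrite <- Cnorm_opp; f_equal; ring. Qed.

Lemma Cnorm_pow u n : Cnorm (u ^ n) = (Cnorm u ^ n)%R.
Proof. induction n; simpl; [apply Cnorm_1|rewrite Cnorm_mul, IHn; auto]. Qed.

Lemma Cpow_add u n m : u ^ (n + m) = u ^ n * u ^ m.
Proof. induction n; simpl; [ring|rewrite IHn; ring]. Qed.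

Lemma Cpow_mul u v n : (u * v) ^ n = u ^ n * v ^ n.
Proof. induction n; simpl; [ring|rewrite IHn; ring]. Qed.

Lemma Cpow_1 n : Cone ^ n = Cone.
Proof. induction n; simpl; [auto|rewrite IHn; ring]. Qed.

Lemma Cpow_neq0 u n : u <> Czero -> u ^ n <> Czero.
Proof. intros H; induction n; simpl; [apply Cone_neq0|apply Cmul_neq0; auto]. Qed.

(** * Sums and products over an initial segment *)

Fixpoint Csum (n : nat) (f : nat -> Cpx) : Cpx :=
  match n with O => Czero | S m => Csum m f + f m end.

Fixpoint Cprod (n : nat) (f : nat -> Cpx) : Cpx :=
  match n with O => Cone | S m => Cprod m f * f m end.

Fixpoint Rsum (n : nat) (f : nat -> R) : R :=
  match n with O => 0 | S m => Rsum m f + f m end%R.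

Lemma Csum_ext n f g : (forall i, (i < n)%nat -> f i = g i) -> Csum n f = Csum n g.
Proof. induction n; intros H; simpl; auto; rewrite IHn, H; auto. Qed.

Lemma Cprod_ext n f g : (forall i, (i < n)%nat -> f i = g i) -> Cprod n f = Cprod n g.
Proof. induction n; intros H; simpl; auto; rewrite IHn, H; auto. Qed.

Lemma Csum_plus n f g : Csum n (fun i => f i + g i) = Csum n f + Csum n g.
Proof. induction n; simpl; [ring|rewrite IHn; ring]. Qed.

Lemma Csum_minus n f g : Csum n (fun i => f i - g i) = Csum n f - Csum n g.
Proof. induction n; simpl; [ring|rewrite IHn; ring]. Qed.

Lemma Csum_scal n c f : Csum n (fun i => c * f i) = c * Csum n f.
Proof. induction n; simpl; [ring|rewrite IHn; ring]. Qed.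

Lemma Csum_split n m f : Csum (n + m) f = Csum n f + Csum m (fun i => f (n + i)%nat).
Proof.
  induction m; simpl.
  - rewrite Nat.add_0_r; ring.
  - rewrite Nat.add_succ_r; simpl; rewrite IHm; ring.
Qed.

Lemma Cprod_split n m f : Cprod (n + m) f = Cprod n f * Cprod m (fun i => f (n + i)%nat).
Proof.
  induction m; simpl.
  - rewrite Nat.add_0_r; ring.
  - rewrite Nat.add_succ_r; simpl; rewrite IHm; ring.
Qed.

Lemma Csum_first n f : Csum (S n) f = f O + Csum n (fun i => f (S i)).
Proof. rewrite (Csum_split 1 n); simpl; ring. Qed.

Lemma Cprod_mul n f g : Cprod n (fun i => f i * g i) = Cprod n f * Cprod n g.
Proof. induction n; simpl; [ring|rewrite IHn; ring]. Qed.

Lemma Csum_rev n f : Csum n f = Csum n (fun i => f (n - 1 - i)%nat).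
Proof.
  induction n; auto.
  rewrite (Csum_first n (fun i => f (S n - 1 - i)%nat)).
  replace (S n - 1 - 0)%nat with n by lia; simpl; rewrite IHn.
  rewrite (Csum_ext n (fun i => f (n - 0 - S i)%nat) (fun i => f (n - 1 - i)%nat));
    [ring|intros; f_equal; lia].
Qed.

Lemma Cprod_neq0 n f : (forall i, (i < n)%nat -> f i <> Czero) -> Cprod n f <> Czero.
Proof.
  induction n; intros H; simpl; [apply Cone_neq0|].
  apply Cmul_neq0; [apply IHn; auto|apply H; lia].
Qed.

Lemma Cprod_first n f : Cprod (S n) f = f O * Cprod n (fun i => f (S i)).
Proof. change (S n) with (1 + n)%nat; rewrite Cprod_split; simpl; ring. Qed.

Lemma Cprod_div n f g : (forall i, (i < n)%nat -> g i <> Czero) ->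
  Cprod n (fun i => f i / g i) = Cprod n f / Cprod n g.
Proof.
  induction n; intros H; simpl; [field; apply Cone_neq0|].
  rewrite IHn by auto; specialize (H n ltac:(lia)) as Hn.
  assert (Cprod n g <> Czero) by (apply Cprod_neq0; auto).
  field; auto.
Qed.

(** In a window of length 2N + 1 the index N carries the exponent 0. Pairing equal distances to both
    sides turns a bilateral sum into a one-sided one, to which [tannery] applies. *)
Lemma Csum_symmetric N h :
  Csum (2 * N + 1) h = h N + Csum N (fun i => h (N + S i)%nat + h (N - S i)%nat).
Proof.
  replace (2 * N + 1)%nat with (N + S N)%nat by lia.
  rewrite Csum_split, Csum_first, Nat.add_0_r, Csum_plus, (Csum_rev N h).
  rewrite (Csum_ext N (fun i => h (N - 1 - i)%nat) (fun i => h (N - S i)%nat))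
    by (intros; f_equal; lia).
  ring.
Qed.

(** The sum over m + M consecutive indices is split in two ways. A long sum of short shifts becomes
    a short sum of long shifts, which is how telescoping over a growing window is read off. *)
Lemma Csum_shift_diff (phi : nat -> Cpx) m M :
  Csum M (fun l => phi (l + m)%nat - phi l) = Csum m (fun i => phi (M + i)%nat - phi i).
Proof.
  rewrite !Csum_minus.
  pose proof (Csum_split m M phi) as A; pose proof (Csum_split M m phi) as B.
  rewrite Nat.add_comm in B; rewrite A in B.
  rewrite (Csum_ext M (fun i => phi (i + m)%nat) (fun i => phi (m + i)%nat))
    by (intros; f_equal; lia).
  assert (G : forall x u y v : Cpx, x + u = y + v -> u - y = v - x).
  { intros x u y v E; replace u with (x + u - x) by ring; rewrite E; ring. }
  apply G; exact B.
Qed.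

(** Column j is entered at row n = j; hence the substitution n = j + m and the length N - j. *)
Lemma Csum_triangle (F : nat -> nat -> Cpx) N :
  Csum N (fun n => Csum (S n) (fun j => F n j)) =
  Csum N (fun j => Csum (N - j) (fun m => F (j + m)%nat j)).
Proof.
  induction N; auto.
  change (Csum (S N) (fun n => Csum (S n) (fun j => F n j))) with
    (Csum N (fun n => Csum (S n) (fun j => F n j)) + Csum (S N) (fun j => F N j)).
  rewrite IHN.
  rewrite (Csum_ext (S N) (fun j => Csum (S N - j) (fun m => F (j + m)%nat j))
            (fun j => Csum (N - j) (fun m => F (j + m)%nat j) + F N j)).
  2:{ intros i Hi; replace (S N - i)%nat with (S (N - i)) by lia; simpl.
      do 2 f_equal; lia. }
  rewrite Csum_plus; f_equal.
  simpl; rewrite Nat.sub_diag; simpl; ring.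
Qed.

Lemma Csum_norm n f : (Cnorm (Csum n f) <= Rsum n (fun i => Cnorm (f i)))%R.
Proof.
  induction n; simpl; [rewrite Cnorm_0; lra|].
  eapply Rle_trans; [apply Cnorm_add|lra].
Qed.

Lemma Rsum_le n f g : (forall i, (i < n)%nat -> (f i <= g i)%R) -> (Rsum n f <= Rsum n g)%R.
Proof.
  induction n; intros H; simpl; [lra|].
  apply Rplus_le_compat; [apply IHn; auto|apply H; lia].
Qed.

Lemma Rsum_split n m f : Rsum (n + m) f = (Rsum n f + Rsum m (fun i => f (n + i)%nat))%R.
Proof.
  induction m; simpl.
  - rewrite Nat.add_0_r; ring.
  - rewrite Nat.add_succ_r; simpl; rewrite IHm; ring.
Qed.

Lemma Rsum_ge0 n f : (forall i, (0 <= f i)%R) -> (0 <= Rsum n f)%R.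
Proof. intros H; induction n; simpl; [lra|specialize (H n); lra]. Qed.

Lemma Rsum_scal n c f : Rsum n (fun i => c * f i)%R = (c * Rsum n f)%R.
Proof. induction n; simpl; [ring|rewrite IHn; ring]. Qed.

(** Bounded partial sums of nonnegative terms: the form in which dominating sequences are supplied,
    with no limit to be named. *)
Definition summable (M : nat -> R) : Prop :=
  (forall i, 0 <= M i)%R /\ exists B, forall n, (Rsum n M <= B)%R.

Lemma summable_scal c M : (0 <= c)%R -> summable M -> summable (fun i => c * M i)%R.
Proof.
  intros Hc [H [B HB]]; split.
  - intros i; apply Rmult_le_pos; auto.
  - exists (c * B)%R; intros n; rewrite Rsum_scal; apply Rmult_le_compat_l; auto.
Qed.

Lemma Rsum_geom_le r n : (0 <= r < 1)%R -> (Rsum n (fun i => r ^ i) <= / (1 - r))%R.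
Proof.
  intros Hr.
  assert (E : (Rsum n (fun i => r ^ i) * (1 - r) = 1 - r ^ n)%R).
  { induction n; simpl; [ring|rewrite Rmult_plus_distr_r, IHn; ring]. }
  assert (P : (0 <= r ^ n)%R) by (apply pow_le; lra).
  apply (Rmult_le_reg_r (1 - r)); [lra|].
  rewrite E, Rinv_l; lra.
Qed.

Lemma summable_geom r : (0 <= r < 1)%R -> summable (fun i => r ^ i)%R.
Proof.
  intros Hr; split; [intros; apply pow_le; lra|].
  exists (/ (1 - r))%R; intros; apply Rsum_geom_le; auto.
Qed.

(** Some partial sum comes within [eps] of the supremum, and all that follows must fit into the
    remaining gap. *)
Lemma summable_tail M eps : summable M -> (0 < eps)%R ->
  exists K, forall m, (Rsum m (fun i => M (K + i)%nat) < eps)%R.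
Proof.
  intros [H [B HB]] He.
  destruct (completeness (fun x => exists n, x = Rsum n M)) as [l [Hl1 Hl2]].
  - exists B; intros x [n ->]; auto.
  - exists (Rsum 0 M), O; auto.
  - destruct (classic (exists K, (l - eps < Rsum K M)%R)) as [[K HK]|N].
    + exists K; intros m.
      assert (Rsum (K + m) M <= l)%R by (apply Hl1; eexists; eauto).
      rewrite Rsum_split in H0; lra.
    + exfalso; assert (l <= l - eps)%R; [|lra].
      apply Hl2; intros x [n ->].
      destruct (Rle_or_lt (Rsum n M) (l - eps)); auto.
      exfalso; apply N; eauto.
Qed.

(** * Limits of complex sequences *)

Definition Cvg (u : nat -> Cpx) (l : Cpx) : Prop :=
  forall eps : R, (0 < eps)%R -> exists N, forall n, (N <= n)%nat -> (Cnorm (u n - l) < eps)%R.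

Lemma Cnorm_fst u : (Rabs (fst u) <= Cnorm u)%R.
Proof.
  rewrite Cnorm_Cmod; eapply Rle_trans; [|apply Complex.Rmax_Cmod]; apply Rmax_l.
Qed.

Lemma Cnorm_snd u : (Rabs (snd u) <= Cnorm u)%R.
Proof.
  rewrite Cnorm_Cmod; eapply Rle_trans; [|apply Complex.Rmax_Cmod]; apply Rmax_r.
Qed.

Lemma Cnorm_le_abs u : (Cnorm u <= Rabs (fst u) + Rabs (snd u))%R.
Proof.
  replace u with ((fst u, 0%R) + (0%R, snd u)) at 1
    by (apply Cpx_ext; simpl; ring).
  eapply Rle_trans; [apply Cnorm_add|].
  unfold Cnorm; simpl.
  replace (fst u * fst u + 0 * 0)%R with (Rsqr (fst u)) by (unfold Rsqr; ring).
  replace (0 * 0 + snd u * snd u)%R with (Rsqr (snd u)) by (unfold Rsqr; ring).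
  rewrite !sqrt_Rsqr_abs; lra.
Qed.

Lemma Cvg_Ccv u l : Cvg u l <-> Ccv u l.
Proof.
  split.
  - intros H; split; intros eps He; destruct (H eps He) as [N HN]; exists N; intros n Hn;
      unfold Rdist; specialize (HN n Hn);
      [pose proof (Cnorm_fst (u n - l)) as P | pose proof (Cnorm_snd (u n - l)) as P];
      simpl in P; unfold Rminus; lra.
  - intros [H1 H2] eps He.
    destruct (H1 (eps / 2)%R) as [N1 HN1]; [lra|].
    destruct (H2 (eps / 2)%R) as [N2 HN2]; [lra|].
    exists (N1 + N2)%nat; intros n Hn.
    specialize (HN1 n ltac:(lia)); specialize (HN2 n ltac:(lia)); unfold Rdist, Rminus in *.
    eapply Rle_lt_trans; [apply Cnorm_le_abs|]; simpl; lra.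
Qed.

Lemma Cvg_unique u l m : Cvg u l -> Cvg u m -> l = m.
Proof.
  intros Hl Hm.
  destruct (classic (l = m)) as [E|E]; auto; exfalso.
  assert (P : (0 < Cnorm (l - m))%R).
  { apply Cnorm_gt0; intros F; apply E.
    replace l with (l - m + m) by ring; rewrite F; ring. }
  destruct (Hl (Cnorm (l - m) / 2)%R) as [N HN]; [lra|].
  destruct (Hm (Cnorm (l - m) / 2)%R) as [N' HN']; [lra|].
  specialize (HN (N + N')%nat ltac:(lia)); specialize (HN' (N + N')%nat ltac:(lia)).
  rewrite Cnorm_sub_sym in HN.
  pose proof (Cnorm_add (l - u (N + N')%nat) (u (N + N')%nat - m)) as T.
  replace (l - u (N + N')%nat + (u (N + N')%nat - m)) with (l - m) in T by ring; lra.
Qed.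

(** Uniqueness of limits pins down the value picked by [epsilon]. *)
Lemma Clim_eq u l : Cvg u l -> Clim u = l.
Proof.
  intros H; apply (Cvg_unique u); auto.
  apply Cvg_Ccv; unfold Clim.
  apply (epsilon_spec (inhabits Czero) (fun l => Ccv u l)).
  exists l; apply Cvg_Ccv; auto.
Qed.

Lemma Cvg_ext u v l : (forall n, u n = v n) -> Cvg u l -> Cvg v l.
Proof. intros E H eps He; destruct (H eps He) as [N HN]; exists N; intros; rewrite <- E; auto. Qed.

Lemma Cvg_eq u l m : l = m -> Cvg u l -> Cvg u m.
Proof. intros ->; auto. Qed.

Lemma Cvg_const c : Cvg (fun _ => c) c.
Proof.
  intros eps He; exists O; intros; replace (c - c) with Czero by ring; rewrite Cnorm_0; auto.
Qed.

Lemma Cvg_add u v l m : Cvg u l -> Cvg v m -> Cvg (fun n => u n + v n) (l + m).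
Proof.
  intros Hu Hv eps He.
  destruct (Hu (eps / 2)%R) as [N HN]; [lra|].
  destruct (Hv (eps / 2)%R) as [N' HN']; [lra|].
  exists (N + N')%nat; intros n Hn.
  specialize (HN n ltac:(lia)); specialize (HN' n ltac:(lia)).
  replace (u n + v n - (l + m)) with ((u n - l) + (v n - m)) by ring.
  eapply Rle_lt_trans; [apply Cnorm_add|lra].
Qed.

Lemma Cvg_opp u l : Cvg u l -> Cvg (fun n => - u n) (- l).
Proof.
  intros H eps He; destruct (H eps He) as [N HN]; exists N; intros n Hn.
  replace (- u n - - l) with (- (u n - l)) by ring; rewrite Cnorm_opp; auto.
Qed.

Lemma Cvg_sub u v l m : Cvg u l -> Cvg v m -> Cvg (fun n => u n - v n) (l - m).
Proof. intros; unfold Csub; apply Cvg_add; auto; apply Cvg_opp; auto. Qed.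

Lemma Cvg_bounded u l : Cvg u l -> exists B, (0 < B)%R /\ forall n, (Cnorm (u n) <= B)%R.
Proof.
  intros H; destruct (H 1%R) as [N HN]; [lra|].
  assert (P : forall n f, (forall i, 0 <= f i)%R -> forall i, (i < n)%nat -> (f i <= Rsum n f)%R).
  { induction n; intros f Hf i Hi; [lia|]; simpl.
    destruct (Nat.eq_dec i n) as [->|D].
    - pose proof (Rsum_ge0 n f Hf); lra.
    - pose proof (IHn f Hf i ltac:(lia)); specialize (Hf n); lra. }
  pose proof (Rsum_ge0 N (fun i => Cnorm (u i)) (fun i => Cnorm_ge0 _)) as Q.
  pose proof (Cnorm_ge0 l).
  exists (Rsum N (fun i => Cnorm (u i)) + Cnorm l + 1)%R; split; [lra|].
  intros n; destruct (le_lt_dec N n) as [L|L].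
  - specialize (HN n L); pose proof (Cnorm_sub_ge (u n) l); lra.
  - pose proof (P N (fun i => Cnorm (u i)) (fun i => Cnorm_ge0 _) n L); simpl in *; lra.
Qed.

Lemma Cvg_le u l (e : nat -> R) : (forall n, (Cnorm (u n - l) <= e n)%R) ->
  Un_cv e 0 -> Cvg u l.
Proof.
  intros H He eps Hp; destruct (He eps Hp) as [N HN]; exists N; intros n Hn.
  specialize (HN n Hn); unfold Rdist in HN; rewrite Rminus_0_r in HN.
  eapply Rle_lt_trans; [apply H|]; eapply Rle_lt_trans; [apply Rle_abs|exact HN].
Qed.

Lemma Cvg_mul0 u v B : Cvg u Czero -> (forall n, (Cnorm (v n) <= B)%R) ->
  Cvg (fun n => u n * v n) Czero.
Proof.
  intros H HB eps He.
  assert (0 <= B)%R by (eapply Rle_trans; [apply Cnorm_ge0|apply (HB O)]).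
  destruct (H (eps / (B + 1))%R) as [N HN]; [apply Rdiv_lt_0_compat; lra|].
  exists N; intros n Hn; specialize (HN n Hn).
  replace (u n * v n - Czero) with ((u n - Czero) * v n) by ring; rewrite Cnorm_mul.
  apply Rle_lt_trans with (Cnorm (u n - Czero) * (B + 1))%R.
  - apply Rmult_le_compat_l; [apply Cnorm_ge0|]; specialize (HB n); lra.
  - apply (Rmult_lt_compat_r (B + 1)) in HN; [|lra].
    replace (eps / (B + 1) * (B + 1))%R with eps in HN by (field; lra); exact HN.
Qed.

Lemma Cvg_mul u v l m : Cvg u l -> Cvg v m -> Cvg (fun n => u n * v n) (l * m).
Proof.
  intros Hu Hv.
  destruct (Cvg_bounded v m Hv) as [B [_ HB]].
  replace (l * m) with (Czero + l * m) by ring.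
  apply Cvg_ext with (fun n => (u n - l) * v n + l * v n); [intros; ring|].
  apply Cvg_add.
  - apply Cvg_mul0 with B; auto.
    replace Czero with (l - l) by ring; apply Cvg_sub; auto; apply Cvg_const.
  - intros eps He.
    pose proof (Cnorm_ge0 l).
    destruct (Hv (eps / (Cnorm l + 1))%R) as [N HN]; [apply Rdiv_lt_0_compat; lra|].
    exists N; intros n Hn; specialize (HN n Hn).
    replace (l * v n - l * m) with (l * (v n - m)) by ring; rewrite Cnorm_mul.
    apply Rle_lt_trans with ((Cnorm l + 1) * Cnorm (v n - m))%R.
    + apply Rmult_le_compat_r; [apply Cnorm_ge0|lra].
    + apply (Rmult_lt_compat_l (Cnorm l + 1)) in HN; [|lra].
      replace ((Cnorm l + 1) * (eps / (Cnorm l + 1)))%R with eps in HN by (field; lra); exact HN.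
Qed.

Lemma Cvg_inv u l : l <> Czero -> Cvg u l -> Cvg (fun n => / u n) (/ l).
Proof.
  intros Hl H eps He.
  pose proof (Cnorm_gt0 l Hl) as P.
  destruct (H (Cnorm l / 2)%R) as [N HN]; [lra|].
  destruct (H (eps * (Cnorm l * (Cnorm l / 2)))%R) as [N' HN'].
  { repeat apply Rmult_lt_0_compat; lra. }
  exists (N + N')%nat; intros n Hh.
  specialize (HN n ltac:(lia)); specialize (HN' n ltac:(lia)).
  assert (L : (Cnorm l / 2 <= Cnorm (u n))%R).
  { rewrite Cnorm_sub_sym in HN; pose proof (Cnorm_sub_ge l (l - u n)).
    replace (l - (l - u n)) with (u n) in H0 by ring; lra. }
  assert (Hn : u n <> Czero) by (apply Cnorm_neq0; lra).
  assert (E : Cnorm (u n - l)%C = (Cnorm (/ u n - / l)%C * (Cnorm l * Cnorm (u n)))%R).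
  { rewrite <- !Cnorm_mul.
    replace ((/ u n - / l) * (l * u n)) with (l - u n) by (field; auto).
    apply Cnorm_sub_sym. }
  apply Rmult_lt_reg_r with (Cnorm l * (Cnorm l / 2))%R; [apply Rmult_lt_0_compat; lra|].
  eapply Rle_lt_trans; [|exact HN'].
  rewrite E; apply Rmult_le_compat_l; [apply Cnorm_ge0|].
  apply Rmult_le_compat_l; lra.
Qed.

Lemma Cvg_div u v l m : m <> Czero -> Cvg u l -> Cvg v m ->
  Cvg (fun n => u n / v n) (l / m).
Proof. intros; unfold Cdiv; apply Cvg_mul; auto; apply Cvg_inv; auto. Qed.

Lemma Cvg_comp u l (phi : nat -> nat) : (forall n, (n <= phi n)%nat) -> Cvg u l ->
  Cvg (fun n => u (phi n)) l.
Proof.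
  intros Hp H eps He; destruct (H eps He) as [N HN]; exists N; intros n Hn; apply HN.
  specialize (Hp n); lia.
Qed.

Lemma Cvg_unshift u l p : Cvg (fun n => u (n + p)%nat) l -> Cvg u l.
Proof.
  intros H eps He; destruct (H eps He) as [N HN]; exists (N + p)%nat; intros n Hn.
  replace n with (n - p + p)%nat by lia; apply HN; lia.
Qed.

Lemma Cvg_shift u l p : Cvg u l -> Cvg (fun n => u (n + p)%nat) l.
Proof. apply Cvg_comp; intros; lia. Qed.

Lemma Cvg_eventually u v l p : (forall n, (p <= n)%nat -> u n = v n) -> Cvg u l -> Cvg v l.
Proof.
  intros E H; apply Cvg_unshift with p, Cvg_ext with (fun n => u (n + p)%nat).
  - intros; apply E; lia.
  - apply Cvg_shift; auto.
Qed.

Lemma Cvg_pow q : (Cnorm q < 1)%R -> Cvg (fun n => q ^ n) Czero.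
Proof.
  intros H; apply Cvg_le with (fun n => Cnorm q ^ n)%R.
  - intros n; replace (q ^ n - Czero) with (q ^ n) by ring; rewrite Cnorm_pow; lra.
  - intros eps He; destruct (pow_lt_1_zero (Cnorm q)) with eps as [N HN]; auto.
    + rewrite Rabs_pos_eq; auto; apply Cnorm_ge0.
    + exists N; intros n Hn; unfold Rdist; rewrite Rminus_0_r; auto.
Qed.

Lemma Cvg_norm_le u l B : Cvg u l -> (forall n, (Cnorm (u n) <= B)%R) -> (Cnorm l <= B)%R.
Proof.
  intros H HB; apply Rnot_lt_le; intros L.
  destruct (H (Cnorm l - B)%R) as [N HN]; [lra|].
  specialize (HN N ltac:(lia)); rewrite Cnorm_sub_sym in HN.
  pose proof (Cnorm_sub_ge l (u N)); specialize (HB N).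
  lra.
Qed.

Lemma Cvg_sum f M : summable M -> (forall i, (Cnorm (f i) <= M i)%R) ->
  exists l, Cvg (fun n => Csum n f) l.
Proof.
  intros HM Hf.
  (* The Cauchy argument is made once, for an additive functional [p] bounded by the norm, and then
     used for both coordinates. *)
  assert (C : forall p : Cpx -> R,
    p Czero = 0%R -> (forall u v, p (u + v) = (p u + p v)%R) ->
    (forall u, (Rabs (p u) <= Cnorm u)%R) -> exists l, Un_cv (fun n => p (Csum n f)) l).
  { intros p p0 pa pn.
    assert (D : forall K m, (Rabs (p (Csum (K + m) f) - p (Csum K f)) <=
                             Rsum m (fun i => M (K + i)%nat))%R).
    { intros K m; rewrite Csum_split, pa.
      replace (p (Csum K f) + p (Csum m (fun i => f (K + i)%nat)) - p (Csum K f))%R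
        with (p (Csum m (fun i => f (K + i)%nat))) by ring.
      eapply Rle_trans; [apply pn|]; eapply Rle_trans; [apply Csum_norm|].
      apply Rsum_le; auto. }
    destruct (R_complete (fun n => p (Csum n f))) as [l Hl]; [|exists l; auto].
    intros eps He.
    destruct (summable_tail M (eps / 2)%R HM) as [K HK]; [lra|].
    exists K; intros n m Hn Hm; unfold Rdist.
    pose proof (D K (n - K)%nat) as D1; pose proof (D K (m - K)%nat) as D2.
    replace (K + (n - K))%nat with n in D1 by lia.
    replace (K + (m - K))%nat with m in D2 by lia.
    pose proof (HK (n - K)%nat); pose proof (HK (m - K)%nat).
    rewrite Rabs_minus_sym in D2.
    pose proof (Rabs_triang (p (Csum n f) - p (Csum K f)) (p (Csum K f) - p (Csum m f))) as T.
    replace (p (Csum n f) - p (Csum K f) + (p (Csum K f) - p (Csum m f)))%R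
      with (p (Csum n f) - p (Csum m f))%R in T by ring.
    lra. }
  destruct (C fst) as [x Hx]; [reflexivity|reflexivity|apply Cnorm_fst|].
  destruct (C snd) as [y Hy]; [reflexivity|reflexivity|apply Cnorm_snd|].
  exists (x, y); apply Cvg_Ccv; split; auto.
Qed.

(** Dominated convergence for arrays whose row length grows with N. The conclusion is about a
    difference, so the sum of [g] needs no name and no separate proof of convergence. *)
Lemma tannery (f : nat -> nat -> Cpx) (g : nat -> Cpx) (M : nat -> R) :
  summable M -> (forall N i, (i < N)%nat -> (Cnorm (f N i) <= M i)%R) ->
  (forall i, Cvg (fun N => f N i) (g i)) ->
  Cvg (fun N => Csum N (f N) - Csum N g) Czero.
Proof.
  intros HM Hf Hg eps He.
  assert (Hb : forall i, (Cnorm (g i) <= M i)%R).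
  (* Domination is assumed for i < N only, so the sequence is started at N = S i before passing to
     the limit. *)
  { intros i; apply Cvg_norm_le with (fun n => f (n + S i)%nat i).
    - apply (Cvg_shift (fun n => f n i)); auto.
    - intros; apply Hf; lia. }
  (* The tail of the difference is at most twice the tail of [M], since [g] inherits the bound; the
     initial block uses the other half of [eps]. *)
  destruct (summable_tail M (eps / 4)%R HM) as [K HK]; [lra|].
  assert (Z : Cvg (fun N => Csum K (fun i => f N i - g i)) Czero).
  { clear HK; induction K; simpl; [apply Cvg_const|].
    replace Czero with (Czero + (g K - g K)) by ring.
    apply Cvg_add; auto; apply Cvg_sub; auto; apply Cvg_const. }
  destruct (Z (eps / 2)%R) as [N HN]; [lra|].
  exists (N + K)%nat; intros n Hn.
  specialize (HN n ltac:(lia)).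
  rewrite <- Csum_minus.
  replace n with (K + (n - K))%nat at 1 by lia; rewrite Csum_split.
  set (A := Csum K _) in *.
  set (B := Csum (n - K) _).
  replace (A + B - Czero) with ((A - Czero) + B) by ring.
  eapply Rle_lt_trans; [apply Cnorm_add|].
  assert (Cnorm B <= 2 * Rsum (n - K) (fun i => M (K + i)%nat))%R.
  { unfold B; eapply Rle_trans; [apply Csum_norm|]; rewrite <- Rsum_scal.
    apply Rsum_le; intros i Hi.
    eapply Rle_trans; [apply Cnorm_sub|].
    specialize (Hf n (K + i)%nat ltac:(lia)); specialize (Hb (K + i)%nat); lra. }
  specialize (HK (n - K)%nat); lra.
Qed.

(** * The q-shifted factorial *)

Lemma qpoch_S x q n : qpoch x q (S n) = qpoch x q n * (Cone - x * q ^ n).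
Proof. reflexivity. Qed.

Lemma qpoch_add x q n m : qpoch x q (n + m) = qpoch x q n * qpoch (x * q ^ n) q m.
Proof.
  induction m; simpl.
  - rewrite Nat.add_0_r; ring.
  - rewrite Nat.add_succ_r; simpl; rewrite IHm, Cpow_add; ring.
Qed.

Lemma qpoch_first x q n : qpoch x q (S n) = (Cone - x) * qpoch (x * q) q n.
Proof.
  change (S n) with (1 + n)%nat; rewrite qpoch_add; simpl.
  replace (x * (q * Cone)) with (x * q) by ring; ring.
Qed.

Definition qnz (x q : Cpx) : Prop := forall n, qpoch x q n <> Czero.

Lemma qnz_factor x q n : qnz x q -> Cone - x * q ^ n <> Czero.
Proof. intros H E; apply (H (S n)); rewrite qpoch_S, E; ring. Qed.

Lemma qnz_factor0 x q : qnz x q -> Cone - x <> Czero.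
Proof.
  intros H; replace (Cone - x) with (Cone - x * q ^ 0) by (simpl; ring).
  apply qnz_factor; auto.
Qed.

Lemma qnz_shift x q i : qnz x q -> qnz (x * q ^ i) q.
Proof.
  intros H n E; apply (H (i + n)%nat); rewrite qpoch_add, E; ring.
Qed.

Lemma qnz_mulq x q : qnz x q -> qnz (x * q) q.
Proof.
  intros H; replace (x * q) with (x * q ^ 1) by (simpl; ring); apply qnz_shift; auto.
Qed.

Lemma qpoch_mulq x q n : qnz x q ->
  qpoch (x * q) q n = qpoch x q n * (Cone - x * q ^ n) / (Cone - x).
Proof.
  intros H; rewrite <- qpoch_S, qpoch_first; field; apply (qnz_factor0 x q); auto.
Qed.

Lemma one_sub_neq0 x : (Cnorm x < 1)%R -> Cone - x <> Czero.
Proof.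
  intros H; apply Cnorm_neq0; pose proof (Cnorm_sub_ge Cone x) as P.
  rewrite Cnorm_1 in P; lra.
Qed.

Lemma Cnorm_pow_le1 q n : (Cnorm q < 1)%R -> (Cnorm (q ^ n) <= 1)%R.
Proof.
  intros H; rewrite Cnorm_pow; rewrite <- (pow1 n).
  apply pow_incr; split; [apply Cnorm_ge0|lra].
Qed.

Lemma Cnorm_mulpow_le x q n : (Cnorm q < 1)%R -> (Cnorm (x * q ^ n)%C <= Cnorm x)%R.
Proof.
  intros H; rewrite Cnorm_mul; pose proof (Cnorm_pow_le1 q n H).
  pose proof (Cnorm_ge0 x); nra.
Qed.

Lemma qnz_small x q : (Cnorm x < 1)%R -> (Cnorm q < 1)%R -> qnz x q.
Proof.
  intros Hx Hq n; induction n; [apply Cone_neq0|].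
  rewrite qpoch_S; apply Cmul_neq0; auto; apply one_sub_neq0.
  eapply Rle_lt_trans; [apply Cnorm_mulpow_le|]; auto.
Qed.

(** Each factor is at most 1 + B |q|^i <= exp (B |q|^i), and the exponents sum to at most B / (1 -
    |q|). The constant depends on neither x nor n. *)
Lemma qpoch_upper q B : (Cnorm q < 1)%R -> exists C, (0 < C)%R /\
  forall x n, (Cnorm x <= B)%R -> (Cnorm (qpoch x q n) <= C)%R.
Proof.
  intros Hq; pose proof (Cnorm_ge0 q) as Q0.
  destruct (Rle_or_lt 0 B) as [HB|HB].
  2:{ exists 1%R; split; [lra|]; intros x n Hx; pose proof (Cnorm_ge0 x); lra. }
  exists (exp (B * / (1 - Cnorm q))); split; [apply exp_pos|].
  intros x n Hx.
  apply Rle_trans with (exp (B * Rsum n (fun i => Cnorm q ^ i)%R)).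
  - induction n; simpl.
    + rewrite Cnorm_1, Rmult_0_r, exp_0; lra.
    + rewrite Cnorm_mul, Rmult_plus_distr_l, exp_plus.
      apply Rmult_le_compat; try apply Cnorm_ge0; auto.
      eapply Rle_trans; [apply Cnorm_sub|].
      rewrite Cnorm_1, Cnorm_mul, Cnorm_pow.
      eapply Rle_trans; [|apply exp_ineq1_le].
      apply Rplus_le_compat_l, Rmult_le_compat_r; auto; apply pow_le; auto.
  - destruct (Rle_lt_or_eq_dec _ _ (Rmult_le_compat_l B _ _ HB
      (Rsum_geom_le (Cnorm q) n (conj Q0 Hq)))) as [L|L].
    + left; apply exp_increasing; auto.
    + rewrite L; lra.
Qed.

(** Weierstrass' inequality: a product of factors 1 - t_i is at least 1 minus the sum of the t_i as
    long as that sum stays below 1. *)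
Lemma qpoch_near1 x q n : (Cnorm q < 1)%R -> (Cnorm x * / (1 - Cnorm q) <= / 2)%R ->
  (/ 2 <= Cnorm (qpoch x q n))%R.
Proof.
  intros Hq Hx; pose proof (Cnorm_ge0 q) as Q0; pose proof (Cnorm_ge0 x) as X0.
  assert (G : forall m, (Cnorm x * Rsum m (fun i => Cnorm q ^ i)%R <= / 2)%R).
  { intros m; eapply Rle_trans; [|exact Hx].
    apply Rmult_le_compat_l; auto; apply Rsum_geom_le; auto. }
  assert (I : (1 - Cnorm x * Rsum n (fun i => Cnorm q ^ i) <= Cnorm (qpoch x q n))%R).
  { induction n; simpl; [rewrite Cnorm_1; lra|].
    rewrite Cnorm_mul.
    set (s := Rsum n _) in *; set (t := (Cnorm q ^ n)%R).
    assert (T0 : (0 <= t)%R) by (apply pow_le; auto).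
    assert (S0 : (0 <= s)%R) by (apply Rsum_ge0; intros; apply pow_le; auto).
    pose proof (G n) as G1; fold s in G1.
    pose proof (G (S n)) as G2; simpl in G2; fold s t in G2.
    assert (F : (1 - Cnorm x * t <= Cnorm (Cone - x * q ^ n)%C)%R).
    { pose proof (Cnorm_sub_ge Cone (x * q ^ n)) as P.
      rewrite Cnorm_1, Cnorm_mul, Cnorm_pow in P; exact P. }
    assert (0 <= Cnorm x * t)%R by (apply Rmult_le_pos; auto).
    assert (0 <= Cnorm x * s)%R by (apply Rmult_le_pos; auto).
    apply Rle_trans with ((1 - Cnorm x * s) * (1 - Cnorm x * t))%R; [nra|].
    apply Rmult_le_compat; try lra. }
  pose proof (G n); lra.
Qed.

(** A nonzero initial product times a tail that [qpoch_near1] keeps away from 0. *)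
Lemma qpoch_lower x q : (Cnorm q < 1)%R -> qnz x q ->
  exists d, (0 < d)%R /\ forall n, (d <= Cnorm (qpoch x q n))%R.
Proof.
  intros Hq Hx; pose proof (Cnorm_ge0 x) as X0; pose proof (Cnorm_ge0 q) as Q0.
  destruct (qpoch_upper q (Cnorm x) Hq) as [C [C0 HC]].
  assert (HC' : forall i n, (Cnorm (qpoch (x * q ^ i)%C q n) <= C)%R).
  { intros i n; apply HC, Cnorm_mulpow_le; auto. }
  (* [m] makes |x q^m| / (1 - |q|) at most 1/2; the added 1 guards against x = 0. *)
  destruct (Cvg_pow q Hq (/ 2 * (1 - Cnorm q) / (Cnorm x + 1))%R) as [m Hm].
  { apply Rdiv_lt_0_compat; lra. }
  specialize (Hm m (le_n m)).
  replace (q ^ m - Czero) with (q ^ m) in Hm by ring.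
  assert (N1 : forall n, (/ 2 <= Cnorm (qpoch (x * q ^ m)%C q n))%R).
  { intros n; apply qpoch_near1; auto; rewrite Cnorm_mul.
    apply Rmult_le_reg_r with (1 - Cnorm q)%R; [lra|].
    rewrite Rmult_assoc, Rinv_l, Rmult_1_r by lra.
    apply Rle_trans with ((Cnorm x + 1) * Cnorm (q ^ m))%R.
    - apply Rmult_le_compat_r; [apply Cnorm_ge0|lra].
    - left; apply (Rmult_lt_compat_l (Cnorm x + 1)) in Hm; [|lra].
      replace ((Cnorm x + 1) * (/ 2 * (1 - Cnorm q) / (Cnorm x + 1)))%R
        with (/ 2 * (1 - Cnorm q))%R in Hm by (field; lra); lra. }
  pose proof (Cnorm_gt0 _ (Hx m)) as P.
  exists (Rmin (Cnorm (qpoch x q m) * / 2) (Cnorm (qpoch x q m) * / C)); split.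
  - assert (0 < / C)%R by (apply Rinv_0_lt_compat; auto).
    apply Rmin_glb_lt; apply Rmult_lt_0_compat; lra.
  - intros n; destruct (le_lt_dec m n) as [L|L].
    + eapply Rle_trans; [apply Rmin_l|].
      replace n with (m + (n - m))%nat by lia; rewrite qpoch_add, Cnorm_mul.
      apply Rmult_le_compat_l; [lra|apply N1].
    (* For n < m the factors missing from (x;q)_m have product at most [C], so (x;q)_n has norm at
       least |(x;q)_m| / C. *)
    + eapply Rle_trans; [apply Rmin_r|].
      replace m with (n + (m - n))%nat by lia; rewrite qpoch_add, Cnorm_mul.
      apply Rmult_le_reg_r with C; auto.
      rewrite Rmult_assoc, Rinv_l, Rmult_1_r by lra.
      apply Rmult_le_compat_l; [apply Cnorm_ge0|apply HC'].
Qed.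

(** The index type is left free so that one bound can be uniform in pairs or triples of indices. *)
Definition Cbounded {I : Type} (f : I -> Cpx) : Prop :=
  exists B, (0 < B)%R /\ forall i, (Cnorm (f i) <= B)%R.

Lemma Cbounded_mul {I} (f g : I -> Cpx) : Cbounded f -> Cbounded g -> Cbounded (fun i => f i * g i).
Proof.
  intros [B [B0 HB]] [B' [B0' HB']]; exists (B * B')%R; split.
  - apply Rmult_lt_0_compat; auto.
  - intros i; rewrite Cnorm_mul; apply Rmult_le_compat; auto; apply Cnorm_ge0.
Qed.

Lemma Cbounded_const {I} (c : Cpx) : Cbounded (fun _ : I => c).
Proof. exists (Cnorm c + 1)%R; pose proof (Cnorm_ge0 c); split; [lra|intros; lra]. Qed.

Lemma Cbounded_add {I} (f g : I -> Cpx) : Cbounded f -> Cbounded g -> Cbounded (fun i => f i + g i).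
Proof.
  intros [B [B0 HB]] [B' [B0' HB']]; exists (B + B')%R; split; [lra|].
  intros i; eapply Rle_trans; [apply Cnorm_add|]; apply Rplus_le_compat; auto.
Qed.

Lemma Cbounded_opp {I} (f : I -> Cpx) : Cbounded f -> Cbounded (fun i => - f i).
Proof. intros [B [B0 HB]]; exists B; split; auto; intros; rewrite Cnorm_opp; auto. Qed.

Lemma Cbounded_sub {I} (f g : I -> Cpx) : Cbounded f -> Cbounded g -> Cbounded (fun i => f i - g i).
Proof. intros; unfold Csub; apply Cbounded_add; auto; apply Cbounded_opp; auto. Qed.

Lemma Cbounded_pow {I} q (e : I -> nat) : (Cnorm q < 1)%R -> Cbounded (fun i => q ^ (e i)).
Proof. intros H; exists 1%R; split; [lra|]; intros; apply Cnorm_pow_le1; auto. Qed.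

Lemma Cbounded_ext {I} (f g : I -> Cpx) : (forall i, f i = g i) -> Cbounded f -> Cbounded g.
Proof. intros E [B [B0 HB]]; exists B; split; auto; intros; rewrite <- E; auto. Qed.

Lemma Cbounded_qpoch {I} x q (e n : I -> nat) : (Cnorm q < 1)%R ->
  Cbounded (fun i => qpoch (x * q ^ e i) q (n i)).
Proof.
  intros Hq; destruct (qpoch_upper q (Cnorm x) Hq) as [C [C0 HC]].
  exists C; split; auto; intros i; apply HC, Cnorm_mulpow_le; auto.
Qed.

(** Uniformity in the shift e comes from 1/(x q^e;q)_n = (x;q)_e / (x;q)_(e+n): one upper and one
    lower bound at the same x suffice. *)
Lemma Cbounded_inv_qpoch {I} x q (e n : I -> nat) : (Cnorm q < 1)%R -> qnz x q ->
  Cbounded (fun i => / qpoch (x * q ^ e i) q (n i)).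
Proof.
  intros Hq Hx.
  destruct (qpoch_lower x q Hq Hx) as [d [d0 Hd]].
  destruct (qpoch_upper q (Cnorm x) Hq) as [C [C0 HC]].
  exists (C * / d)%R; split.
  - apply Rmult_lt_0_compat; auto; apply Rinv_0_lt_compat; auto.
  - intros i.
    replace (/ qpoch (x * q ^ e i) q (n i))
      with (qpoch x q (e i) * / qpoch x q (e i + n i)).
    + rewrite Cnorm_mul; apply Rmult_le_compat; try apply Cnorm_ge0.
      * apply HC; lra.
      * rewrite Cnorm_inv by apply Hx; apply Rinv_le_contravar; auto.
    + rewrite qpoch_add; field; split; [apply qnz_shift; auto|apply Hx].
Qed.

(** The increments of (x;q)_n are -x q^n (x;q)_n, dominated by a geometric sequence because (x;q)_n
    is bounded. *)
Lemma qpoch_cvg x q : (Cnorm q < 1)%R -> Cvg (qpoch x q) (qpinf x q).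
Proof.
  intros Hq; pose proof (Cnorm_ge0 q) as Q0.
  destruct (qpoch_upper q (Cnorm x) Hq) as [C [C0 HC]].
  destruct (Cvg_sum (fun i => - x * q ^ i * qpoch x q i)
              (fun i => (Cnorm x * C) * Cnorm q ^ i)%R) as [l Hl].
  - apply summable_scal; [|apply summable_geom; lra].
    apply Rmult_le_pos; [apply Cnorm_ge0|lra].
  - intros i; rewrite !Cnorm_mul, Cnorm_opp, Cnorm_pow.
    specialize (HC x i (Rle_refl _)).
    rewrite Rmult_assoc, Rmult_assoc; apply Rmult_le_compat_l; [apply Cnorm_ge0|].
    rewrite Rmult_comm; apply Rmult_le_compat_r; auto; apply pow_le; auto.
  - assert (H : Cvg (qpoch x q) (Cone + l)).
    { apply Cvg_ext with (fun n => Cone + Csum n (fun i => - x * q ^ i * qpoch x q i)).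
      - induction n; simpl; [ring|rewrite <- IHn; ring].
      - apply Cvg_add; auto; apply Cvg_const. }
    unfold qpinf; rewrite (Clim_eq _ _ H); auto.
Qed.

Lemma qpinf_eq x q l : Cvg (qpoch x q) l -> qpinf x q = l.
Proof. apply Clim_eq. Qed.

Lemma qpinf_split x q n : (Cnorm q < 1)%R -> qpinf x q = qpoch x q n * qpinf (x * q ^ n) q.
Proof.
  intros Hq; apply qpinf_eq, Cvg_unshift with n.
  apply Cvg_ext with (fun m => qpoch x q n * qpoch (x * q ^ n) q m).
  - intros m; rewrite <- qpoch_add; f_equal; lia.
  - apply Cvg_mul; [apply Cvg_const|apply qpoch_cvg; auto].
Qed.

Lemma qpinf_first x q : (Cnorm q < 1)%R -> qpinf x q = (Cone - x) * qpinf (x * q) q.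
Proof.
  intros Hq; rewrite (qpinf_split x q 1 Hq); simpl; f_equal; [ring|f_equal; ring].
Qed.

Lemma qnz_of_qpinf x q : (Cnorm q < 1)%R -> qpinf x q <> Czero -> qnz x q.
Proof. intros Hq H n E; apply H; rewrite (qpinf_split x q n Hq), E; ring. Qed.

Lemma qpinf_neq0 x q : (Cnorm q < 1)%R -> qnz x q -> qpinf x q <> Czero.
Proof.
  intros Hq Hx E.
  destruct (qpoch_lower x q Hq Hx) as [d [d0 Hd]].
  destruct (qpoch_cvg x q Hq d d0) as [N HN]; specialize (HN N (le_n N)).
  rewrite E in HN; replace (qpoch x q N - Czero) with (qpoch x q N) in HN by ring.
  specialize (Hd N); lra.
Qed.

Lemma qpoch_cvg1 y q j : (Cnorm q < 1)%R -> Cvg (fun i => qpoch (y * q ^ i) q j) Cone.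
Proof.
  intros Hq; induction j; simpl; [apply Cvg_const|].
  replace Cone with (Cone * (Cone - y * q ^ j * Czero)) at 1 by ring.
  apply Cvg_mul; auto.
  apply Cvg_ext with (fun i => Cone - y * q ^ j * q ^ i); [intros; ring|].
  apply Cvg_sub; [apply Cvg_const|].
  apply Cvg_mul; [apply Cvg_const|apply Cvg_pow; auto].
Qed.

(** * A telescoping very-well-poised sum *)

Section VeryWellPoised.

Variables (q d z : Cpx).
Hypotheses (Hq : (Cnorm q < 1)%R) (Hz : z <> Czero).

(* The term of index p + 1 of the 6phi5 with parameters A = d a c^2, B = z c,
   C = c, D = d and argument Aq/(BCD) = aq/z, divided by 1 - c in order to
   allow c = 1. *)
Definition vwp_term (c a : Cpx) (p : nat) : Cpx :=
  (Cone - d * a * c * c * q ^ S p * q ^ S p) * qpoch (d * a * c * c * q) q p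
  * qpoch (z * c) q (S p) * qpoch (c * q) q p * qpoch d q (S p)
  / (qpoch q q (S p) * qpoch (d * a * c * q / z) q (S p) * qpoch (d * a * c * q) q (S p)
     * qpoch (a * c * c * q) q (S p)) * (a * q / z) ^ S p.

(* The quotient of the values of the 6phi5 at a and at a q. *)
Definition vwp_ratio (c a : Cpx) : Cpx :=
  (Cone - d * a * c * c * q) * (Cone - d * a * q / z) * (Cone - a * c * q / z)
  * (Cone - a * c * q)
  / ((Cone - d * a * c * q / z) * (Cone - d * a * c * q) * (Cone - a * c * c * q)
     * (Cone - a * q / z)).

(** Certificate of Wilf-Zeilberger type for [vwp_step]. It carries the same division by 1 - c as
    [vwp_term], hence makes sense at c = 1, where its value at p = 0 is the summand of the
    Lambert-type series. *)
Definition vwp_cert (c a : Cpx) (p : nat) : Cpx :=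
  (a * q / z) ^ S p * qpoch (z * c) q (S p) * qpoch (c * q) q p * qpoch d q (S p)
  * qpoch (d * a * c * c * q) q p * (Cone - d * a * a * c * c * q * q ^ S p / z)
  / ((Cone - a * q / z) * qpoch q q p * qpoch (d * a * c * q / z) q (S p)
     * qpoch (d * a * c * q) q (S p) * qpoch (a * c * c * q) q (S p)).

(** This is [vwp_step] stripped of the q-factorials common to its four terms, with [Q] for q^p, so
    that only a rational identity is left to [field]. *)
Lemma vwp_rational c a Q :
  Cone - q * Q <> Czero -> Cone - a * q / z <> Czero ->
  Cone - d * a * c * q / z * Q <> Czero -> Cone - d * a * c * q / z * (q * Q) <> Czero ->
  Cone - d * a * c * q * Q <> Czero -> Cone - d * a * c * q * (q * Q) <> Czero ->
  Cone - a * c * c * q * Q <> Czero -> Cone - a * c * c * q * (q * Q) <> Czero ->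
  (Cone - d * a * c * c * (q * Q) * (q * Q)) * (Cone - z * c * Q) * (Cone - d * Q)
  / ((Cone - q * Q) * (Cone - d * a * c * q / z * Q) * (Cone - d * a * c * q * Q)
     * (Cone - a * c * c * q * Q)) * (a * q / z)
  - (Cone - d * a * q / z) * (Cone - a * c * q / z) * (Cone - a * c * q)
    * (Cone - d * a * c * c * q * (q * Q) * (q * Q)) * (Cone - d * a * c * c * q * Q)
    * (Cone - z * c * Q) * (Cone - d * Q) * (a * q / z * (q * Q))
    / ((Cone - a * q / z) * (Cone - q * Q)
       * ((Cone - d * a * c * q / z * Q) * (Cone - d * a * c * q / z * (q * Q)))
       * ((Cone - d * a * c * q * Q) * (Cone - d * a * c * q * (q * Q)))
       * ((Cone - a * c * c * q * Q) * (Cone - a * c * c * q * (q * Q))))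
  = (a * q / z) * (Cone - z * c * Q) * (Cone - d * Q)
    * (Cone - d * a * a * c * c * q * (q * Q) / z)
    / ((Cone - a * q / z) * (Cone - d * a * c * q / z * Q) * (Cone - d * a * c * q * Q)
       * (Cone - a * c * c * q * Q))
  - (a * q / z) * (a * q / z) * (Cone - z * c * Q) * (Cone - z * c * (q * Q))
    * (Cone - c * q * Q) * (Cone - d * Q) * (Cone - d * (q * Q))
    * (Cone - d * a * c * c * q * Q) * (Cone - d * a * a * c * c * q * (q * (q * Q)) / z)
    / ((Cone - a * q / z) * (Cone - q * Q)
       * ((Cone - d * a * c * q / z * Q) * (Cone - d * a * c * q / z * (q * Q)))
       * ((Cone - d * a * c * q * Q) * (Cone - d * a * c * q * (q * Q)))
       * ((Cone - a * c * c * q * Q) * (Cone - a * c * c * q * (q * Q)))).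
Proof.
  intros H1 H2 H3 H4 H5 H6 H7 H8.
  (* [field] clears the inner divisions by z, so the nonvanishing conditions are needed in the form
     z - ... as well. *)
  assert (K3 : z - d * a * c * q * Q <> Czero).
  { apply sub_neq0_of_div; auto; intros E; apply H3; rewrite <- E; field; auto. }
  assert (K4 : z - d * a * c * q * (q * Q) <> Czero).
  { apply sub_neq0_of_div; auto; intros E; apply H4; rewrite <- E; field; auto. }
  apply sub_neq0_of_div in H2; auto.
  field.
  repeat split; auto.
Qed.

Lemma vwp_step c a p :
  qnz (d * a * c * q / z) q -> qnz (d * a * c * q) q -> qnz (a * c * c * q) q ->
  Cone - a * q / z <> Czero -> Cone - d * a * c * c * q <> Czero ->
  vwp_term c a p - vwp_ratio c a * vwp_term c (a * q) p = vwp_cert c a p - vwp_cert c a (S p).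
Proof.
  intros H1 H2 H3 H4 H5.
  assert (Hqq : qnz q q) by (apply qnz_small; auto).
  assert (G5 : qpoch (d * (a * q) * c * c * q) q p =
               qpoch (d * a * c * c * q) q p * (Cone - d * a * c * c * q * q ^ p)
               / (Cone - d * a * c * c * q)).
  { replace (d * (a * q) * c * c * q) with (d * a * c * c * q * q) by ring.
    rewrite <- qpoch_S, qpoch_first; field; auto. }
  assert (G1 : qpoch (d * (a * q) * c * q / z) q (S p) =
               qpoch (d * a * c * q / z) q p * (Cone - d * a * c * q / z * q ^ p)
               * (Cone - d * a * c * q / z * q ^ S p) / (Cone - d * a * c * q / z)).
  { replace (d * (a * q) * c * q / z) with (d * a * c * q / z * q) by (field; auto).
    rewrite qpoch_mulq by auto; reflexivity. }
  assert (G2 : qpoch (d * (a * q) * c * q) q (S p) =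
               qpoch (d * a * c * q) q p * (Cone - d * a * c * q * q ^ p)
               * (Cone - d * a * c * q * q ^ S p) / (Cone - d * a * c * q)).
  { replace (d * (a * q) * c * q) with (d * a * c * q * q) by ring.
    rewrite qpoch_mulq by auto; reflexivity. }
  assert (G3 : qpoch (a * q * c * c * q) q (S p) =
               qpoch (a * c * c * q) q p * (Cone - a * c * c * q * q ^ p)
               * (Cone - a * c * c * q * q ^ S p) / (Cone - a * c * c * q)).
  { replace (a * q * c * c * q) with (a * c * c * q * q) by ring.
    rewrite qpoch_mulq by auto; reflexivity. }
  assert (G4 : (a * q * q / z) ^ S p = a * q / z * (q ^ S p) * (a * q / z) ^ p).
  { replace (a * q * q / z) with (q * (a * q / z)) by (field; auto).
    rewrite Cpow_mul; simpl; ring. }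
  pose proof (qnz_factor _ _ p Hqq) as F0.
  pose proof (qnz_factor _ _ p H1) as F1. pose proof (qnz_factor _ _ (S p) H1) as F1'.
  pose proof (qnz_factor _ _ p H2) as F2. pose proof (qnz_factor _ _ (S p) H2) as F2'.
  pose proof (qnz_factor _ _ p H3) as F3. pose proof (qnz_factor _ _ (S p) H3) as F3'.
  pose proof (qnz_factor0 _ _ H1) as E1. pose proof (qnz_factor0 _ _ H2) as E2.
  pose proof (qnz_factor0 _ _ H3) as E3.
  pose proof (vwp_rational c a (q ^ p) F0 H4 F1 F1' F2 F2' F3 F3') as V.
  unfold vwp_term, vwp_cert, vwp_ratio; rewrite G1, G2, G3, G4, G5.
  rewrite !qpoch_S.
  specialize (Hqq p); specialize (H1 p); specialize (H2 p); specialize (H3 p).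
  change ((a * q / z) ^ S (S p)) with (a * q / z * (a * q / z * (a * q / z) ^ p)).
  change ((a * q / z) ^ S p) with (a * q / z * (a * q / z) ^ p).
  change (q ^ S (S p)) with (q * (q * q ^ p)).
  change (q ^ S p) with (q * q ^ p) in *.
  set (P1 := qpoch (d * a * c * c * q) q p).
  set (P2 := qpoch (z * c) q p).
  set (P3 := qpoch (c * q) q p).
  set (P4 := qpoch d q p).
  set (Q1 := qpoch (d * a * c * q / z) q p) in *.
  set (Q2 := qpoch (d * a * c * q) q p) in *.
  set (Q3 := qpoch (a * c * c * q) q p) in *.
  set (Q0 := qpoch q q p) in *.
  set (y1 := d * a * c * q / z) in *.
  set (y2 := d * a * c * q) in *.
  set (y3 := a * c * c * q) in *.
  set (x := a * q / z) in *.
  set (X := x ^ p).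
  set (Q := q ^ p) in *.
  replace (a * q * c * q / z) with (a * c * q / z * q) by (field; auto).
  replace (d * (a * q) * (a * q) * c * c * q * (q * Q) / z)
    with (d * a * a * c * c * q * (q * Q) / z * (q * q)) by (field; auto).
  (* [K] is the factor shared by all four terms; the quotient by it is [vwp_rational]. *)
  set (K := P1 * P2 * P3 * P4 / (Q1 * Q2 * Q3 * Q0) * X).
  match type of V with ?u - ?v = ?w - ?t =>
    transitivity (K * u - K * v); [|transitivity (K * (u - v)); [ring|];
      rewrite V; transitivity (K * w - K * t); [ring|]]
  end.
  - unfold K; f_equal; field; repeat split; auto.
  - unfold K; f_equal; field; repeat split; auto.
Qed.

(** Conditions at c = 1 only: replacing c by q^j or a by a q^i multiplies the arguments by powers of
    q, and [qnz] is stable under that. *)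
Definition vwp_regular (a : Cpx) : Prop :=
  qnz (d * a * q / z) q /\ qnz (d * a * q) q /\ qnz (a * q) q /\ (Cnorm (a * q / z)%C < 1)%R.

Lemma vwp_regular_shift a i : vwp_regular a -> vwp_regular (a * q ^ i).
Proof.
  intros [H1 [H2 [H3 H4]]]; repeat split.
  - replace (d * (a * q ^ i) * q / z) with (d * a * q / z * q ^ i) by (field; auto).
    apply qnz_shift; auto.
  - replace (d * (a * q ^ i) * q) with (d * a * q * q ^ i) by ring; apply qnz_shift; auto.
  - replace (a * q ^ i * q) with (a * q * q ^ i) by ring; apply qnz_shift; auto.
  - replace (a * q ^ i * q / z) with (a * q / z * q ^ i) by (field; auto).
    eapply Rle_lt_trans; [apply Cnorm_mulpow_le|]; auto.
Qed.

Lemma vwp_step_pow a j p : vwp_regular a ->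
  vwp_term (q ^ j) a p - vwp_ratio (q ^ j) a * vwp_term (q ^ j) (a * q) p
  = vwp_cert (q ^ j) a p - vwp_cert (q ^ j) a (S p).
Proof.
  intros [H1 [H2 [H3 H4]]]; apply vwp_step.
  - replace (d * a * q ^ j * q / z) with (d * a * q / z * q ^ j) by (field; auto).
    apply qnz_shift; auto.
  - replace (d * a * q ^ j * q) with (d * a * q * q ^ j) by ring; apply qnz_shift; auto.
  - replace (a * q ^ j * q ^ j * q) with (a * q * q ^ (j + j)) by (rewrite Cpow_add; ring).
    apply qnz_shift; auto.
  - apply one_sub_neq0; auto.
  - replace (d * a * q ^ j * q ^ j * q) with (d * a * q * q ^ (j + j))
      by (rewrite Cpow_add; ring).
    apply qnz_factor; auto.
Qed.

(** Uniform in all three indices: j for dominating the rows, p for summability, i for the limit a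
    q^i -> 0. The decay in i comes from the last factor, where q^i is raised to the power p + 1 >=
    1. *)
Lemma vwp_term_bound a : vwp_regular a -> exists K, (0 < K)%R /\ forall i j p,
  (Cnorm (vwp_term (q ^ j)%C (a * q ^ i)%C p) <= K * Cnorm q ^ i * Cnorm (a * q / z)%C ^ p)%R.
Proof.
  intros [H1 [H2 [H3 H4]]].
  assert (B : Cbounded (fun t : nat * nat * nat => let '(i, j, p) := t in
    (Cone - d * a * q ^ (i + j + j + S p + S p))
    * qpoch (d * a * q * q ^ (i + j + j)) q p * qpoch (z * q ^ j) q (S p)
    * qpoch (q * q ^ j) q p * qpoch (d * q ^ 0) q (S p)
    * (/ qpoch (q * q ^ 0) q (S p) * / qpoch (d * a * q / z * q ^ (i + j)) q (S p)
       * / qpoch (d * a * q * q ^ (i + j)) q (S p)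
       * / qpoch (a * q * q ^ (i + j + j)) q (S p)))).
  { apply Cbounded_ext with (fun t : nat * nat * nat =>
      (Cone - d * a * q ^ (fst (fst t) + snd (fst t) + snd (fst t) + S (snd t) + S (snd t)))
      * qpoch (d * a * q * q ^ (fst (fst t) + snd (fst t) + snd (fst t))) q (snd t)
      * qpoch (z * q ^ (snd (fst t))) q (S (snd t))
      * qpoch (q * q ^ (snd (fst t))) q (snd t) * qpoch (d * q ^ 0) q (S (snd t))
      * (/ qpoch (q * q ^ 0) q (S (snd t))
         * / qpoch (d * a * q / z * q ^ (fst (fst t) + snd (fst t))) q (S (snd t))
         * / qpoch (d * a * q * q ^ (fst (fst t) + snd (fst t))) q (S (snd t))
         * / qpoch (a * q * q ^ (fst (fst t) + snd (fst t) + snd (fst t))) q (S (snd t)))).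
    { intros [[i j] p]; reflexivity. }
    assert (Hqq : qnz q q) by (apply qnz_small; auto).
    repeat match goal with
      | |- Cbounded (fun t => @?f t * @?g t) => apply Cbounded_mul
      end;
      try (apply Cbounded_qpoch; auto);
      try (apply (Cbounded_qpoch d q (fun _ => O) (fun t : nat * nat * nat => S (snd t))); auto);
      try (apply (Cbounded_inv_qpoch q q (fun _ => O) (fun t : nat * nat * nat => S (snd t))); auto);
      try (apply Cbounded_inv_qpoch; auto).
    apply Cbounded_sub; [apply Cbounded_const|apply Cbounded_mul; [apply Cbounded_const|]].
    apply Cbounded_pow; auto. }
  destruct B as [K [K0 HK]]; exists K; split; auto.
  intros i j p; specialize (HK (i, j, p)); simpl in HK.
  assert (E : vwp_term (q ^ j) (a * q ^ i) p =
    (Cone - d * a * q ^ (i + j + j + S p + S p))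
    * qpoch (d * a * q * q ^ (i + j + j)) q p * qpoch (z * q ^ j) q (S p)
    * qpoch (q * q ^ j) q p * qpoch (d * q ^ 0) q (S p)
    * (/ qpoch (q * q ^ 0) q (S p) * / qpoch (d * a * q / z * q ^ (i + j)) q (S p)
       * / qpoch (d * a * q * q ^ (i + j)) q (S p)
       * / qpoch (a * q * q ^ (i + j + j)) q (S p)) * (a * q / z * q ^ i) ^ S p).
  { unfold vwp_term.
    replace (d * (a * q ^ i) * q ^ j * q ^ j * q ^ S p * q ^ S p)
      with (d * a * q ^ (i + j + j + S p + S p)) by (rewrite !Cpow_add; ring).
    replace (d * (a * q ^ i) * q ^ j * q ^ j * q) with (d * a * q * q ^ (i + j + j))
      by (rewrite !Cpow_add; ring).
    replace (q ^ j * q) with (q * q ^ j) by ring.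
    replace (d * (a * q ^ i) * q ^ j * q / z) with (d * a * q / z * q ^ (i + j))
      by (rewrite !Cpow_add; field; auto).
    replace (d * (a * q ^ i) * q ^ j * q) with (d * a * q * q ^ (i + j))
      by (rewrite !Cpow_add; ring).
    replace (a * q ^ i * q ^ j * q ^ j * q) with (a * q * q ^ (i + j + j))
      by (rewrite !Cpow_add; ring).
    replace (a * q ^ i * q / z) with (a * q / z * q ^ i) by (field; auto).
    replace (d * q ^ 0) with d by (simpl; ring).
    replace (q * q ^ 0) with q by (simpl; ring).
    field; repeat split; try (apply qnz_shift; auto).
    apply qnz_small; auto. }
  rewrite E, Cnorm_mul, Rmult_assoc.
  apply Rmult_le_compat; try apply Cnorm_ge0; auto.
  rewrite Cnorm_pow, Cnorm_mul, Cnorm_pow; simpl.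
  pose proof (Cnorm_ge0 (a * q / z)) as X0.
  set (x := Cnorm (a * q / z)%C) in *.
  assert (Y0 : (0 <= Cnorm q ^ i)%R) by (apply pow_le, Cnorm_ge0).
  assert (Y1 : (Cnorm q ^ i <= 1)%R).
  { rewrite <- (pow1 i); apply pow_incr; split; [apply Cnorm_ge0|lra]. }
  set (y := (Cnorm q ^ i)%R) in *.
  assert ((x * y) ^ p <= x ^ p)%R.
  { apply pow_incr; split; [apply Rmult_le_pos; auto|].
    rewrite <- (Rmult_1_r x) at 2; apply Rmult_le_compat_l; auto. }
  apply Rmult_le_compat; auto.
  - apply Rmult_le_pos; auto.
  - apply pow_le, Rmult_le_pos; auto.
  - rewrite <- (Rmult_1_l y) at 2; apply Rmult_le_compat_r; lra.
Qed.

(** The boundary term of the telescoping dies through (aq/z)^(p+1); all other factors are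
    bounded. *)
Lemma vwp_cert_cvg a j : vwp_regular a -> Cvg (vwp_cert (q ^ j) a) Czero.
Proof.
  intros [H1 [H2 [H3 H4]]].
  assert (Hqq : qnz q q) by (apply qnz_small; auto).
  assert (B : Cbounded (fun p : nat =>
    qpoch (z * q ^ j) q (S p) * qpoch (q * q ^ j) q p * qpoch (d * q ^ 0) q (S p)
    * qpoch (d * a * q * q ^ (j + j)) q p
    * (Cone - d * a * a * q ^ (j + j) * q / z * q ^ S p)
    * (/ (Cone - a * q / z) * / qpoch (q * q ^ 0) q p
       * / qpoch (d * a * q / z * q ^ j) q (S p)
       * / qpoch (d * a * q * q ^ j) q (S p) * / qpoch (a * q * q ^ (j + j)) q (S p)))).
  { repeat match goal with
      | |- Cbounded (fun t => @?f t * @?g t) => apply Cbounded_mul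
      end.
    all: try apply Cbounded_const.
    all: try exact (Cbounded_qpoch _ q (fun _ => _) _ Hq).
    all: try (refine (Cbounded_inv_qpoch _ q (fun _ => _) _ Hq _); auto).
    apply Cbounded_sub; [apply Cbounded_const|apply Cbounded_mul; [apply Cbounded_const|]].
    apply Cbounded_pow; auto. }
  destruct B as [K [K0 HK]].
  apply Cvg_ext with (fun p => (a * q / z) ^ S p *
    (qpoch (z * q ^ j) q (S p) * qpoch (q * q ^ j) q p * qpoch (d * q ^ 0) q (S p)
    * qpoch (d * a * q * q ^ (j + j)) q p
    * (Cone - d * a * a * q ^ (j + j) * q / z * q ^ S p)
    * (/ (Cone - a * q / z) * / qpoch (q * q ^ 0) q p
       * / qpoch (d * a * q / z * q ^ j) q (S p)
       * / qpoch (d * a * q * q ^ j) q (S p) * / qpoch (a * q * q ^ (j + j)) q (S p)))).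
  { intros p; unfold vwp_cert.
    replace (d * a * q ^ j * q ^ j * q) with (d * a * q * q ^ (j + j))
      by (rewrite Cpow_add; ring).
    replace (a * q ^ j * q ^ j * q) with (a * q * q ^ (j + j))
      by (rewrite Cpow_add; ring).
    replace (d * a * a * q ^ j * q ^ j * q * q ^ S p / z)
      with (d * a * a * q ^ (j + j) * q / z * q ^ S p) by (rewrite Cpow_add; field; auto).
    replace (q ^ j * q) with (q * q ^ j) by ring.
    replace (d * a * q ^ j * q / z) with (d * a * q / z * q ^ j) by (field; auto).
    replace (d * a * q ^ j * q) with (d * a * q * q ^ j) by ring.
    replace (d * q ^ 0) with d by (simpl; ring).
    replace (q * q ^ 0) with q by (simpl; ring).
    pose proof (qnz_shift _ _ j H1 (S p)); pose proof (qnz_shift _ _ j H2 (S p)).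
    pose proof (qnz_shift _ _ (j + j) H3 (S p)); specialize (Hqq p).
    pose proof (one_sub_neq0 _ H4).
    set (A1 := qpoch (d * a * q / z * q ^ j) q (S p)) in *.
    set (A2 := qpoch (d * a * q * q ^ j) q (S p)) in *.
    set (A3 := qpoch (a * q * q ^ (j + j)) q (S p)) in *.
    set (x := a * q / z) in *.
    field; repeat split; auto. }
  apply Cvg_mul0 with K; auto.
  apply (Cvg_comp (fun n => (a * q / z) ^ n) Czero S); [intros; lia|].
  apply Cvg_pow; auto.
Qed.

Definition vwp_sum (c a : Cpx) : Cpx := Clim (fun N => Csum N (vwp_term c a)).

Lemma vwp_sum_cvg a i j : vwp_regular a ->
  Cvg (fun N => Csum N (vwp_term (q ^ j) (a * q ^ i))) (vwp_sum (q ^ j) (a * q ^ i)).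
Proof.
  intros H; destruct (vwp_term_bound a H) as [K [K0 HK]].
  destruct H as [_ [_ [_ H4]]].
  destruct (Cvg_sum (vwp_term (q ^ j) (a * q ^ i))
             (fun p => (K * Cnorm q ^ i) * Cnorm (a * q / z)%C ^ p)%R) as [l Hl].
  - apply summable_scal.
    + apply Rmult_le_pos; [lra|apply pow_le, Cnorm_ge0].
    + apply summable_geom; split; auto; apply Cnorm_ge0.
  - intros p; apply HK.
  - unfold vwp_sum; rewrite (Clim_eq _ _ Hl); auto.
Qed.

Lemma vwp_sum_cvg0 a j : vwp_regular a ->
  Cvg (fun N => Csum N (vwp_term (q ^ j) a)) (vwp_sum (q ^ j) a).
Proof.
  intros H; pose proof (vwp_sum_cvg a 0 j H) as V.
  replace (a * q ^ 0) with a in V by (simpl; ring); auto.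
Qed.

Lemma vwp_sum_lim a j : vwp_regular a -> Cvg (fun i => vwp_sum (q ^ j) (a * q ^ i)) Czero.
Proof.
  intros H; destruct (vwp_term_bound a H) as [K [K0 HK]].
  pose proof H as [_ [_ [_ H4]]].
  pose proof (Cnorm_ge0 (a * q / z)) as X0.
  set (x := Cnorm (a * q / z)%C) in *.
  assert (0 < / (1 - x))%R by (apply Rinv_0_lt_compat; lra).
  assert (B : forall i, (Cnorm (vwp_sum (q ^ j)%C (a * q ^ i)%C) <= (K * / (1 - x)) * Cnorm q ^ i)%R).
  { intros i; apply (Cvg_norm_le _ _ _ (vwp_sum_cvg a i j H)).
    intros N; eapply Rle_trans; [apply Csum_norm|].
    apply Rle_trans with (Rsum N (fun p => (K * Cnorm q ^ i) * x ^ p)%R).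
    - apply Rsum_le; intros; apply HK.
    - rewrite Rsum_scal.
      replace (K * / (1 - x) * Cnorm q ^ i)%R with (K * Cnorm q ^ i * / (1 - x))%R by ring.
      apply Rmult_le_compat_l; [|apply Rsum_geom_le; lra].
      apply Rmult_le_pos; [lra|apply pow_le, Cnorm_ge0]. }
  assert (KX : (0 < K * / (1 - x))%R) by (apply Rmult_lt_0_compat; auto).
  intros eps He.
  destruct (Cvg_pow q Hq (eps / (K * / (1 - x)))%R) as [N HN].
  { apply Rdiv_lt_0_compat; auto. }
  exists N; intros n Hn; specialize (HN n Hn); specialize (B n).
  replace (q ^ n - Czero) with (q ^ n) in HN by ring; rewrite Cnorm_pow in HN.
  replace (vwp_sum (q ^ j) (a * q ^ n) - Czero) with (vwp_sum (q ^ j) (a * q ^ n)) by ring.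
  eapply Rle_lt_trans; [exact B|].
  apply (Rmult_lt_compat_l (K * / (1 - x))) in HN; auto.
  replace (K * / (1 - x) * (eps / (K * / (1 - x))))%R with eps in HN by (field; lra).
  exact HN.
Qed.

Lemma vwp_sum_step a j : vwp_regular a ->
  vwp_sum (q ^ j) a = vwp_ratio (q ^ j) a * vwp_sum (q ^ j) (a * q) + vwp_cert (q ^ j) a 0.
Proof.
  intros H.
  apply (Cvg_unique (fun N => Csum N (vwp_term (q ^ j) a))); [apply vwp_sum_cvg0; auto|].
  apply Cvg_ext with (fun N => vwp_ratio (q ^ j) a * Csum N (vwp_term (q ^ j) (a * q))
                               + (vwp_cert (q ^ j) a 0 - vwp_cert (q ^ j) a N)).
  { induction n; simpl Csum; [ring|]; rewrite <- IHn.
    pose proof (vwp_step_pow a j n H) as E.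
    set (u := vwp_term (q ^ j) a n) in *.
    replace u with (vwp_ratio (q ^ j) a * vwp_term (q ^ j) (a * q) n +
      (vwp_cert (q ^ j) a n - vwp_cert (q ^ j) a (S n))) by (rewrite <- E; ring).
    ring. }
  replace (vwp_ratio (q ^ j) a * vwp_sum (q ^ j) (a * q) + vwp_cert (q ^ j) a 0)
    with (vwp_ratio (q ^ j) a * vwp_sum (q ^ j) (a * q) + (vwp_cert (q ^ j) a 0 - Czero))
    by ring.
  apply Cvg_add.
  - apply Cvg_mul; [apply Cvg_const|].
    pose proof (vwp_sum_cvg a 1 j H) as V.
    replace (a * q ^ 1) with (a * q) in V by (simpl; ring); auto.
  - apply Cvg_sub; [apply Cvg_const|apply vwp_cert_cvg; auto].
Qed.

(** At c = 1 numerator and denominator of [vwp_ratio] agree, so the recurrence says that the sums at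
    a and at aq differ by [vwp_cert] at p = 0. Adding these up along a q^i leaves a remainder that
    tends to 0. *)
Lemma vwp_sum_one a : vwp_regular a ->
  Cvg (fun N => Csum N (fun i => vwp_cert Cone (a * q ^ i) 0)) (vwp_sum Cone a).
Proof.
  intros H.
  apply Cvg_ext with (fun N => vwp_sum Cone a - vwp_sum Cone (a * q ^ N)).
  - induction n; simpl Csum.
    + simpl; replace (a * Cone) with a by ring; ring.
    + rewrite <- IHn.
      pose proof (vwp_regular_shift a n H) as [R1 [R2 [R3 R4]]].
      pose proof (vwp_sum_step (a * q ^ n) 0 (vwp_regular_shift a n H)) as E.
      simpl in E; rewrite E; simpl.
      replace (vwp_ratio Cone (a * q ^ n)) with Cone.
      * replace (a * (q * q ^ n)) with (a * q ^ n * q) by ring; ring.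
      * apply qnz_factor0 in R1, R2, R3; apply one_sub_neq0 in R4.
        unfold vwp_ratio; set (b := a * q ^ n) in *.
        replace (d * b * Cone * Cone * q) with (d * b * q) by ring.
        replace (b * Cone * q / z) with (b * q / z) by (field; auto).
        replace (b * Cone * q) with (b * q) by ring.
        replace (d * b * Cone * q / z) with (d * b * q / z) by (field; auto).
        replace (d * b * Cone * q) with (d * b * q) by ring.
        replace (b * Cone * Cone * q) with (b * q) by ring.
        set (y1 := d * b * q / z) in *; set (y2 := d * b * q) in *.
        set (y3 := b * q) in *; set (y4 := y3 / z) in *.
        field; auto.
  - apply (Cvg_eq _ (vwp_sum Cone a - Czero)); [ring|].
    apply Cvg_sub; [apply Cvg_const|]; apply (vwp_sum_lim a 0 H).
Qed.

(** The infinite-product value of the 6phi5; for c = q^j its eight products cancel in pairs to four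
    finite ones. *)
Definition vwp_product (j : nat) (a : Cpx) : Cpx :=
  qpoch (a * q * q ^ j) q j * qpoch (d * a * q / z) q j
  / (qpoch (a * q / z) q j * qpoch (d * a * q * q ^ j) q j).

Lemma vwp_product_neq0 j a : vwp_regular a -> vwp_product j a <> Czero.
Proof.
  intros [H1 [H2 [H3 H4]]]; apply Cmul_neq0; [apply Cmul_neq0|apply Cinv_neq0, Cmul_neq0].
  - apply qnz_shift; auto.
  - apply H1.
  - apply qnz_small; auto.
  - apply qnz_shift; auto.
Qed.

Lemma vwp_product_step j a : vwp_regular a ->
  vwp_product j a = vwp_ratio (q ^ j) a * vwp_product j (a * q).
Proof.
  intros [H1 [H2 [H3 H4]]].
  pose proof (qnz_small _ _ H4 Hq) as H5.
  pose proof (qnz_shift _ _ j H1) as S1; pose proof (qnz_shift _ _ j H2) as S2.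
  pose proof (qnz_shift _ _ j H3) as S3; pose proof (qnz_shift _ _ j H5) as S5.
  unfold vwp_product, vwp_ratio.
  replace (a * q * q * q ^ j) with (a * q * q ^ j * q) by ring.
  replace (d * (a * q) * q / z) with (d * a * q / z * q) by (field; auto).
  replace (a * q * q / z) with (a * q / z * q) by (field; auto).
  replace (d * (a * q) * q * q ^ j) with (d * a * q * q ^ j * q) by ring.
  rewrite !qpoch_mulq by auto.
  replace (d * a * q ^ j * q ^ j * q) with (d * a * q * q ^ j * q ^ j) by ring.
  replace (a * q ^ j * q / z) with (a * q / z * q ^ j) by (field; auto).
  replace (d * a * q ^ j * q / z) with (d * a * q / z * q ^ j) by (field; auto).
  replace (a * q ^ j * q ^ j * q) with (a * q * q ^ j * q ^ j) by ring.
  replace (d * a * q ^ j * q) with (d * a * q * q ^ j) by ring.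
  replace (a * q ^ j * q) with (a * q * q ^ j) by ring.
  pose proof (qnz_factor0 _ _ H1); pose proof (qnz_factor0 _ _ H5).
  pose proof (qnz_factor _ _ j H1); pose proof (qnz_factor _ _ j H5).
  pose proof (qnz_factor0 _ _ S2); pose proof (qnz_factor0 _ _ S3).
  pose proof (qnz_factor _ _ j S2); pose proof (qnz_factor _ _ j S3).
  specialize (H1 j); specialize (H5 j); specialize (S2 j); specialize (S3 j).
  set (y1 := d * a * q / z) in *; set (y2 := d * a * q * q ^ j) in *.
  set (y3 := a * q * q ^ j) in *; set (y4 := a * q / z) in *.
  field; repeat split; auto.
Qed.

Lemma vwp_product_lim j a : vwp_regular a -> Cvg (fun i => vwp_product j (a * q ^ i)) Cone.
Proof.
  intros H.
  apply (Cvg_eq _ (Cone * Cone / (Cone * Cone))); [field; apply Cone_neq0|].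
  apply Cvg_div.
  - apply Cmul_neq0; apply Cone_neq0.
  - apply Cvg_mul.
    + apply Cvg_ext with (fun i => qpoch (a * q * q ^ j * q ^ i) q j);
        [intros; f_equal; ring|apply qpoch_cvg1; auto].
    + apply Cvg_ext with (fun i => qpoch (d * a * q / z * q ^ i) q j);
        [intros; f_equal; field; auto|apply qpoch_cvg1; auto].
  - apply Cvg_mul.
    + apply Cvg_ext with (fun i => qpoch (a * q / z * q ^ i) q j);
        [intros; f_equal; field; auto|apply qpoch_cvg1; auto].
    + apply Cvg_ext with (fun i => qpoch (d * a * q * q ^ j * q ^ i) q j);
        [intros; f_equal; ring|apply qpoch_cvg1; auto].
Qed.

(** The added 1 is the term of index 0 of the 6phi5. It makes the recurrence homogeneous because
    [vwp_ratio] - 1 = (1 - c) [vwp_cert] at p = 0, the telescoping identity at that index. *)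
Lemma vwp_sum_pow_step j a : vwp_regular a ->
  Cone + (Cone - q ^ j) * vwp_sum (q ^ j) a =
  vwp_ratio (q ^ j) a * (Cone + (Cone - q ^ j) * vwp_sum (q ^ j) (a * q)).
Proof.
  intros H; rewrite (vwp_sum_step a j H).
  assert (E : vwp_ratio (q ^ j) a - Cone = (Cone - q ^ j) * vwp_cert (q ^ j) a 0).
  { destruct H as [H1 [H2 [H3 H4]]].
    unfold vwp_ratio, vwp_cert; simpl.
    assert (K1 : Cone - d * a * q ^ j * q / z <> Czero).
    { replace (d * a * q ^ j * q / z) with (d * a * q / z * q ^ j) by (field; auto).
      apply qnz_factor; auto. }
    assert (K2 : Cone - d * a * q ^ j * q <> Czero).
    { replace (d * a * q ^ j * q) with (d * a * q * q ^ j) by ring.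
      apply qnz_factor; auto. }
    assert (K3 : Cone - a * q ^ j * q ^ j * q <> Czero).
    { replace (a * q ^ j * q ^ j * q) with (a * q * q ^ (j + j)) by (rewrite Cpow_add; ring).
      apply qnz_factor; auto. }
    pose proof (one_sub_neq0 _ H4) as K4.
    apply sub_neq0_of_div in K1, K4; auto.
    set (c := q ^ j) in *.
    field; repeat split; auto.
    all: try (intros E; first [apply K3|apply K2|apply K1|apply K4|apply Cone_neq0];
              rewrite <- E; ring). }
  set (C := vwp_cert _ _ _) in *; set (r := vwp_ratio _ _) in *.
  replace r with (Cone + (Cone - q ^ j) * C) by (rewrite <- E; ring).
  ring.
Qed.

(** Both sides obey the same recurrence in a -> aq, so their quotient [T] is constant along a q^i;
    both tend to 1 there. *)
Lemma vwp_sum_pow j a : vwp_regular a ->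
  Cone + (Cone - q ^ j) * vwp_sum (q ^ j) a = vwp_product j a.
Proof.
  intros H.
  set (T := fun i => (Cone + (Cone - q ^ j) * vwp_sum (q ^ j) (a * q ^ i))
                     / vwp_product j (a * q ^ i)).
  assert (S1 : forall i, T i = T O).
  { induction i; auto; rewrite <- IHi; unfold T.
    replace (a * q ^ S i) with (a * q ^ i * q) by (simpl; ring).
    pose proof (vwp_regular_shift a i H) as Hi.
    pose proof (vwp_regular_shift a (S i) H) as Hi'.
    replace (a * q ^ S i) with (a * q ^ i * q) in Hi' by (simpl; ring).
    rewrite (vwp_sum_pow_step j _ Hi).
    pose proof (vwp_product_neq0 j _ Hi) as P; pose proof (vwp_product_neq0 j _ Hi') as P'.
    rewrite (vwp_product_step j _ Hi) in *.
    assert (vwp_ratio (q ^ j) (a * q ^ i) <> Czero).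
    { intros E; apply P; rewrite E; ring. }
    field; auto. }
  assert (L : Cvg T Cone).
  { apply (Cvg_eq _ ((Cone + (Cone - q ^ j) * Czero) / Cone)); [field; apply Cone_neq0|].
    apply Cvg_div; [apply Cone_neq0| |apply vwp_product_lim; auto].
    apply Cvg_add; [apply Cvg_const|apply Cvg_mul; [apply Cvg_const|]].
      apply vwp_sum_lim; auto. }
  assert (E : T O = Cone).
  { apply (Cvg_unique T); auto; apply Cvg_ext with (fun _ => T O); auto.
    apply Cvg_const. }
  unfold T in E; simpl in E; replace (a * Cone) with a in E by ring.
  pose proof (vwp_product_neq0 j a H).
  set (u := Cone + _) in *; set (v := vwp_product j a) in *.
  replace u with (u / v * v) by (field; auto); rewrite E; ring.
Qed.

End VeryWellPoised.

(** * Summation of WP-Bailey pairs *)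

Lemma Csum1_Csum f N : Csum1 f N = Csum N (fun i => f (S i)).
Proof. induction N; simpl; [auto|rewrite IHN; auto]. Qed.

Lemma fold_right_Csum f m n :
  List.fold_right Cadd Czero (List.map f (List.seq m n)) = Csum n (fun i => f (m + i)%nat).
Proof.
  revert m; induction n; intros m; [reflexivity|].
  rewrite Csum_first; simpl; rewrite IHn, Nat.add_0_r; f_equal.
  apply Csum_ext; intros; f_equal; lia.
Qed.

Lemma abs_summable1_summable f : abs_summable1 f -> summable (fun i => Cnorm (f (S i))).
Proof.
  intros [l Hl]; split; [intros; apply Cnorm_ge0|]; exists l; intros n.
  assert (E : forall n, Rsum_abs1 f n = Rsum n (fun i => Cnorm (f (S i)))).
  { induction n0; simpl; [auto|rewrite IHn0; auto]. }
  rewrite <- E; apply (growing_ineq (Rsum_abs1 f)); auto.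
  intros m; simpl; pose proof (Cnorm_ge0 (f (S m))); lra.
Qed.

Lemma series1_cvg f : abs_summable1 f -> Cvg (Csum1 f) (series1 f).
Proof.
  intros H.
  destruct (Cvg_sum (fun i => f (S i)) _ (abs_summable1_summable f H)) as [l Hl].
  - intros; apply Rle_refl.
  - assert (H' : Cvg (Csum1 f) l).
    { apply Cvg_ext with (2 := Hl); intros; symmetry; apply Csum1_Csum. }
    unfold series1; rewrite (Clim_eq _ _ H'); auto.
Qed.

Section Pair.

Variables (q a k z s : Cpx).
Hypotheses (Hq : (Cnorm q < 1)%R) (Hs : s * s = k)
  (Ha0 : a <> Czero) (Hz0 : z <> Czero)
  (Hx : (Cnorm (q * a / z)%C < 1)%R) (Hk1 : Cone - k <> Czero)
  (Hs1 : qnz s q) (Hs2 : qnz (- s) q) (Hk : qnz (q * k) q) (Hkz : qnz (q * k / z) q)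
  (Ha : qnz (q * a) q).

Let d := k / a.

(** The truncated n - 1 is harmless: the series start at n = 1. *)
Definition beta_weight (n : nat) : Cpx :=
  qpoch (q * s) q n * qpoch (- (q * s)) q n * qpoch z q n * qpoch q q (n - 1)
  / (qpoch s q n * qpoch (- s) q n * qpoch (q * k) q n * qpoch (q * k / z) q n)
  * (q * a / z) ^ n.

Definition alpha_weight (n : nat) : Cpx :=
  qpoch z q n * qpoch q q (n - 1) / (qpoch (q * a) q n * qpoch (q * a / z) q n)
  * (q * a / z) ^ n.

Definition wp_coef (n j : nat) : Cpx :=
  qpoch (k / a) q (n - j) * qpoch k q (n + j) / (qpoch q q (n - j) * qpoch (a * q) q (n + j)).

(** The four products in [s] telescope to (1 - s^2 q^(2n)) / (1 - s^2), so the choice of the square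
    root is immaterial. *)
Lemma beta_weight_eq n : beta_weight n =
  (Cone - k * q ^ n * q ^ n) / (Cone - k) * qpoch z q n * qpoch q q (n - 1)
  / (qpoch (q * k) q n * qpoch (q * k / z) q n) * (q * a / z) ^ n.
Proof.
  unfold beta_weight.
  replace (q * s) with (s * q) by ring.
  replace (- (s * q)) with (- s * q) by ring.
  rewrite !qpoch_mulq by auto.
  pose proof (qnz_factor0 _ _ Hs1) as E1; pose proof (qnz_factor0 _ _ Hs2) as E2.
  replace (Cone - k * q ^ n * q ^ n) with ((Cone - s * q ^ n) * (Cone - - s * q ^ n))
    by (rewrite <- Hs; ring).
  replace (Cone - k) with ((Cone - s) * (Cone - - s)) by (rewrite <- Hs; ring).
  pose proof (Hs1 n); pose proof (Hs2 n); pose proof (Hk n); pose proof (Hkz n).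
  set (y := q * k / z) in *; set (x := q * a / z).
  set (t := - s) in *.
  field; repeat split; auto.
Qed.

Lemma d_mul : d * a = k.
Proof. unfold d; field; auto. Qed.

Lemma pair_regular : vwp_regular q d z a.
Proof.
  unfold vwp_regular; rewrite d_mul.
  replace (k * q / z) with (q * k / z) by (field; auto).
  replace (k * q) with (q * k) by ring.
  replace (a * q / z) with (q * a / z) by (field; auto).
  replace (a * q) with (q * a) by ring.
  auto.
Qed.

(** For j = 0 the factor (q;q)_(n-1), in place of (q;q)_n, is exactly the division by 1 - c built
    into [vwp_term]. *)
Lemma weight_coef0 p : beta_weight (S p) * wp_coef (S p) 0 = vwp_term q d z Cone a p.
Proof.
  rewrite beta_weight_eq; unfold wp_coef, vwp_term; rewrite d_mul; fold d.
  rewrite Nat.add_0_r, Nat.sub_0_r.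
  replace (S p - 1)%nat with p by lia.
  rewrite (qpoch_first k).
  replace (k * Cone * Cone * q ^ S p * q ^ S p) with (k * q ^ S p * q ^ S p) by ring.
  replace (k * Cone * Cone * q) with (k * q) by ring.
  replace (k * Cone * q / z) with (q * k / z) by (field; auto).
  replace (k * Cone * q) with (q * k) by ring.
  replace (a * Cone * Cone * q) with (a * q) by ring.
  replace (a * q / z) with (q * a / z) by (field; auto).
  replace (z * Cone) with z by ring.
  replace (Cone * q) with q by ring.
  assert (Hqq : qnz q q) by (apply qnz_small; auto).
  pose proof (Hk (S p)); pose proof (Hkz (S p)); pose proof (Hqq (S p)).
  assert (qpoch (a * q) q (S p) <> Czero).
  { replace (a * q) with (q * a) by ring; apply Ha. }
  set (y := q * k / z) in *; set (x := q * a / z).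
  field; repeat split; auto.
Qed.

(** The first entry of row j is V_j divided by the value of the 6phi5, which is why the whole row
    will sum to V_j. *)
Lemma weight_coef_diag j : (0 < j)%nat ->
  beta_weight j * wp_coef j j = alpha_weight j / vwp_product q d z j a.
Proof.
  intros Hj; rewrite beta_weight_eq; unfold wp_coef, alpha_weight, vwp_product; rewrite d_mul.
  rewrite Nat.sub_diag; simpl (qpoch _ _ 0).
  rewrite (qpoch_add (a * q)).
  assert (E : qpoch k q (j + j) * (Cone - k * q ^ j * q ^ j) =
              (Cone - k) * (qpoch (k * q) q j * qpoch (k * q * q ^ j) q j)).
  { rewrite <- qpoch_add, <- qpoch_first, qpoch_S, Cpow_add; ring. }
  replace (k * q / z) with (q * k / z) by (field; auto).
  replace (k * q) with (q * k) in * by ring.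
  replace (a * q / z) with (q * a / z) by (field; auto).
  replace (a * q) with (q * a) by ring.
  pose proof (Hk j); pose proof (Hkz j); pose proof (Ha j).
  pose proof (qnz_shift _ _ j Hk j); pose proof (qnz_shift _ _ j Ha j).
  pose proof (qnz_small _ _ Hx Hq j).
  set (y := q * k / z) in *; set (x := q * a / z) in *.
  transitivity (qpoch k q (j + j) * (Cone - k * q ^ j * q ^ j) / (Cone - k)
    * qpoch z q j * qpoch q q (j - 1) / (qpoch (q * k) q j * qpoch y q j) * x ^ j
    / (qpoch (q * a) q j * qpoch (q * a * q ^ j) q j)).
  - field; repeat split; auto; apply Cone_neq0.
  - rewrite E; field; repeat split; auto.
Qed.

(** Relative to the first entry of the row, the others are the terms of the 6phi5 with A = k q^(2j),
    B = z q^j, C = q^j, D = k/a. *)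
Lemma weight_coef_off j p : (0 < j)%nat ->
  beta_weight (j + S p) * wp_coef (j + S p) j =
  alpha_weight j / vwp_product q d z j a * ((Cone - q ^ j) * vwp_term q d z (q ^ j) a p).
Proof.
  intros Hj; rewrite beta_weight_eq; unfold wp_coef, alpha_weight, vwp_product, vwp_term.
  rewrite !d_mul; fold d.
  replace (j + S p - j)%nat with (S p) by lia.
  replace (j + S p - 1)%nat with (j - 1 + S p)%nat by lia.
  replace (j + S p + j)%nat with (j + j + S p)%nat by lia.
  rewrite !(qpoch_add _ _ j (S p)), (qpoch_add _ _ (j - 1)).
  rewrite (qpoch_add (a * q)), (qpoch_add (a * q) q j j), !Cpow_add.
  assert (E : qpoch k q (j + j + S p) =
              (Cone - k) * (qpoch (k * q) q j * qpoch (k * q * q ^ j) q j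
                            * qpoch (k * q ^ j * q ^ j * q) q p)).
  { replace (j + j + S p)%nat with (S (j + j + p)) by lia.
    rewrite qpoch_first, qpoch_add, qpoch_add, Cpow_add.
    replace (k * q * (q ^ j * q ^ j)) with (k * q ^ j * q ^ j * q) by ring; auto. }
  (* This splits off the factor 1 - q^j that [vwp_term] has been divided by. *)
  assert (E' : qpoch (q * q ^ (j - 1)) q (S p) = (Cone - q ^ j) * qpoch (q ^ j * q) q p).
  { rewrite qpoch_first.
    replace (q * q ^ (j - 1)) with (q ^ j); auto.
    replace j with (S (j - 1)) at 1 by lia; reflexivity. }
  rewrite E, E'.
  replace (k * q ^ j * q / z) with (q * k / z * q ^ j) by (field; auto).
  replace (k * q / z) with (q * k / z) by (field; auto).
  replace (k * q ^ j * q) with (q * k * q ^ j) by ring.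
  replace (k * q) with (q * k) by ring.
  replace (a * q / z) with (q * a / z) by (field; auto).
  replace (a * q * (q ^ j * q ^ j)) with (a * q ^ j * q ^ j * q) by ring.
  replace (a * q) with (q * a) by ring.
  assert (Hqq : qnz q q) by (apply qnz_small; auto).
  pose proof (Hk j); pose proof (Hkz j); pose proof (Ha j); pose proof (Hqq (S p)).
  pose proof (qnz_shift _ _ j Hk j); pose proof (qnz_shift _ _ j Ha j).
  pose proof (qnz_shift _ _ j Hk (S p)); pose proof (qnz_shift _ _ j Hkz (S p)).
  pose proof (qnz_small _ _ Hx Hq j).
  assert (qpoch (a * q ^ j * q ^ j * q) q (S p) <> Czero).
  { replace (a * q ^ j * q ^ j * q) with (q * a * q ^ (j + j)) by (rewrite Cpow_add; ring).
    apply qnz_shift; auto. }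
  set (y := q * k / z) in *; set (x := q * a / z) in *.
  set (p1 := qpoch (a * q ^ j * q ^ j * q) q (S p)) in *.
  set (p2 := qpoch (k * q ^ j * q ^ j * q) q p) in *.
  set (p3 := qpoch (y * q ^ j) q (S p)) in *.
  set (p4 := qpoch (q * k * q ^ j) q (S p)) in *.
  set (p5 := qpoch (q * k * q ^ j) q j) in *.
  set (p6 := qpoch (q * a * q ^ j) q j) in *.
  set (p7 := qpoch d q (S p)) in *.
  set (p8 := qpoch (z * q ^ j) q (S p)) in *.
  set (p9 := qpoch (q ^ j * q) q p) in *.
  set (p10 := qpoch q q (S p)) in *.
  replace (k * (q ^ j * q ^ S p) * (q ^ j * q ^ S p))
    with (k * q ^ j * q ^ j * q ^ S p * q ^ S p) by ring.
  set (e := k * q ^ j * q ^ j * q ^ S p * q ^ S p).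
  set (x1 := x ^ S p).
  field; repeat split; auto.
Qed.

Variables (alpha beta : nat -> Cpx).
Hypothesis Hpair : WP_Bailey_pair a k q alpha beta.

Lemma beta_eq n : (0 < n)%nat -> beta n = Csum (S n) (fun j => wp_coef n j * alpha j).
Proof. intros Hn; destruct Hpair as [_ [_ H]]; rewrite H, fold_right_Csum; auto. Qed.

(** The index is shifted by one: this row belongs to alpha (S j), since the row of alpha 0 is
    [weight_coef0]. *)
Definition row_sum (j M : nat) : Cpx :=
  Csum M (fun m => beta_weight (S j + m) * wp_coef (S j + m) (S j)).

Lemma weighted_beta_sum N :
  Csum N (fun n => beta_weight (S n) * beta (S n)) =
  Csum N (vwp_term q d z Cone a) + Csum N (fun j => row_sum j (N - j) * alpha (S j)).
Proof.
  rewrite (Csum_ext N _ (fun n => vwp_term q d z Cone a n +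
    Csum (S n) (fun j => beta_weight (S n) * wp_coef (S n) (S j) * alpha (S j)))).
  - rewrite Csum_plus; f_equal.
    rewrite (Csum_triangle (fun n j => beta_weight (S n) * wp_coef (S n) (S j) * alpha (S j))).
    apply Csum_ext; intros j Hj; unfold row_sum.
    rewrite (Csum_ext _ _ (fun m => alpha (S j) *
      (beta_weight (S j + m) * wp_coef (S j + m) (S j)))).
    + rewrite Csum_scal; ring.
    + intros m _; simpl; ring.
  - intros n _; rewrite beta_eq by lia; rewrite Csum_first.
    destruct Hpair as [A0 _]; rewrite A0, <- weight_coef0.
    rewrite (Csum_ext _ (fun j => beta_weight (S n) * wp_coef (S n) (S j) * alpha (S j))
              (fun j => beta_weight (S n) * (wp_coef (S n) (S j) * alpha (S j))))
      by (intros; ring).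
    rewrite Csum_scal; ring.
Qed.

Lemma row_sum_S j M : row_sum j (S M) =
  alpha_weight (S j) * (/ vwp_product q d z (S j) a
    * (Cone + (Cone - q ^ S j) * Csum M (vwp_term q d z (q ^ S j) a))).
Proof.
  unfold row_sum; rewrite Csum_first, Nat.add_0_r, weight_coef_diag by lia.
  rewrite (Csum_ext M _ (fun p => alpha_weight (S j) / vwp_product q d z (S j) a
    * (Cone - q ^ S j) * vwp_term q d z (q ^ S j) a p)).
  - rewrite Csum_scal; unfold Cdiv; ring.
  - intros p _; rewrite weight_coef_off by lia; ring.
Qed.

(** By [vwp_sum_pow] the bracket in [row_sum_S] tends to [vwp_product], which cancels. *)
Lemma row_sum_cvg j : Cvg (fun N => row_sum j (N - j)) (alpha_weight (S j)).
Proof.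
  (* From N = S j on, the truncated difference N - j is a successor, as [row_sum_S] requires. *)
  apply Cvg_unshift with (S j).
  apply Cvg_ext with (fun M => alpha_weight (S j) * (/ vwp_product q d z (S j) a
    * (Cone + (Cone - q ^ S j) * Csum M (vwp_term q d z (q ^ S j) a)))).
  { intros M; rewrite <- row_sum_S; f_equal; lia. }
  pose proof (vwp_product_neq0 q d z Hq (S j) a pair_regular) as P.
  apply (Cvg_eq _ (alpha_weight (S j) * (/ vwp_product q d z (S j) a
    * (Cone + (Cone - q ^ S j) * vwp_sum q d z (q ^ S j) a)))).
  - rewrite (vwp_sum_pow q d z Hq Hz0 (S j) a pair_regular).
    field; auto.
  - repeat (apply Cvg_mul; [apply Cvg_const|]).
    apply Cvg_add; [apply Cvg_const|]; apply Cvg_mul; [apply Cvg_const|].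
    apply vwp_sum_cvg0; auto; apply pair_regular.
Qed.

Lemma row_sum_bound : exists B, (0 < B)%R /\ forall j M,
  (Cnorm (row_sum j M) <= B * Cnorm (alpha_weight (S j)))%R.
Proof.
  destruct (vwp_term_bound q d z Hq Hz0 a pair_regular) as [K [K0 HK]].
  pose proof pair_regular as [H1 [H2 [H3 H4]]].
  pose proof (qnz_small _ _ H4 Hq) as H5.
  assert (Bd : Cbounded (fun j : nat => (/ vwp_product q d z (S j) a)%C)).
  { apply Cbounded_ext with (fun j : nat =>
      / qpoch (a * q * q ^ (S j)) q (S j) * / qpoch (d * a * q / z * q ^ 0) q (S j)
      * (qpoch (a * q / z * q ^ 0) q (S j) * qpoch (d * a * q * q ^ (S j)) q (S j))).
    { intros j; unfold vwp_product.
      replace (d * a * q / z * q ^ 0) with (d * a * q / z) by (simpl; ring).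
      replace (a * q / z * q ^ 0) with (a * q / z) by (simpl; ring).
      pose proof (H1 (S j)); pose proof (H5 (S j)).
      pose proof (qnz_shift _ _ (S j) H2 (S j)); pose proof (qnz_shift _ _ (S j) H3 (S j)).
      set (p1 := qpoch (a * q * q ^ S j) q (S j)) in *.
      set (p2 := qpoch (d * a * q / z) q (S j)) in *.
      set (p3 := qpoch (a * q / z) q (S j)) in *.
      set (p4 := qpoch (d * a * q * q ^ S j) q (S j)) in *.
      field; auto. }
    apply Cbounded_mul; apply Cbounded_mul.
    - apply (Cbounded_inv_qpoch (a * q) q S S Hq H3).
    - apply (Cbounded_inv_qpoch (d * a * q / z) q (fun _ => O) S Hq H1).
    - apply (Cbounded_qpoch (a * q / z) q (fun _ => O) S Hq).
    - apply (Cbounded_qpoch (d * a * q) q S S Hq). }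
  destruct Bd as [D [D0 HD]].
  set (x := Cnorm (a * q / z)%C) in *.
  assert (X0 : (0 <= x)%R) by apply Cnorm_ge0.
  assert (I0 : (0 < / (1 - x))%R) by (apply Rinv_0_lt_compat; lra).
  assert (P0 : (0 < K * / (1 - x))%R) by (apply Rmult_lt_0_compat; auto).
  (* [D] bounds the inverse of [vwp_product] uniformly in j, 2 bounds |1 - q^j|, and K / (1 - x)
     bounds the partial sums of [vwp_term]. *)
  exists (D * (1 + 2 * (K * / (1 - x))))%R; split; [apply Rmult_lt_0_compat; lra|].
  intros j [|M].
  - unfold row_sum; simpl; rewrite Cnorm_0.
    apply Rmult_le_pos; [apply Rmult_le_pos; lra|apply Cnorm_ge0].
  - rewrite row_sum_S, Cnorm_mul, Rmult_comm.
    apply Rmult_le_compat_r; [apply Cnorm_ge0|].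
    rewrite Cnorm_mul; apply Rmult_le_compat; try apply Cnorm_ge0; auto.
    eapply Rle_trans; [apply Cnorm_add|]; rewrite Cnorm_1; apply Rplus_le_compat_l.
    rewrite Cnorm_mul; apply Rmult_le_compat; try apply Cnorm_ge0.
    + eapply Rle_trans; [apply Cnorm_sub|]; rewrite Cnorm_1.
      pose proof (Cnorm_pow_le1 q (S j) Hq); lra.
    + eapply Rle_trans; [apply Csum_norm|].
      apply Rle_trans with (Rsum M (fun p => K * x ^ p)%R).
      * apply Rsum_le; intros p _; specialize (HK O (S j) p).
        replace (a * q ^ 0) with a in HK by (simpl; ring).
        simpl (Cnorm q ^ 0)%R in HK; rewrite Rmult_1_r in HK; auto.
      * rewrite Rsum_scal; apply Rmult_le_compat_l; [lra|apply Rsum_geom_le; auto].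
Qed.

(* Only the absolute convergence of the two single series is available, so the
   rearrangement of the double sum is justified by dominating each row by the
   corresponding term of the alpha-series. *)
Lemma pair_series :
  abs_summable1 (fun n => beta_weight n * beta n) ->
  abs_summable1 (fun n => alpha_weight n * alpha n) ->
  series1 (fun n => beta_weight n * beta n) - series1 (fun n => alpha_weight n * alpha n)
  = vwp_sum q d z Cone a.
Proof.
  intros Hb Hal.
  apply (Cvg_unique (fun N => Csum1 (fun n => beta_weight n * beta n) N
                              - Csum1 (fun n => alpha_weight n * alpha n) N)).
  - apply Cvg_sub; apply series1_cvg; auto.
  - destruct row_sum_bound as [B [B0 HB]].
    pose proof (tannery (fun N j => row_sum j (N - j) * alpha (S j))
                  (fun j => alpha_weight (S j) * alpha (S j))
                  (fun j => B * Cnorm (alpha_weight (S j) * alpha (S j)))%R) as T.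
    apply Cvg_ext with (fun N => Csum N (vwp_term q d z Cone a) +
      (Csum N (fun j => row_sum j (N - j) * alpha (S j))
       - Csum N (fun j => alpha_weight (S j) * alpha (S j)))).
    { intros N; rewrite !Csum1_Csum, weighted_beta_sum; ring. }
    apply (Cvg_eq _ (vwp_sum q d z Cone a + Czero)); [ring|].
    apply Cvg_add; [apply (vwp_sum_cvg0 q d z Hq Hz0 a 0 pair_regular)|].
    apply T.
    + apply summable_scal; [lra|]; apply (abs_summable1_summable _ Hal).
    + intros N j _; rewrite !Cnorm_mul, <- Rmult_assoc.
      apply Rmult_le_compat_r; [apply Cnorm_ge0|apply HB].
    + intros j; apply Cvg_mul; [apply row_sum_cvg|apply Cvg_const].
Qed.

(** The summand is [vwp_cert] at c = 1, p = 0 and a q^i, after inserting d = k/a. *)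
Lemma pair_series_lambert :
  abs_summable1 (fun n => beta_weight n * beta n) ->
  abs_summable1 (fun n => alpha_weight n * alpha n) ->
  Cvg (fun N => Csum N (fun i => (k - a) * q ^ S i * (Cone - / z)
                  * (Cone - a * k * q ^ S i * q ^ S i / z)
                  / ((Cone - k * q ^ S i) * (Cone - a * q ^ S i)
                     * (Cone - a * q ^ S i / z) * (Cone - k * q ^ S i / z))))
    (series1 (fun n => beta_weight n * beta n) - series1 (fun n => alpha_weight n * alpha n)).
Proof.
  intros Hb Hal; rewrite (pair_series Hb Hal).
  apply Cvg_ext with (2 := vwp_sum_one q d z Hq Hz0 a pair_regular).
  intros N; apply Csum_ext; intros i _; unfold vwp_cert; simpl.
  replace (d * (a * q ^ i) * Cone * q / z) with (d * a * q * q ^ i / z) by (field; auto).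
  replace (d * (a * q ^ i) * Cone * q) with (d * a * q * q ^ i) by ring.
  rewrite d_mul.
  assert (K1 : Cone - k * q * q ^ i <> Czero).
  { replace (k * q) with (q * k) by ring; apply qnz_factor; auto. }
  assert (K2 : Cone - k * q * q ^ i / z <> Czero).
  { replace (k * q * q ^ i / z) with (q * k / z * q ^ i) by (field; auto).
    apply qnz_factor; auto. }
  assert (K3 : Cone - a * q * q ^ i <> Czero).
  { replace (a * q) with (q * a) by ring; apply qnz_factor; auto. }
  assert (K4 : Cone - a * q * q ^ i / z <> Czero).
  { replace (a * q * q ^ i / z) with (q * a / z * q ^ i) by (field; auto).
    apply qnz_factor, qnz_small; auto. }
  apply sub_neq0_of_div in K2, K4; auto.
  unfold d.
  field; repeat split; auto; try apply Cone_neq0.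
  all: intros E; change (R1, R0) with Cone in E.
  all: try (apply K1; rewrite <- E; ring).
  all: try (apply K2; rewrite <- E; ring).
  all: try (apply K3; rewrite <- E; ring).
  all: try (apply K4; rewrite <- E; ring).
Qed.

End Pair.

(** * Partial fractions *)

(** Coefficient of 1/(1 - x u_l): the product at x = 1/u_l, with the vanishing factor replaced by
    1. *)
Definition pf_coef (u v : nat -> Cpx) (n l : nat) : Cpx :=
  Cprod n (fun j => Cone - v j / u l)
  / Cprod n (fun j => if Nat.eqb j l then Cone else Cone - u j / u l).

Lemma one_sub_div_neq0 x y : y <> Czero -> x <> y -> Cone - x / y <> Czero.
Proof.
  intros Hy Hxy E; apply Hxy.
  replace x with (y - (Cone - x / y) * y) by (field; auto); rewrite E; ring.
Qed.

(** Induction on the number of factors. A new factor multiplies each old coefficient by its value at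
    1/u_l ([C1]), while the new coefficient is the old expansion evaluated at 1/u_n ([C2]), so no
    separate identity between residues is needed. *)
Lemma partial_fractions (u v : nat -> Cpx) n :
  (forall l, (l < n)%nat -> u l <> Czero) ->
  (forall l j, (l < n)%nat -> (j < n)%nat -> l <> j -> u l <> u j) ->
  forall x, (forall l, (l < n)%nat -> Cone - x * u l <> Czero) ->
  Cprod n (fun l => (Cone - x * v l) / (Cone - x * u l)) =
  Cprod n (fun l => v l / u l) + Csum n (fun l => pf_coef u v n l / (Cone - x * u l)).
Proof.
  induction n; intros Hu Hd x Hx; [simpl; ring|].
  assert (Hu' : forall l, (l < n)%nat -> u l <> Czero) by auto.
  assert (Hd' : forall l j, (l < n)%nat -> (j < n)%nat -> l <> j -> u l <> u j) by auto.
  specialize (IHn Hu' Hd').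
  pose proof (Hu n ltac:(lia)) as Hn.
  pose proof (Hx n ltac:(lia)) as Hxn.
  assert (Hln : forall l, (l < n)%nat -> Cone - u n / u l <> Czero).
  { intros l Hl; apply one_sub_div_neq0; auto; apply Hd; lia. }
  assert (Hnl : forall l, (l < n)%nat -> Cone - u l / u n <> Czero).
  { intros l Hl; apply one_sub_div_neq0; auto; apply Hd; lia. }
  assert (C1 : forall l, (l < n)%nat ->
    pf_coef u v (S n) l = pf_coef u v n l * (Cone - v n / u l) / (Cone - u n / u l)).
  { intros l Hl; unfold pf_coef; simpl.
    destruct (Nat.eqb_spec n l) as [E|_]; [lia|].
    assert (Cprod n (fun j => if Nat.eqb j l then Cone else Cone - u j / u l) <> Czero).
    { apply Cprod_neq0; intros i Hi; destruct (Nat.eqb_spec i l); [apply Cone_neq0|].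
      apply one_sub_div_neq0; auto. }
    specialize (Hln l Hl); set (D := Cprod _ _) in *; set (G := Cone - u n / u l) in *.
    set (D' := Cprod n (fun j => if Nat.eqb j l then Cone else Cone - u j / u l)) in *.
    set (G' := Cone - v n / u l).
    field; auto. }
  assert (C2 : pf_coef u v (S n) n = (Cone - v n / u n) *
    (Cprod n (fun l => v l / u l) + Csum n (fun l => pf_coef u v n l / (Cone - u l / u n)))).
  { transitivity ((Cone - v n / u n) *
      Cprod n (fun l => (Cone - / u n * v l) / (Cone - / u n * u l))).
    - unfold pf_coef; simpl; rewrite Nat.eqb_refl.
      rewrite (Cprod_ext n (fun j => if Nat.eqb j n then Cone else Cone - u j / u n)
                (fun j => Cone - / u n * u j)).
      2:{ intros i Hi; destruct (Nat.eqb_spec i n); [lia|field; auto]. }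
      rewrite (Cprod_ext n (fun j => Cone - v j / u n) (fun j => Cone - / u n * v j))
        by (intros; field; auto).
      assert (Q : Cprod n (fun j => Cone - / u n * u j) <> Czero).
      { apply Cprod_neq0; intros i Hi; specialize (Hnl i Hi).
        replace (/ u n * u i) with (u i / u n) by (field; auto); auto. }
      assert (QQ : Cprod n (fun l => (Cone - / u n * v l) / (Cone - / u n * u l))
                * Cprod n (fun j => Cone - / u n * u j) = Cprod n (fun j => Cone - / u n * v j)).
      { rewrite <- Cprod_mul; apply Cprod_ext; intros i Hi.
        specialize (Hnl i Hi).
        replace (u i / u n) with (/ u n * u i) in Hnl by (field; auto).
        set (w := / u n) in *; field; auto. }
      rewrite <- QQ; set (D := Cprod n (fun j => Cone - / u n * u j)) in *.
      set (w := v n / u n).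
      field; repeat split; auto.
    - f_equal; rewrite IHn; [f_equal; apply Csum_ext; intros i Hi;
        replace (/ u n * u i) with (u i / u n) by (field; auto); reflexivity|].
      intros l Hl; replace (/ u n * u l) with (u l / u n) by (field; auto); auto. }
  simpl; rewrite IHn by auto; rewrite C2.
  rewrite (Csum_ext n (fun l => pf_coef u v (S n) l / (Cone - x * u l))
    (fun l => pf_coef u v n l / (Cone - x * u l) * ((Cone - x * v n) / (Cone - x * u n))
      - (Cone - v n / u n) / (Cone - x * u n) * (pf_coef u v n l / (Cone - u l / u n)))).
  - rewrite Csum_minus, Csum_scal.
    rewrite (Csum_ext n (fun l => pf_coef u v n l / (Cone - x * u l)
               * ((Cone - x * v n) / (Cone - x * u n)))
              (fun l => (Cone - x * v n) / (Cone - x * u n)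
                        * (pf_coef u v n l / (Cone - x * u l)))) by (intros; ring).
    rewrite Csum_scal.
    set (A := Cprod n _); set (B := Csum n _); set (C := Csum n _).
    field; auto.
  - intros l Hl; rewrite C1 by auto.
    specialize (Hln l Hl); specialize (Hnl l Hl); pose proof (Hu' l Hl).
    pose proof (Hx l ltac:(lia)).
    assert (u l - u n <> Czero).
    { intros E; apply (Hd l n); try lia.
      replace (u l) with (u l - u n + u n) by ring; rewrite E; ring. }
    assert (u n - u l <> Czero).
    { intros E; apply (Hd l n); try lia.
      replace (u l) with (u n - (u n - u l)) by ring; rewrite E; ring. }
    set (P := pf_coef u v n l).
    field; repeat split; auto.
Qed.

(** * The bilateral series as a theta quotient *)

Section Theta.

Variable q : Cpx.
Hypotheses (Hq : (Cnorm q < 1)%R) (Hq0 : q <> Czero).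

Lemma qpow_neq0 n : q ^ n <> Czero.
Proof. apply Cpow_neq0; auto. Qed.

Lemma qpoch_Cprod x n : qpoch x q n = Cprod n (fun i => Cone - x * q ^ i).
Proof. induction n; simpl; [auto|rewrite IHn; auto]. Qed.

(** The part independent of x that appears when factors with negative exponents are inverted; it
    cancels in quotients with equally many windows above and below. *)
Definition window_const (l : nat) : Cpx := Cprod l (fun i => - / q ^ S i).

Lemma window_const_neq0 l : window_const l <> Czero.
Proof.
  apply Cprod_neq0; intros i _ E; apply (Cinv_neq0 _ (qpow_neq0 (S i))).
  replace (/ q ^ S i) with (- - / q ^ S i) by ring; rewrite E; ring.
Qed.

(* M factors of theta(x), those with exponents -l, ..., M - 1 - l of q. *)
Definition window (M l : nat) (x : Cpx) : Cpx := Cprod M (fun j => Cone - x * q ^ j / q ^ l).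

(** Factor by factor, 1 - x q^(-i) = -x q^(-i) (1 - q^i/x) for i = 1, ..., l. *)
Lemma window_low x l : x <> Czero ->
  Cprod l (fun j => Cone - x * q ^ j / q ^ l) = window_const l * x ^ l * qpoch (q / x) q l.
Proof.
  intros Hx; unfold window_const; induction l; [simpl; ring|].
  rewrite Cprod_first.
  rewrite (Cprod_ext l _ (fun j => Cone - x * q ^ j / q ^ l)).
  - rewrite IHl; simpl.
    pose proof (qpow_neq0 l); field; auto.
  - intros i _; simpl; pose proof (qpow_neq0 l); f_equal; field; auto.
Qed.

Lemma window_high x l m :
  Cprod m (fun j => Cone - x * q ^ (l + j) / q ^ l) = qpoch x q m.
Proof.
  rewrite qpoch_Cprod; apply Cprod_ext; intros i _; rewrite Cpow_add.
  pose proof (qpow_neq0 l); f_equal; field; auto.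
Qed.

Lemma window_eq M l x : x <> Czero -> (l <= M)%nat ->
  window M l x = window_const l * x ^ l * qpoch (q / x) q l * qpoch x q (M - l).
Proof.
  intros Hx Hl; unfold window; replace M with (l + (M - l))%nat at 1 by lia.
  rewrite Cprod_split, window_low, window_high by auto; auto.
Qed.

(** A window of theta at x = 1 without its zero factor; the part above the gap starts at exponent 1,
    hence has one factor fewer. *)
Lemma window_punctured M l : (l < M)%nat ->
  Cprod M (fun j => if Nat.eqb j l then Cone else Cone - q ^ j / q ^ l)
  = window_const l * qpoch q q l * qpoch q q (M - 1 - l).
Proof.
  intros Hl; replace M with (l + S (M - 1 - l))%nat at 1 by lia.
  rewrite Cprod_split, Cprod_first, Nat.add_0_r, Nat.eqb_refl.
  rewrite (Cprod_ext l _ (fun j => Cone - Cone * q ^ j / q ^ l)).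
  2:{ intros i Hi; destruct (Nat.eqb_spec i l); [lia|].
      f_equal; pose proof (qpow_neq0 l); field; auto. }
  rewrite window_low by apply Cone_neq0.
  rewrite (Cprod_ext (M - 1 - l) _ (fun j => Cone - q * q ^ j)).
  2:{ intros i Hi; destruct (Nat.eqb_spec (l + S i) l); [lia|].
      rewrite Cpow_add; simpl; f_equal; pose proof (qpow_neq0 l); field; auto. }
  rewrite <- qpoch_Cprod.
  replace (q / Cone) with q by (field; apply Cone_neq0).
  rewrite Cpow_1; ring.
Qed.

Lemma qpow_inj i j : q ^ i = q ^ j -> i = j.
Proof.
  assert (A : forall i j, (i < j)%nat -> q ^ i <> q ^ j).
  { intros m n L E; assert (N : qnz q q) by (apply qnz_small; auto).
    apply (qnz_factor _ _ (n - m - 1) N).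
    apply (f_equal (fun t => t / q ^ m)) in E.
    replace n with (m + (1 + (n - m - 1)))%nat in E by lia.
    rewrite Cpow_add, Cpow_add in E; simpl in E.
    pose proof (qpow_neq0 m).
    transitivity (Cone - q ^ m / q ^ m); [rewrite E; field; auto|field; auto]. }
  intros E; destruct (Nat.lt_trichotomy i j) as [L|[L|L]]; auto.
  - exfalso; exact (A _ _ L E).
  - exfalso; exact (A _ _ L (eq_sym E)).
Qed.

Lemma qnz_inv y : y <> Czero -> qnz y q -> qnz (q / y) q -> qnz (/ y) q.
Proof.
  intros Hy H1 H2 [|n]; [apply Cone_neq0|].
  rewrite qpoch_first; replace (/ y * q) with (q / y) by (field; auto).
  apply Cmul_neq0; auto; intros E; apply (qnz_factor0 _ _ H1).
  replace (Cone - y) with (- y * (Cone - / y)) by (field; auto); rewrite E; ring.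
Qed.

(** The inversion theta(1/y) = -theta(y)/y. *)
Lemma qpinf_flip y : y <> Czero ->
  qpinf (/ y) q * qpinf (q * y) q = - / y * (qpinf y q * qpinf (q / y) q).
Proof.
  intros Hy; rewrite (qpinf_first (/ y)), (qpinf_first y) by auto.
  replace (/ y * q) with (q / y) by (field; auto).
  replace (y * q) with (q * y) by ring.
  field; auto.
Qed.

Variables a k z : Cpx.
Hypotheses (Ha0 : a <> Czero) (Hk0 : k <> Czero) (Hz0 : z <> Czero)
  (Ha : qnz a q) (Ha' : qnz (q / a) q) (Hk : qnz k q) (Hk' : qnz (q / k) q)
  (Haz : qnz (z / a) q) (Haz' : qnz (q * a / z) q)
  (Hkz : qnz (z / k) q) (Hkz' : qnz (q * k / z) q).

(** [ediff] is e and [ebil] is E of the overview. *)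
Definition ediff (x : Cpx) : Cpx := / (Cone - k * x) - / (Cone - a * x).

Definition ebil (x : Cpx) : Cpx := ediff x - ediff (x / z).

Definition ebil_partial (N : nat) : Cpx :=
  ebil Cone + Csum N (fun i => ebil (q ^ S i) + ebil (/ q ^ S i)).

Definition theta_quotient : Cpx :=
  z / k *
     (qpinf z q * qpinf (q / z) q * qpinf (k / a) q * qpinf (q * a / k) q
      * qpinf (a * k / z) q * qpinf (q * z / (a * k)) q * qpinf q q * qpinf q q)
     / (qpinf (z / k) q * qpinf (q * k / z) q * qpinf (z / a) q * qpinf (q * a / z) q
        * qpinf a q * qpinf (q / a) q * qpinf k q * qpinf (q / k) q).

Lemma ebil_partial_eq N :
  ebil_partial N = Csum (2 * N + 1) (fun l => ebil (q ^ l / q ^ N)).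
Proof.
  rewrite Csum_symmetric; unfold ebil_partial; f_equal.
  - f_equal; pose proof (qpow_neq0 N); field; auto.
  - apply Csum_ext; intros i Hi; f_equal; f_equal.
    + rewrite Cpow_add; pose proof (qpow_neq0 N); field; auto.
    + replace N with (N - S i + S i)%nat at 2 by lia; rewrite Cpow_add.
      pose proof (qpow_neq0 (N - S i)); pose proof (qpow_neq0 (S i)); field; auto.
Qed.

Lemma ediff_lim0 y : Cvg (fun N => ediff (y * q ^ N)) Czero.
Proof.
  assert (L : forall b, Cvg (fun N => / (Cone - b * (y * q ^ N))) (/ Cone)).
  { intros b; apply Cvg_inv; [apply Cone_neq0|].
    apply (Cvg_eq _ (Cone - b * (y * Czero))); [ring|].
    apply Cvg_sub; [apply Cvg_const|].
    repeat (apply Cvg_mul; [apply Cvg_const|]); apply Cvg_pow; auto. }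
  apply (Cvg_eq _ (/ Cone - / Cone)); [ring|].
  apply Cvg_sub; apply L.
Qed.

Lemma ediff_liminf y : y <> Czero -> Cvg (fun N => ediff (y / q ^ N)) Czero.
Proof.
  intros Hy.
  assert (L : forall b, b <> Czero -> Cvg (fun N => / (Cone - b * (y / q ^ N))) Czero).
  { intros b Hb.
    (* The denominator may vanish for some N; the rewriting survives because [Cinv_div] covers that
       case. *)
    apply Cvg_ext with (fun N => q ^ N / (q ^ N - b * y)).
    - intros N; pose proof (qpow_neq0 N).
      rewrite <- Cinv_div by auto; f_equal; field; auto.
    - assert (b * y <> Czero) by (apply Cmul_neq0; auto).
      assert (Czero - b * y <> Czero).
      { intros E; apply H; replace (b * y) with (- (Czero - b * y)) by ring.
        rewrite E; ring. }
      apply (Cvg_eq _ (Czero / (Czero - b * y))); [unfold Cdiv; ring|].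
      apply Cvg_div; auto; [apply Cvg_pow; auto|].
      apply Cvg_sub; [apply Cvg_pow; auto|apply Cvg_const]. }
  apply (Cvg_eq _ (Czero - Czero)); [ring|].
  apply Cvg_sub; apply L; auto.
Qed.

(** Only m differences between the two ends of the window remain, and e tends to 0 both at 0 and at
    infinity. *)
Lemma ediff_telescope y m : y <> Czero ->
  Cvg (fun N => Csum (2 * N + 1) (fun l => ediff (y * q ^ (l + m) / q ^ N)
                                           - ediff (y * q ^ l / q ^ N))) Czero.
Proof.
  intros Hy.
  apply Cvg_ext with (fun N => Csum m (fun i => ediff (y * q ^ i * q * q ^ N)
                                           - ediff (y * q ^ i / q ^ N))).
  - intros N; rewrite (Csum_shift_diff (fun l => ediff (y * q ^ l / q ^ N))).
    apply Csum_ext; intros i _; f_equal; f_equal.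
    replace (2 * N + 1 + i)%nat with (N + (N + S i))%nat by lia.
    rewrite !Cpow_add; simpl; pose proof (qpow_neq0 N); field; auto.
  - induction m; simpl; [apply Cvg_const|].
    apply (Cvg_eq _ (Czero + (Czero - Czero))); [ring|].
    apply Cvg_add; auto; apply Cvg_sub; [apply ediff_lim0|apply ediff_liminf].
    apply Cmul_neq0; auto; apply qpow_neq0.
Qed.

Lemma qpoch_eq0 x n : qpoch x q n = Czero -> exists i, Cone - x * q ^ i = Czero.
Proof.
  induction n; intros H; [exfalso; exact (Cone_neq0 H)|].
  rewrite qpoch_S in H; apply Cmul_eq0 in H; destruct H; eauto.
Qed.

Lemma not_qnz x : ~ qnz x q -> exists i, Cone - x * q ^ i = Czero.
Proof.
  intros H; apply not_all_ex_not in H; destruct H as [n H].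
  apply NNPP in H; eapply qpoch_eq0; eauto.
Qed.

(* For z an integral power of q the bilateral series telescopes and the theta
   quotient vanishes; the partial fraction expansion would have double poles. *)
Lemma ebil_degenerate : ~ (qnz z q /\ qnz (q / z) q) -> Cvg ebil_partial theta_quotient.
Proof.
  intros H.
  assert (T : theta_quotient = Czero).
  { assert (Z : qpinf z q = Czero \/ qpinf (q / z) q = Czero).
    { apply NNPP; intros N; apply H; split; apply qnz_of_qpinf; auto. }
    unfold theta_quotient, Cdiv; destruct Z as [-> | E]; [ring|].
    unfold Cdiv in E; rewrite E; ring. }
  rewrite T.
  apply Cvg_ext with (fun N => Csum (2 * N + 1) (fun l => ebil (q ^ l / q ^ N)));
    [intros; symmetry; apply ebil_partial_eq|].
  assert (C : (exists m, z * q ^ m = Cone) \/ (exists m, z = q ^ m)).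
  { destruct (classic (qnz z q)) as [Z|Z].
    - right; destruct (not_qnz (q / z)) as [i Hi]; [tauto|].
      exists (S i); simpl.
      replace z with (z * (Cone - q / z * q ^ i) + q * q ^ i) by (field; auto).
      rewrite Hi; ring.
    - left; destruct (not_qnz z Z) as [i Hi]; exists i.
      replace (z * q ^ i) with (Cone - (Cone - z * q ^ i)) by ring; rewrite Hi; ring. }
  (* For z = q^(-m), x/z = x q^m and E is the negative of the shift difference with y = 1; for z =
     q^m it is the shift difference with y = q^(-m). *)
  destruct C as [[m Hm]|[m Hm]].
  - apply (Cvg_eq _ (- Czero)); [ring|].
    apply Cvg_ext with (2 := Cvg_opp _ _ (ediff_telescope Cone m Cone_neq0)).
    intros N.
    replace (- Csum (2 * N + 1) (fun l => ediff (Cone * q ^ (l + m) / q ^ N)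
                                           - ediff (Cone * q ^ l / q ^ N)))
      with (- Cone * Csum (2 * N + 1) (fun l => ediff (Cone * q ^ (l + m) / q ^ N)
                                           - ediff (Cone * q ^ l / q ^ N))) by ring.
    rewrite <- Csum_scal; apply Csum_ext; intros l _; unfold ebil.
    replace (Cone * q ^ l / q ^ N) with (q ^ l / q ^ N)
      by (pose proof (qpow_neq0 N); field; auto).
    replace (Cone * q ^ (l + m) / q ^ N) with (q ^ l / q ^ N / z); [ring|].
    rewrite Cpow_add; pose proof (qpow_neq0 N); pose proof (qpow_neq0 m).
    replace (q ^ m) with (/ z); [field; auto|].
    replace (q ^ m) with (z * q ^ m / z) by (field; auto); rewrite Hm; field; auto.
  - apply Cvg_ext with (2 := ediff_telescope (/ q ^ m) m (Cinv_neq0 _ (qpow_neq0 m))).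
    intros N; apply Csum_ext; intros l _; unfold ebil; rewrite Hm.
    rewrite Cpow_add; pose proof (qpow_neq0 N); pose proof (qpow_neq0 m).
    f_equal; f_equal; field; auto.
Qed.

(** For l >= N this is a factor of (b;q)_oo, for l < N a nonzero multiple of a factor of
    (q/b;q)_oo. *)
Lemma qnz_window b l N : b <> Czero -> qnz b q -> qnz (q / b) q ->
  Cone - b * (q ^ l / q ^ N) <> Czero.
Proof.
  intros Hb H1 H2; pose proof (qpow_neq0 N) as HN.
  destruct (le_lt_dec N l) as [L|L].
  - replace (q ^ l) with (q ^ N * q ^ (l - N)) by (rewrite <- Cpow_add; f_equal; lia).
    replace (b * (q ^ N * q ^ (l - N) / q ^ N)) with (b * q ^ (l - N)) by (field; auto).
    apply qnz_factor; auto.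
  - pose proof (qpow_neq0 (N - l - 1)) as HM; pose proof (qpow_neq0 l) as Hl.
    replace (q ^ N) with (q ^ l * (q * q ^ (N - l - 1))).
    2:{ change (q * q ^ (N - l - 1)) with (q ^ S (N - l - 1)).
        rewrite <- Cpow_add; f_equal; lia. }
    set (t := q ^ (N - l - 1)) in *.
    replace (Cone - b * (q ^ l / (q ^ l * (q * t))))
      with (- (b / (q * t)) * (Cone - q / b * t)) by (field; repeat split; auto).
    apply Cmul_neq0; [|apply qnz_factor; auto].
    intros E; apply Hb.
    replace b with (- (- (b / (q * t))) * (q * t)) by (field; auto).
    rewrite E; ring.
Qed.

(** * Truncated theta quotients for z not an integral power of q *)

Hypotheses (Hz : qnz z q) (Hz' : qnz (q / z) q).

Let vaz : qnz (a / z) q.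
Proof.
  replace (a / z) with (/ (z / a)) by (field; auto).
  apply qnz_inv; auto.
  - apply Cmul_neq0; auto; apply Cinv_neq0; auto.
  - replace (q / (z / a)) with (q * a / z) by (field; auto); auto.
Qed.

Let vaz' : qnz (q / (a / z)) q.
Proof. replace (q / (a / z)) with (z / a * q) by (field; auto); apply qnz_mulq; auto. Qed.

Let vkz : qnz (k / z) q.
Proof.
  replace (k / z) with (/ (z / k)) by (field; auto).
  apply qnz_inv; auto.
  - apply Cmul_neq0; auto; apply Cinv_neq0; auto.
  - replace (q / (z / k)) with (q * k / z) by (field; auto); auto.
Qed.

Let vkz' : qnz (q / (k / z)) q.
Proof. replace (q / (k / z)) with (z / k * q) by (field; auto); apply qnz_mulq; auto. Qed.

Let viz : qnz (/ z) q.
Proof. apply qnz_inv; auto. Qed.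

Let vqz : qnz (q * z) q.
Proof. replace (q * z) with (z * q) by ring; apply qnz_mulq; auto. Qed.

Let Hqq : qnz q q.
Proof. apply qnz_small; auto. Qed.

Let az0 : a / z <> Czero.
Proof. apply Cmul_neq0; auto; apply Cinv_neq0; auto. Qed.

Let kz0 : k / z <> Czero.
Proof. apply Cmul_neq0; auto; apply Cinv_neq0; auto. Qed.

Let zk0 : z / k <> Czero.
Proof. apply Cmul_neq0; auto; apply Cinv_neq0; auto. Qed.

(* As a function of x, the product over j < M of
   (1 - x q^j / k) (1 - x k q^j / z) / ((1 - x q^j) (1 - x q^j / z)), to be
   taken at x = a / q^N with M = 2 N + 1, is encoded by the sequences of its
   2 M poles and zeros; it vanishes at x = k / q^N. *)
Definition node (M l : nat) : Cpx := if Nat.ltb l M then q ^ l else q ^ (l - M) / z.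

Definition zero_node (M l : nat) : Cpx :=
  if Nat.ltb l M then q ^ l / k else k * q ^ (l - M) / z.

Definition residue1 (M l : nat) : Cpx :=
  qpoch (/ k) q (M - l) * qpoch (q * k) q l * qpoch (k / z) q (M - l) * qpoch (q * z / k) q l
  / (qpoch q q (M - 1 - l) * qpoch q q l * qpoch (/ z) q (M - l) * qpoch (q * z) q l).

Definition residue2 (M l : nat) : Cpx :=
  qpoch (z / k) q (M - l) * qpoch (q * k / z) q l * qpoch k q (M - l) * qpoch (q / k) q l
  / (qpoch q q (M - 1 - l) * qpoch q q l * qpoch z q (M - l) * qpoch (q / z) q l).

Lemma node_low M l : (l < M)%nat -> node M l = q ^ l.
Proof. intros H; unfold node; destruct (Nat.ltb_spec l M); auto; lia. Qed.

Lemma node_high M l : node M (M + l) = q ^ l / z.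
Proof.
  unfold node; destruct (Nat.ltb_spec (M + l) M); [lia|].
  replace (M + l - M)%nat with l by lia; auto.
Qed.

Lemma zero_node_low M l : (l < M)%nat -> zero_node M l = q ^ l / k.
Proof. intros H; unfold zero_node; destruct (Nat.ltb_spec l M); auto; lia. Qed.

Lemma zero_node_high M l : zero_node M (M + l) = k * q ^ l / z.
Proof.
  unfold zero_node; destruct (Nat.ltb_spec (M + l) M); [lia|].
  replace (M + l - M)%nat with l by lia; auto.
Qed.

(** Each product over a family is a window at 1/k, k/z, 1 (punctured) or 1/z. The l-th powers cancel
    because (1/k)(k/z) = 1/z, and so do the constants. *)
Lemma pf_coef_low M l : (l < M)%nat ->
  pf_coef (node M) (zero_node M) (M + M) l = residue1 M l.
Proof.
  intros Hl; unfold pf_coef; rewrite !Cprod_split, (node_low M l Hl).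
  pose proof (qpow_neq0 l) as Q.
  rewrite (Cprod_ext M _ (fun j => Cone - / k * q ^ j / q ^ l)).
  2:{ intros j Hj; rewrite zero_node_low by auto; f_equal; field; auto. }
  rewrite (Cprod_ext M (fun i => Cone - zero_node M (M + i) / q ^ l)
            (fun j => Cone - k / z * q ^ j / q ^ l)).
  2:{ intros j Hj; rewrite zero_node_high; f_equal; field; auto. }
  rewrite (Cprod_ext M (fun j => if Nat.eqb j l then Cone else Cone - node M j / q ^ l)
            (fun j => if Nat.eqb j l then Cone else Cone - q ^ j / q ^ l)).
  2:{ intros j Hj; rewrite node_low by auto; auto. }
  rewrite (Cprod_ext M (fun i => if Nat.eqb (M + i) l then _ else _)
            (fun j => Cone - / z * q ^ j / q ^ l)).
  2:{ intros j Hj; rewrite node_high; destruct (Nat.eqb_spec (M + j) l); [lia|].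
      f_equal; field; auto. }
  rewrite window_punctured by auto.
  pose proof (window_eq M l (/ k) (Cinv_neq0 _ Hk0) ltac:(lia)) as E1.
  pose proof (window_eq M l (k / z) kz0 ltac:(lia)) as E2.
  pose proof (window_eq M l (/ z) (Cinv_neq0 _ Hz0) ltac:(lia)) as E3.
  unfold window in E1, E2, E3; rewrite E1, E2, E3; unfold residue1.
  replace (q / / k) with (q * k) by (field; split; auto using Cone_neq0).
  replace (q / (k / z)) with (q * z / k) by (field; auto).
  replace (q / / z) with (q * z) by (field; split; auto using Cone_neq0).
  replace ((/ z) ^ l) with ((/ k) ^ l * (k / z) ^ l).
  2:{ rewrite <- Cpow_mul; f_equal; field; auto. }
  pose proof (Cpow_neq0 _ l (Cinv_neq0 _ Hk0)); pose proof (Cpow_neq0 _ l kz0).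
  pose proof (window_const_neq0 l).
  pose proof (viz (M - l)%nat); pose proof (vqz l); pose proof (Hqq (M - 1 - l)%nat).
  pose proof (Hqq l).
  set (y := k / z) in *; set (y' := / k) in *; set (y'' := / z) in *.
  set (y3 := q * z / k) in *.
  field; repeat split; auto.
Qed.

(** The same at the second family of poles, with windows at z/k, k, z and the punctured one at 1;
    here (z/k) k = z. *)
Lemma pf_coef_high M l : (l < M)%nat ->
  pf_coef (node M) (zero_node M) (M + M) (M + l) = residue2 M l.
Proof.
  intros Hl; unfold pf_coef; rewrite !Cprod_split, (node_high M l).
  pose proof (qpow_neq0 l) as Q.
  rewrite (Cprod_ext M _ (fun j => Cone - z / k * q ^ j / q ^ l)).
  2:{ intros j Hj; rewrite zero_node_low by auto; f_equal; field; auto. }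
  rewrite (Cprod_ext M (fun i => Cone - zero_node M (M + i) / (q ^ l / z))
            (fun j => Cone - k * q ^ j / q ^ l)).
  2:{ intros j Hj; rewrite zero_node_high; f_equal; field; auto. }
  rewrite (Cprod_ext M (fun j => if Nat.eqb j (M + l) then _ else _)
            (fun j => Cone - z * q ^ j / q ^ l)).
  2:{ intros j Hj; rewrite node_low by auto; destruct (Nat.eqb_spec j (M + l)); [lia|].
      f_equal; field; auto. }
  rewrite (Cprod_ext M (fun i => if Nat.eqb (M + i) (M + l) then _ else _)
            (fun j => if Nat.eqb j l then Cone else Cone - q ^ j / q ^ l)).
  2:{ intros j Hj; rewrite node_high.
      destruct (Nat.eqb_spec (M + j) (M + l)), (Nat.eqb_spec j l); try lia; auto.
      f_equal; field; auto. }
  rewrite window_punctured by auto.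
  pose proof (window_eq M l (z / k) zk0 ltac:(lia)) as E1.
  pose proof (window_eq M l k Hk0 ltac:(lia)) as E2.
  pose proof (window_eq M l z Hz0 ltac:(lia)) as E3.
  unfold window in E1, E2, E3; rewrite E1, E2, E3; unfold residue2.
  replace (q / (z / k)) with (q * k / z) by (field; auto).
  replace (z ^ l) with ((z / k) ^ l * k ^ l).
  2:{ rewrite <- Cpow_mul; f_equal; field; auto. }
  pose proof (Cpow_neq0 _ l Hk0); pose proof (Cpow_neq0 _ l zk0).
  pose proof (window_const_neq0 l).
  pose proof (Hz (M - l)%nat); pose proof (Hz' l); pose proof (Hqq (M - 1 - l)%nat).
  pose proof (Hqq l).
  set (y := z / k) in *; set (y' := q / z) in *; set (y3 := q * k / z) in *.
  set (y4 := q / k) in *.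
  field; repeat split; auto.
Qed.

Lemma node_neq0 M l : node M l <> Czero.
Proof.
  unfold node; destruct (Nat.ltb l M); [apply qpow_neq0|].
  apply Cmul_neq0; [apply qpow_neq0|apply Cinv_neq0; auto].
Qed.

(** Poles of different families stay apart precisely because z is not an integral power of q. *)
Lemma node_inj M l j : (l < M + M)%nat -> (j < M + M)%nat -> l <> j -> node M l <> node M j.
Proof.
  assert (X : forall i i', q ^ i <> q ^ i' / z).
  { intros i i' E; pose proof (qpow_neq0 i').
    apply (qnz_window z i i' Hz0 Hz Hz'); rewrite E; field; auto. }
  intros Hl Hj Hlj; unfold node.
  destruct (Nat.ltb_spec l M), (Nat.ltb_spec j M).
  - intros E; apply Hlj, qpow_inj; auto.
  - apply X.
  - intros E; symmetry in E; revert E; apply X.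
  - intros E; apply Hlj.
    assert (E' : q ^ (l - M) = q ^ (j - M)).
    { replace (q ^ (l - M)) with (q ^ (l - M) / z * z) by (field; auto).
      rewrite E; field; auto. }
    apply qpow_inj in E'; lia.
Qed.

Definition finite_quotient (M : nat) (x : Cpx) : Cpx :=
  Cprod (M + M) (fun l => (Cone - x * zero_node M l) / (Cone - x * node M l)).

Lemma finite_quotient_pf M b N :
  b <> Czero -> qnz b q -> qnz (q / b) q -> qnz (b / z) q -> qnz (q / (b / z)) q ->
  finite_quotient M (b / q ^ N) =
  Cprod (M + M) (fun l => zero_node M l / node M l)
  + Csum M (fun l => residue1 M l / (Cone - b * (q ^ l / q ^ N))
                     + residue2 M l / (Cone - b * (q ^ l / q ^ N / z))).
Proof.
  intros Hb H1 H2 H3 H4; unfold finite_quotient; pose proof (qpow_neq0 N) as QN.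
  assert (bz : b / z <> Czero) by (apply Cmul_neq0; auto; apply Cinv_neq0; auto).
  rewrite partial_fractions.
  - f_equal; rewrite Csum_split, Csum_plus; f_equal; apply Csum_ext; intros l Hl.
    + rewrite pf_coef_low, node_low by auto; do 2 f_equal; field; auto.
    + rewrite pf_coef_high, node_high by auto; do 2 f_equal; field; auto.
  - intros; apply node_neq0.
  - intros; apply node_inj; auto.
  - intros l Hl; unfold node; destruct (Nat.ltb l M).
    + replace (b / q ^ N * q ^ l) with (b * (q ^ l / q ^ N)) by (field; auto).
      apply qnz_window; auto.
    + replace (b / q ^ N * (q ^ (l - M) / z)) with (b / z * (q ^ (l - M) / q ^ N))
        by (field; auto).
      apply qnz_window; auto.
Qed.

(** The factor of index N has its zero there. Subtracting this value later costs nothing and removes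
    the constant of the expansion. *)
Lemma finite_quotient_root N : finite_quotient (2 * N + 1) (k / q ^ N) = Czero.
Proof.
  unfold finite_quotient.
  set (M := (2 * N + 1)%nat).
  replace (M + M)%nat with (N + S (M + M - N - 1))%nat by lia.
  rewrite Cprod_split, Cprod_first, Nat.add_0_r, zero_node_low by lia.
  replace (Cone - k / q ^ N * (q ^ N / k)) with Czero
    by (pose proof (qpow_neq0 N); field; auto).
  unfold Cdiv; ring.
Qed.

(** With M = 2N + 1 factors per window, N have negative exponents and N + 1 do not. *)
Definition finite_theta (N : nat) : Cpx :=
  qpoch (q * k / a) q N * qpoch (a / k) q (N + 1)
  * qpoch (q * z / (a * k)) q N * qpoch (a * k / z) q (N + 1)
  / (qpoch (q / a) q N * qpoch a q (N + 1) * qpoch (q * z / a) q N * qpoch (a / z) q (N + 1)).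

(** The powers from the four windows cancel because (a/k)(ak/z) = a (a/z). *)
Lemma finite_quotient_theta N : finite_quotient (2 * N + 1) (a / q ^ N) = finite_theta N.
Proof.
  unfold finite_quotient; set (M := (2 * N + 1)%nat); pose proof (qpow_neq0 N) as QN.
  rewrite Cprod_split.
  rewrite (Cprod_ext M _
    (fun j => (Cone - a / k * q ^ j / q ^ N) / (Cone - a * q ^ j / q ^ N))).
  2:{ intros j Hj; rewrite zero_node_low, node_low by auto.
      f_equal; [f_equal; field; auto|f_equal; field; auto]. }
  rewrite (Cprod_ext M (fun i => (Cone - a / q ^ N * zero_node M (M + i)) / _)
    (fun j => (Cone - a * k / z * q ^ j / q ^ N) / (Cone - a / z * q ^ j / q ^ N))).
  2:{ intros j Hj; rewrite zero_node_high, node_high.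
      f_equal; [f_equal; field; auto|f_equal; field; auto]. }
  rewrite !Cprod_div.
  2:{ intros j _; replace (a / z * q ^ j / q ^ N) with (a / z * (q ^ j / q ^ N))
        by (field; auto); apply qnz_window; auto. }
  2:{ intros j _; replace (a * q ^ j / q ^ N) with (a * (q ^ j / q ^ N))
        by (field; auto); apply qnz_window; auto. }
  assert (ak0 : a / k <> Czero) by (apply Cmul_neq0; auto; apply Cinv_neq0; auto).
  assert (akz0 : a * k / z <> Czero).
  { apply Cmul_neq0; [apply Cmul_neq0|apply Cinv_neq0]; auto. }
  pose proof (window_eq M N (a / k) ak0 ltac:(lia)) as E1.
  pose proof (window_eq M N (a * k / z) akz0 ltac:(lia)) as E2.
  pose proof (window_eq M N a Ha0 ltac:(lia)) as E3.
  pose proof (window_eq M N (a / z) az0 ltac:(lia)) as E4.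
  unfold window in *; rewrite E1, E2, E3, E4; unfold finite_theta.
  replace (M - N)%nat with (N + 1)%nat by lia.
  replace (q / (a / k)) with (q * k / a) by (field; auto).
  replace (q / (a * k / z)) with (q * z / (a * k)) by (field; auto).
  pose proof (vaz' N) as V.
  replace (q / (a / z)) with (q * z / a) in * by (field; auto).
  assert (P : (a / k) ^ N * (a * k / z) ^ N = a ^ N * (a / z) ^ N).
  { rewrite <- !Cpow_mul; f_equal; field; auto. }
  pose proof (Cpow_neq0 _ N Ha0); pose proof (Cpow_neq0 _ N az0).
  pose proof (window_const_neq0 N); pose proof (Ha (N + 1)%nat); pose proof (Ha' N).
  pose proof (vaz (N + 1)%nat).
  set (q1 := qpoch (q * k / a) q N); set (q2 := qpoch (a / k) q (N + 1)).
  set (q3 := qpoch (q * z / (a * k)) q N); set (q4 := qpoch (a * k / z) q (N + 1)).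
  set (q5 := qpoch (q / a) q N) in *; set (q6 := qpoch a q (N + 1)) in *.
  set (q7 := qpoch (q * z / a) q N) in *; set (q8 := qpoch (a / z) q (N + 1)) in *.
  set (w := window_const N) in *.
  transitivity ((a / k) ^ N * (a * k / z) ^ N * (w * w * q1 * q2 * q3 * q4)
    / (a ^ N * (a / z) ^ N * (w * w * q5 * q6 * q7 * q8))).
  - set (t1 := (a / k) ^ N); set (t2 := (a * k / z) ^ N).
    set (t3 := (a / z) ^ N) in *; set (t4 := a ^ N) in *.
    field; repeat split; auto.
  - rewrite P.
    set (t3 := (a / z) ^ N) in *; set (t4 := a ^ N) in *.
    field; repeat split; auto.
Qed.

(** The sign is due to e having the fraction with k first, whereas the expansion at k is subtracted
    from the one at a. *)
Definition window_term (N l : nat) : Cpx :=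
  - (residue1 (2 * N + 1) l * ediff (q ^ l / q ^ N)
     + residue2 (2 * N + 1) l * ediff (q ^ l / q ^ N / z)).

Lemma finite_identity N :
  finite_theta N = window_term N N
    + Csum N (fun i => window_term N (N + S i) + window_term N (N - S i)).
Proof.
  rewrite <- Csum_symmetric, <- finite_quotient_theta.
  replace (finite_quotient (2 * N + 1) (a / q ^ N))
    with (finite_quotient (2 * N + 1) (a / q ^ N) - finite_quotient (2 * N + 1) (k / q ^ N))
    by (rewrite finite_quotient_root; ring).
  rewrite !finite_quotient_pf by auto.
  (* The constant of the expansion is the same at a and at k and drops out. *)
  match goal with |- ?c + ?x - (?c + ?y) = _ => transitivity (x - y); [ring|] end.
  rewrite <- Csum_minus; apply Csum_ext; intros l _.
  unfold window_term, ediff, Cdiv; ring.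
Qed.

(** * Limits of the residues and of the truncated sums *)

Lemma qpoch_cvg_comp x (psi : nat -> nat) c : (forall N, (N <= psi N + c)%nat) ->
  Cvg (fun N => qpoch x q (psi N)) (qpinf x q).
Proof.
  intros H eps He; destruct (qpoch_cvg x q Hq eps He) as [N0 HN]; exists (N0 + c)%nat.
  intros N L; apply HN; specialize (H N); lia.
Qed.

Definition residue_lim : Cpx :=
  qpinf (z / k) q * qpinf (q * k / z) q * qpinf k q * qpinf (q / k) q
  / (qpinf q q * qpinf q q * qpinf z q * qpinf (q / z) q).

(** As [phi] stays within c of N, both l and M - l tend to infinity when M = 2N + 1, so all finite
    products become infinite ones. *)
Lemma residue2_cvg (phi : nat -> nat) c :
  (forall N, (N <= phi N + c)%nat /\ (phi N <= N + c)%nat) ->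
  Cvg (fun N => residue2 (2 * N + 1) (phi N)) residue_lim.
Proof.
  intros H; apply Cvg_div.
  - repeat apply Cmul_neq0; apply qpinf_neq0; auto.
  - repeat apply Cvg_mul; apply qpoch_cvg_comp with c; intros N; specialize (H N); lia.
  - repeat apply Cvg_mul; apply qpoch_cvg_comp with c; intros N; specialize (H N); lia.
Qed.

(** Inverting theta at k, z/k and z gives the factor (1/k)(k/z) / (-1/z) = -1: the two residues of
    an elliptic function with two simple poles are opposite. *)
Lemma residue1_cvg (phi : nat -> nat) c :
  (forall N, (N <= phi N + c)%nat /\ (phi N <= N + c)%nat) ->
  Cvg (fun N => residue1 (2 * N + 1) (phi N)) (- residue_lim).
Proof.
  intros H.
  apply (Cvg_eq _ (qpinf (/ k) q * qpinf (q * k) q * qpinf (k / z) q * qpinf (q * z / k) q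
    / (qpinf q q * qpinf q q * qpinf (/ z) q * qpinf (q * z) q))).
  - pose proof (qpinf_flip k Hk0) as E1; pose proof (qpinf_flip (z / k) zk0) as E2.
    pose proof (qpinf_flip z Hz0) as E3.
    replace (/ (z / k)) with (k / z) in E2 by (field; auto).
    replace (q * (z / k)) with (q * z / k) in E2 by (field; auto).
    replace (q / (z / k)) with (q * k / z) in E2 by (field; auto).
    transitivity ((qpinf (/ k) q * qpinf (q * k) q) * (qpinf (k / z) q * qpinf (q * z / k) q)
      / (qpinf q q * qpinf q q * (qpinf (/ z) q * qpinf (q * z) q))); [f_equal; ring|].
    rewrite E1, E2, E3; unfold residue_lim.
    pose proof (qpinf_neq0 _ _ Hq Hqq); pose proof (qpinf_neq0 _ _ Hq Hz).
    pose proof (qpinf_neq0 _ _ Hq Hz').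
    set (q1 := qpinf (q / z) q) in *; set (q2 := qpinf (z / k) q).
    set (q3 := qpinf (q * k / z) q); set (q4 := qpinf (q / k) q).
    field; repeat split; auto.
    exact (Copp_neq0 _ Cone_neq0).
  - apply Cvg_div.
    + repeat apply Cmul_neq0; apply qpinf_neq0; auto.
    + repeat apply Cvg_mul; apply qpoch_cvg_comp with c; intros N; specialize (H N); lia.
    + repeat apply Cvg_mul; apply qpoch_cvg_comp with c; intros N; specialize (H N); lia.
Qed.

Lemma Cbounded_qpoch0 {I} x (n : I -> nat) : Cbounded (fun t => qpoch x q (n t)).
Proof.
  apply Cbounded_ext with (fun t => qpoch (x * q ^ 0) q (n t)).
  - intros t; f_equal; simpl; ring.
  - exact (Cbounded_qpoch x q (fun _ => O) n Hq).
Qed.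

Lemma Cbounded_inv_qpoch0 {I} x (n : I -> nat) : qnz x q ->
  Cbounded (fun t => / qpoch x q (n t)).
Proof.
  intros H; apply Cbounded_ext with (fun t => / qpoch (x * q ^ 0) q (n t)).
  - intros t; do 2 f_equal; simpl; ring.
  - exact (Cbounded_inv_qpoch x q (fun _ => O) n Hq H).
Qed.

Lemma Cinv_mul4 w1 w2 w3 w4 : w1 <> Czero -> w2 <> Czero -> w3 <> Czero -> w4 <> Czero ->
  / w1 * / w2 * / w3 * / w4 = / (w1 * w2 * w3 * w4).
Proof. intros; field; auto. Qed.

Lemma residue1_bounded : exists B, (0 < B)%R /\ forall M l, (Cnorm (residue1 M l) <= B)%R.
Proof.
  assert (H : Cbounded (fun t : nat * nat => residue1 (fst t) (snd t))).
  { apply Cbounded_ext with (fun t : nat * nat =>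
      qpoch (/ k) q (fst t - snd t) * qpoch (q * k) q (snd t) * qpoch (k / z) q (fst t - snd t)
      * qpoch (q * z / k) q (snd t)
      * (/ qpoch q q (fst t - 1 - snd t) * / qpoch q q (snd t) * / qpoch (/ z) q (fst t - snd t)
         * / qpoch (q * z) q (snd t))).
    - intros t; unfold residue1, Cdiv; f_equal; apply Cinv_mul4; auto.
    - apply Cbounded_mul; repeat apply Cbounded_mul;
        first [apply Cbounded_qpoch0 | apply Cbounded_inv_qpoch0; auto]. }
  destruct H as [B [B0 HB]]; exists B; split; auto; intros M l; apply (HB (M, l)).
Qed.

Lemma residue2_bounded : exists B, (0 < B)%R /\ forall M l, (Cnorm (residue2 M l) <= B)%R.
Proof.
  assert (H : Cbounded (fun t : nat * nat => residue2 (fst t) (snd t))).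
  { apply Cbounded_ext with (fun t : nat * nat =>
      qpoch (z / k) q (fst t - snd t) * qpoch (q * k / z) q (snd t) * qpoch k q (fst t - snd t)
      * qpoch (q / k) q (snd t)
      * (/ qpoch q q (fst t - 1 - snd t) * / qpoch q q (snd t) * / qpoch z q (fst t - snd t)
         * / qpoch (q / z) q (snd t))).
    - intros t; unfold residue2, Cdiv; f_equal; apply Cinv_mul4; auto.
    - apply Cbounded_mul; repeat apply Cbounded_mul;
        first [apply Cbounded_qpoch0 | apply Cbounded_inv_qpoch0; auto]. }
  destruct H as [B [B0 HB]]; exists B; split; auto; intros M l; apply (HB (M, l)).
Qed.

Lemma Cbounded_inv_one_sub b (e : nat -> nat) : qnz b q ->
  Cbounded (fun i => / (Cone - b * q ^ e i)).
Proof.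
  intros H; apply Cbounded_ext with (fun i => / qpoch (b * q ^ e i) q 1).
  - intros i; f_equal; simpl; ring.
  - exact (Cbounded_inv_qpoch b q e (fun _ => 1%nat) Hq H).
Qed.

Lemma geometric_of_bounded (f g : nat -> Cpx) : Cbounded g -> (forall i, f i = q ^ i * g i) ->
  exists K, (0 < K)%R /\ forall i, (Cnorm (f i) <= K * Cnorm q ^ i)%R.
Proof.
  intros [K [K0 HK]] E; exists K; split; auto; intros i.
  rewrite E, Cnorm_mul, Cnorm_pow, Rmult_comm.
  apply Rmult_le_compat_r; auto; apply pow_le, Cnorm_ge0.
Qed.

(** Near 0 the decay comes from the difference of the two reciprocals, which has a factor x; near
    infinity each reciprocal is already of order 1/x. *)
Lemma ediff_bound y : y <> Czero -> qnz (k * y) q -> qnz (q / (k * y)) q ->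
  qnz (a * y) q -> qnz (q / (a * y)) q ->
  exists K, (0 < K)%R /\ forall i,
    (Cnorm (ediff (y * q ^ S i)%C) + Cnorm (ediff (y / q ^ S i)%C) <= K * Cnorm q ^ i)%R.
Proof.
  intros Hy H1 H2 H3 H4.
  assert (ky : k * y <> Czero) by (apply Cmul_neq0; auto).
  assert (ay : a * y <> Czero) by (apply Cmul_neq0; auto).
  destruct (geometric_of_bounded (fun i => ediff (y * q ^ S i))
    (fun i => (k - a) * y * q * (/ (Cone - k * y * q ^ S i) * / (Cone - a * y * q ^ S i))))
    as [K [K0 HK]].
  - apply Cbounded_mul; [apply Cbounded_const|].
    apply Cbounded_mul; apply (Cbounded_inv_one_sub _ S); auto.
  - intros i; unfold ediff.
    pose proof (qnz_factor _ _ (S i) H1); pose proof (qnz_factor _ _ (S i) H3).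
    replace (k * (y * q ^ S i)) with (k * y * q ^ S i) by ring.
    replace (a * (y * q ^ S i)) with (a * y * q ^ S i) by ring.
    simpl in *; set (t := q ^ i) in *; field; auto.
  - destruct (geometric_of_bounded (fun i => ediff (y / q ^ S i))
      (fun i => q / (a * y) * / (Cone - q / (a * y) * q ^ i)
                - q / (k * y) * / (Cone - q / (k * y) * q ^ i))) as [L [L0 HL]].
    + apply Cbounded_sub; (apply Cbounded_mul; [apply Cbounded_const|]);
        apply (Cbounded_inv_one_sub _ (fun i => i)); auto.
    + intros i.
      assert (F : forall w, w <> Czero -> qnz (q / w) q ->
        / (Cone - w * (/ q ^ S i)) = - (q ^ i * (q / w * / (Cone - q / w * q ^ i)))).
      { intros w Hw G; pose proof (qnz_factor _ _ i G) as G'; pose proof (qpow_neq0 i).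
        change (q ^ S i) with (q * q ^ i); set (t := q ^ i) in *.
        assert (w - q * t <> Czero).
        { intros E; apply G'.
          replace (Cone - q / w * t) with ((w - q * t) / w) by (field; auto).
          rewrite E; unfold Cdiv; ring. }
        assert (q * t - w <> Czero).
        { intros E; apply H0; replace (w - q * t) with (- (q * t - w)) by ring.
          rewrite E; ring. }
        field; repeat split; auto. }
      unfold ediff.
      replace (k * (y / q ^ S i)) with (k * y * / q ^ S i) by (unfold Cdiv; ring).
      replace (a * (y / q ^ S i)) with (a * y * / q ^ S i) by (unfold Cdiv; ring).
      rewrite !F by auto; ring.
    + exists (K + L)%R; split; [lra|]; intros i.
      specialize (HK i); specialize (HL i); simpl in HK, HL; simpl; lra.
Qed.

(** The factor z/k of the theorem arises here: passing from theta(a/k) to theta(k/a) gives -a/k, and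
    from theta(a/z) to theta(z/a) gives -a/z. *)
Lemma finite_theta_cvg : Cvg finite_theta (residue_lim * theta_quotient).
Proof.
  apply (Cvg_eq _ (qpinf (q * k / a) q * qpinf (a / k) q
    * qpinf (q * z / (a * k)) q * qpinf (a * k / z) q
    / (qpinf (q / a) q * qpinf a q * qpinf (q * z / a) q * qpinf (a / z) q))).
  - assert (ka0 : k / a <> Czero) by (apply Cmul_neq0; auto; apply Cinv_neq0; auto).
    assert (za0 : z / a <> Czero) by (apply Cmul_neq0; auto; apply Cinv_neq0; auto).
    pose proof (qpinf_flip (k / a) ka0) as E1; pose proof (qpinf_flip (z / a) za0) as E2.
    replace (/ (k / a)) with (a / k) in E1 by (field; auto).
    replace (q * (k / a)) with (q * k / a) in E1 by (field; auto).
    replace (q / (k / a)) with (q * a / k) in E1 by (field; auto).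
    replace (/ (z / a)) with (a / z) in E2 by (field; auto).
    replace (q * (z / a)) with (q * z / a) in E2 by (field; auto).
    replace (q / (z / a)) with (q * a / z) in E2 by (field; auto).
    transitivity ((qpinf (a / k) q * qpinf (q * k / a) q)
      * (qpinf (q * z / (a * k)) q * qpinf (a * k / z) q)
      / (qpinf (q / a) q * qpinf a q * (qpinf (a / z) q * qpinf (q * z / a) q)));
      [f_equal; ring|].
    rewrite E1, E2; unfold residue_lim, theta_quotient.
    pose proof (qpinf_neq0 _ _ Hq Hqq); pose proof (qpinf_neq0 _ _ Hq Hz).
    pose proof (qpinf_neq0 _ _ Hq Hz'); pose proof (qpinf_neq0 _ _ Hq Ha).
    pose proof (qpinf_neq0 _ _ Hq Ha'); pose proof (qpinf_neq0 _ _ Hq Hk).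
    pose proof (qpinf_neq0 _ _ Hq Hk'); pose proof (qpinf_neq0 _ _ Hq Haz).
    pose proof (qpinf_neq0 _ _ Hq Haz'); pose proof (qpinf_neq0 _ _ Hq Hkz).
    pose proof (qpinf_neq0 _ _ Hq Hkz').
    set (q1 := qpinf (z / k) q) in *; set (q2 := qpinf (q * k / z) q) in *.
    set (q3 := qpinf (z / a) q) in *; set (q4 := qpinf (q * a / z) q) in *.
    set (q5 := qpinf (q / a) q) in *; set (q6 := qpinf (q / k) q) in *.
    set (q7 := qpinf (q / z) q) in *; set (q8 := qpinf (k / a) q) in *.
    set (q9 := qpinf (q * a / k) q) in *; set (q10 := qpinf (a * k / z) q) in *.
    set (q11 := qpinf (q * z / (a * k)) q) in *.
    field; repeat split; auto.
    apply Copp_neq0; auto.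
  - assert (qnz (q * z / a) q).
    { replace (q * z / a) with (q / (a / z)) by (field; auto); auto. }
    unfold finite_theta; apply Cvg_div.
    + repeat apply Cmul_neq0; apply qpinf_neq0; auto.
    + repeat apply Cvg_mul; apply qpoch_cvg_comp with O; intros; lia.
    + repeat apply Cvg_mul; apply qpoch_cvg_comp with O; intros; lia.
Qed.

(** The index moves with N so that the exponent relative to the centre is fixed; only the residues
    still vary. *)
Lemma window_term_cvg (phi : nat -> nat) c t :
  (forall N, (N <= phi N + c)%nat /\ (phi N <= N + c)%nat) ->
  (forall N, (c <= N)%nat -> q ^ phi N / q ^ N = t) ->
  Cvg (fun N => window_term N (phi N)) (residue_lim * ebil t).
Proof.
  intros H E.
  apply Cvg_eventually with (p := c) (u := fun N =>
    - (residue1 (2 * N + 1) (phi N) * ediff t + residue2 (2 * N + 1) (phi N) * ediff (t / z))).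
  - intros N L; unfold window_term; rewrite E; auto.
  - apply (Cvg_eq _ (- (- residue_lim * ediff t + residue_lim * ediff (t / z))));
      [unfold ebil; ring|].
    apply Cvg_opp, Cvg_add; (apply Cvg_mul; [|apply Cvg_const]).
    + apply residue1_cvg with c; auto.
    + apply residue2_cvg with c; auto.
Qed.

Lemma qpow_window_up N i : q ^ (N + S i) / q ^ N = q ^ S i.
Proof. rewrite Cpow_add; pose proof (qpow_neq0 N); field; auto. Qed.

Lemma qpow_window_down N i : (S i <= N)%nat -> q ^ (N - S i) / q ^ N = / q ^ S i.
Proof.
  intros H; replace N with (N - S i + S i)%nat at 2 by lia; rewrite Cpow_add.
  pose proof (qpow_neq0 (N - S i)); pose proof (qpow_neq0 (S i)).
  set (t := q ^ S i) in *; set (t' := q ^ (N - S i)) in *.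
  field; auto.
Qed.

Lemma ebil_generic : Cvg ebil_partial theta_quotient.
Proof.
  assert (D0 : residue_lim <> Czero).
  { unfold residue_lim; apply Cmul_neq0; [|apply Cinv_neq0];
      repeat apply Cmul_neq0; apply qpinf_neq0; auto. }
  destruct residue1_bounded as [B1 [B10 HB1]]; destruct residue2_bounded as [B2 [B20 HB2]].
  destruct (ediff_bound Cone Cone_neq0) as [K1 [K10 HK1]];
    try (replace (k * Cone) with k by ring; auto);
    try (replace (a * Cone) with a by ring; auto).
  destruct (ediff_bound (/ z) (Cinv_neq0 _ Hz0)) as [K2 [K20 HK2]]; auto.
  assert (P1 : (0 < B1 * K1)%R) by (apply Rmult_lt_0_compat; auto).
  assert (P2 : (0 < B2 * K2)%R) by (apply Rmult_lt_0_compat; auto).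
  (* Bounded residues times the geometric decay of e on both sides give the dominating sequence. *)
  pose proof (tannery (fun N i => window_term N (N + S i) + window_term N (N - S i))
    (fun i => residue_lim * ebil (q ^ S i) + residue_lim * ebil (/ q ^ S i))
    (fun i => (B1 * K1 + B2 * K2) * Cnorm q ^ i)%R) as T.
  assert (T' : Cvg (fun N => finite_theta N - window_term N N
     - residue_lim * Csum N (fun i => ebil (q ^ S i) + ebil (/ q ^ S i))) Czero).
  { eapply Cvg_ext; [|apply T].
    - intros N; cbv beta.
      replace (residue_lim * Csum N (fun i => ebil (q ^ S i) + ebil (/ q ^ S i)))
        with (Csum N (fun i => residue_lim * ebil (q ^ S i) + residue_lim * ebil (/ q ^ S i)))
        by (rewrite <- Csum_scal; apply Csum_ext; intros; ring).
      rewrite finite_identity; ring.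
    - apply summable_scal; [lra|apply summable_geom; split; auto; apply Cnorm_ge0].
    - intros N i Hi; unfold window_term.
      rewrite qpow_window_up, qpow_window_down by lia.
      specialize (HK1 i); specialize (HK2 i).
      replace (Cone * q ^ S i) with (q ^ S i) in HK1 by ring.
      replace (Cone / q ^ S i) with (/ q ^ S i) in HK1 by (unfold Cdiv; ring).
      replace (/ z * q ^ S i) with (q ^ S i / z) in HK2 by (unfold Cdiv; ring).
      replace (/ z / q ^ S i) with (/ q ^ S i / z) in HK2 by (unfold Cdiv; ring).
      eapply Rle_trans; [apply Cnorm_add|]; rewrite !Cnorm_opp.
      eapply Rle_trans; [apply Rplus_le_compat; apply Cnorm_add|]; rewrite !Cnorm_mul.
      pose proof (HB1 (2 * N + 1)%nat (N + S i)%nat) as b1.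
      pose proof (HB1 (2 * N + 1)%nat (N - S i)%nat) as b2.
      pose proof (HB2 (2 * N + 1)%nat (N + S i)%nat) as b3.
      pose proof (HB2 (2 * N + 1)%nat (N - S i)%nat) as b4.
      pose proof (Rmult_le_compat_r _ _ _ (Cnorm_ge0 (ediff (q ^ S i)%C)) b1) as c1.
      pose proof (Rmult_le_compat_r _ _ _ (Cnorm_ge0 (ediff (/ q ^ S i)%C)) b2) as c2.
      pose proof (Rmult_le_compat_r _ _ _ (Cnorm_ge0 (ediff (q ^ S i / z)%C)) b3) as c3.
      pose proof (Rmult_le_compat_r _ _ _ (Cnorm_ge0 (ediff (/ q ^ S i / z)%C)) b4) as c4.
      apply (Rmult_le_compat_l B1) in HK1; [|lra].
      apply (Rmult_le_compat_l B2) in HK2; [|lra].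
      rewrite Rmult_plus_distr_l in HK1, HK2.
      rewrite Rmult_plus_distr_r, !Rmult_assoc.
      lra.
    - intros i; apply Cvg_add; apply window_term_cvg with (S i); try (intros; lia).
      + intros; apply qpow_window_up.
      + intros; apply qpow_window_down; auto. }
  assert (C0 : Cvg (fun N => window_term N N) (residue_lim * ebil Cone)).
  { apply (window_term_cvg (fun N => N) 0); [intros; lia|].
    intros N _; pose proof (qpow_neq0 N); field; auto. }
  (* The partial sum is solved for in terms of [finite_theta], an error tending to 0 and the central
     term. *)
  apply Cvg_ext with (fun N => / residue_lim *
    (finite_theta N - (finite_theta N - window_term N N
      - residue_lim * Csum N (fun i => ebil (q ^ S i) + ebil (/ q ^ S i)))
     - window_term N N + residue_lim * ebil Cone)).
  { intros N; unfold ebil_partial; set (S := Csum N _); set (w := window_term N N).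
    field; auto. }
  apply (Cvg_eq _ (/ residue_lim * (residue_lim * theta_quotient - Czero
    - residue_lim * ebil Cone + residue_lim * ebil Cone))); [field; auto|].
  apply Cvg_mul; [apply Cvg_const|]; apply Cvg_add; [|apply Cvg_const].
  apply Cvg_sub; auto; apply Cvg_sub; auto; apply finite_theta_cvg.
Qed.

End Theta.

(** * Lambert-type terms, the case q = 0, and the conclusion *)

Lemma one_sub_swap x y : x <> Czero -> y <> Czero -> Cone - x / y = - (x / y) * (Cone - y / x).
Proof. intros; field; auto. Qed.

(** E(x) over a common denominator. In this form it comes out of [vwp_cert], and the rational term
    of the theorem is its negative at x = 1. *)
Definition lambert_term (a k z x : Cpx) : Cpx :=
  (k - a) * x * (Cone - / z) * (Cone - a * k * x * x / z)
  / ((Cone - k * x) * (Cone - a * x) * (Cone - a * x / z) * (Cone - k * x / z)).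

Lemma lambert_term_eq a k z x : z <> Czero ->
  Cone - k * x <> Czero -> Cone - a * x <> Czero ->
  Cone - a * x / z <> Czero -> Cone - k * x / z <> Czero ->
  lambert_term a k z x = ebil a k z x.
Proof.
  intros Hz H1 H2 H3 H4; unfold lambert_term, ebil, ediff.
  replace (k * (x / z)) with (k * x / z) by (field; auto).
  replace (a * (x / z)) with (a * x / z) by (field; auto).
  transitivity ((k - a) * x / ((Cone - k * x) * (Cone - a * x))
    - ((k - a) * x / z) / ((Cone - a * x / z) * (Cone - k * x / z))).
  - set (A := Cone - k * x) in *; set (B := Cone - a * x) in *.
    set (C := Cone - a * x / z) in *; set (D := Cone - k * x / z) in *.
    transitivity (((k - a) * x * (C * D) - (k - a) * x / z * (A * B)) / (A * B * C * D)).
    + f_equal; unfold A, B, C, D; field; auto.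
    + set (e := (k - a) * x / z); set (f := (k - a) * x).
      field; repeat split; auto.
  - replace ((k - a) * x) with ((Cone - a * x) - (Cone - k * x)) at 1 by ring.
    replace ((k - a) * x / z) with ((Cone - a * x / z) - (Cone - k * x / z)) by (field; auto).
    set (A := Cone - k * x) in *; set (B := Cone - a * x) in *.
    set (C := Cone - a * x / z) in *; set (D := Cone - k * x / z) in *.
    field; repeat split; auto.
Qed.

(** Every factor obeys 1 - y = -y (1 - 1/y); the resulting monomials cancel up to one sign. *)
Lemma lambert_term_inv a k z x : a <> Czero -> k <> Czero -> z <> Czero -> x <> Czero ->
  Cone - / k * x <> Czero -> Cone - / a * x <> Czero ->
  Cone - / a * x / / z <> Czero -> Cone - / k * x / / z <> Czero ->
  lambert_term (/ a) (/ k) (/ z) x = - ebil a k z (/ x).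
Proof.
  intros Ha Hk Hz Hx H1 H2 H3 H4.
  assert (E1 : Cone - k * / x = - (k / x) * (Cone - / k * x)) by (field; auto).
  assert (E2 : Cone - a * / x = - (a / x) * (Cone - / a * x)) by (field; auto).
  assert (E3 : Cone - a * / x / z = - (a / (x * z)) * (Cone - / a * x / / z))
    by (field; repeat split; auto using Cone_neq0).
  assert (E4 : Cone - k * / x / z = - (k / (x * z)) * (Cone - / k * x / / z))
    by (field; repeat split; auto using Cone_neq0).
  assert (N : forall y, y <> Czero -> - y <> Czero) by (intros; apply Copp_neq0; auto).
  assert (xz : x * z <> Czero) by (apply Cmul_neq0; auto).
  assert (Q : forall u v, u <> Czero -> v <> Czero -> u / v <> Czero).
  { intros; apply Cmul_neq0; auto; apply Cinv_neq0; auto. }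
  rewrite <- lambert_term_eq; auto;
    [|rewrite E1|rewrite E2|rewrite E3|rewrite E4]; try (apply Cmul_neq0; auto).
  unfold lambert_term; rewrite E1, E2, E3, E4.
  replace (Cone - / / z) with (- z * (Cone - / z)) by (field; auto using Cone_neq0).
  replace (Cone - / a * / k * x * x / / z)
    with (- (x * x * z / (a * k)) * (Cone - a * k * / x * / x / z))
    by (field; repeat split; auto using Cone_neq0).
  set (A := Cone - / k * x) in *; set (B := Cone - / a * x) in *.
  set (C := Cone - / a * x / / z) in *; set (D := Cone - / k * x / / z) in *.
  set (F := Cone - a * k * / x * / x / z); set (G := Cone - / z).
  field; repeat split; auto.
Qed.

Lemma ebil_series q a k z :
  (Cnorm q < 1)%R -> q <> Czero -> a <> Czero -> k <> Czero -> z <> Czero ->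
  qnz a q -> qnz (q / a) q -> qnz k q -> qnz (q / k) q ->
  qnz (z / a) q -> qnz (q * a / z) q -> qnz (z / k) q -> qnz (q * k / z) q ->
  Cvg (ebil_partial q a k z) (theta_quotient q a k z).
Proof.
  intros Hq Hq0 Ha0 Hk0 Hz0 Ha Ha' Hk Hk' Haz Haz' Hkz Hkz'.
  destruct (classic (qnz z q /\ qnz (q / z) q)) as [[H H']|H].
  - apply ebil_generic; auto.
  - apply ebil_degenerate; auto.
Qed.

(** Since 0^0 = 1, the factor of index 0 survives and all later ones are 1. *)
Lemma qpinf_base0 x : qpinf x Czero = Cone - x.
Proof.
  apply qpinf_eq, Cvg_unshift with 1%nat.
  apply Cvg_ext with (fun _ => Cone - x); [|apply Cvg_const].
  intros n; rewrite Nat.add_1_r; induction n; [simpl; ring|].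
  rewrite qpoch_S, <- IHn; simpl; ring.
Qed.

(** For q = 0 the Lambert-type series vanish, so the right side has to; writing 1 - z/k and 1 - z/a
    through their inverses makes the product the negative of the rational term. *)
Lemma theorem_rhs_base0 a k z : a <> Czero -> k <> Czero -> z <> Czero ->
  Cone - a <> Czero -> Cone - k <> Czero -> Cone - a / z <> Czero -> Cone - k / z <> Czero ->
  (a - k) * (Cone - / z) * (Cone - a * k / z)
     / ((Cone - a) * (Cone - k) * (Cone - a / z) * (Cone - k / z))
  + theta_quotient Czero a k z = Czero.
Proof.
  intros Ha Hk Hz H1 H2 H3 H4; unfold theta_quotient; rewrite !qpinf_base0.
  assert (E : forall y, Cone - Czero / y = Cone) by (intros; unfold Cdiv; ring).
  assert (E' : forall x y, Cone - Czero * x / y = Cone) by (intros; unfold Cdiv; ring).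
  rewrite !E, !E'.
  replace (Cone - Czero) with Cone by ring.
  rewrite (one_sub_swap z k), (one_sub_swap z a) by auto.
  set (A := Cone - a) in *; set (B := Cone - k) in *.
  set (C := Cone - a / z) in *; set (D := Cone - k / z) in *.
  set (F := Cone - a * k / z).
  field; repeat split; auto using Copp_neq0, Cone_neq0.
Qed.

Local Close Scope C_scope.

Theorem theorem1p1
  (alpha beta : Cpx -> Cpx -> nat -> Cpx) (q a k z s : Cpx)
  (Hq : Cnorm q < 1)
  (Hs : (s * s)%C = k)  (* s plays the role of sqrt k; any square root *)
  (HWP1 : WP_Bailey_pair a k q (alpha a k) (beta a k))
  (HWP2 : WP_Bailey_pair (/ a)%C (/ k)%C q (alpha (/ a)%C (/ k)%C) (beta (/ a)%C (/ k)%C))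
  (Hz1 : Cnorm (q * a)%C < Cnorm z)
  (Hz2 : Cnorm q * Cnorm z < Cnorm a)  (* i.e. |z| < |a/q| *)
  (* no denominator vanishes *)
  (Ha0 : a <> Czero) (Hk0 : k <> Czero) (Hz0 : z <> Czero)
  (Hd1 : (Cone - a)%C <> Czero) (Hd2 : (Cone - k)%C <> Czero)
  (Hd3 : (Cone - a / z)%C <> Czero) (Hd4 : (Cone - k / z)%C <> Czero)
  (Hfin : forall n : nat,
      qpoch s q n <> Czero /\ qpoch (- s)%C q n <> Czero /\
      qpoch (q * k)%C q n <> Czero /\ qpoch (q * k / z)%C q n <> Czero /\
      qpoch (/ s)%C q n <> Czero /\ qpoch (- / s)%C q n <> Czero /\
      qpoch (q / k)%C q n <> Czero /\ qpoch (q * z / k)%C q n <> Czero /\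
      qpoch (q * a)%C q n <> Czero /\ qpoch (q * a / z)%C q n <> Czero /\
      qpoch (q / a)%C q n <> Czero /\ qpoch (q * z / a)%C q n <> Czero)
  (Hinf : qpinf (z / k)%C q <> Czero /\ qpinf (q * k / z)%C q <> Czero /\
          qpinf (z / a)%C q <> Czero /\ qpinf (q * a / z)%C q <> Czero /\
          qpinf a q <> Czero /\ qpinf (q / a)%C q <> Czero /\
          qpinf k q <> Czero /\ qpinf (q / k)%C q <> Czero)
  (* the four series converge absolutely *)
  (Hc1 : abs_summable1 (fun n =>
      (qpoch (q * s) q n * qpoch (- (q * s)) q n * qpoch z q n * qpoch q q (n - 1)
       / (qpoch s q n * qpoch (- s) q n * qpoch (q * k) q n * qpoch (q * k / z) q n)
       * (q * a / z) ^ n * beta a k n)%C))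
  (Hc2 : abs_summable1 (fun n =>
      (qpoch (q / s) q n * qpoch (- (q / s)) q n * qpoch (/ z) q n * qpoch q q (n - 1)
       / (qpoch (/ s) q n * qpoch (- / s) q n * qpoch (q / k) q n * qpoch (q * z / k) q n)
       * (q * z / a) ^ n * beta (/ a) (/ k) n)%C))
  (Hc3 : abs_summable1 (fun n =>
      (qpoch z q n * qpoch q q (n - 1) / (qpoch (q * a) q n * qpoch (q * a / z) q n)
       * (q * a / z) ^ n * alpha a k n)%C))
  (Hc4 : abs_summable1 (fun n =>
      (qpoch (/ z) q n * qpoch q q (n - 1) / (qpoch (q / a) q n * qpoch (q * z / a) q n)
       * (q * z / a) ^ n * alpha (/ a) (/ k) n)%C)) :
  (series1 (fun n =>
      qpoch (q * s) q n * qpoch (- (q * s)) q n * qpoch z q n * qpoch q q (n - 1)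
       / (qpoch s q n * qpoch (- s) q n * qpoch (q * k) q n * qpoch (q * k / z) q n)
       * (q * a / z) ^ n * beta a k n)
   - series1 (fun n =>
      qpoch (q / s) q n * qpoch (- (q / s)) q n * qpoch (/ z) q n * qpoch q q (n - 1)
       / (qpoch (/ s) q n * qpoch (- / s) q n * qpoch (q / k) q n * qpoch (q * z / k) q n)
       * (q * z / a) ^ n * beta (/ a) (/ k) n)
   - series1 (fun n =>
      qpoch z q n * qpoch q q (n - 1) / (qpoch (q * a) q n * qpoch (q * a / z) q n)
       * (q * a / z) ^ n * alpha a k n)
   + series1 (fun n =>
      qpoch (/ z) q n * qpoch q q (n - 1) / (qpoch (q / a) q n * qpoch (q * z / a) q n)
       * (q * z / a) ^ n * alpha (/ a) (/ k) n))%C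
  =
  ((a - k) * (Cone - / z) * (Cone - a * k / z)
     / ((Cone - a) * (Cone - k) * (Cone - a / z) * (Cone - k / z))
   + z / k *
     (qpinf z q * qpinf (q / z) q * qpinf (k / a) q * qpinf (q * a / k) q
      * qpinf (a * k / z) q * qpinf (q * z / (a * k)) q * qpinf q q * qpinf q q)
     / (qpinf (z / k) q * qpinf (q * k / z) q * qpinf (z / a) q * qpinf (q * a / z) q
        * qpinf a q * qpinf (q / a) q * qpinf k q * qpinf (q / k) q))%C.
Proof.
  destruct Hinf as (I1 & I2 & I3 & I4 & I5 & I6 & I7 & I8).
  apply qnz_of_qpinf in I1, I2, I3, I4, I5, I6, I7, I8; auto.
  assert (F1 : qnz s q) by (intros n; apply (Hfin n)).
  assert (F2 : qnz (- s)%C q) by (intros n; apply (Hfin n)).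
  assert (F3 : qnz (q * k)%C q) by (intros n; apply (Hfin n)).
  assert (F5 : qnz (/ s)%C q) by (intros n; apply (Hfin n)).
  assert (F6 : qnz (- / s)%C q) by (intros n; apply (Hfin n)).
  assert (F8 : qnz (q * z / k)%C q) by (intros n; apply (Hfin n)).
  assert (F9 : qnz (q * a)%C q) by (intros n; apply (Hfin n)).
  assert (F12 : qnz (q * z / a)%C q) by (intros n; apply (Hfin n)).
  clear Hfin.
  (* The annulus for z amounts to |qa/z| < 1 and |qz/a| < 1, the ratios required for the pair and
     for its inverted copy. *)
  assert (X1 : Cnorm (q * a / z)%C < 1).
  { rewrite Cnorm_div by auto; pose proof (Cnorm_gt0 z Hz0).
    apply Rmult_lt_reg_r with (Cnorm z); auto.
    unfold Rdiv; rewrite Rmult_assoc, Rinv_l, Rmult_1_l, Rmult_1_r by lra; auto. }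
  assert (X2 : Cnorm (q * z / a)%C < 1).
  { rewrite Cnorm_div, Cnorm_mul by auto; pose proof (Cnorm_gt0 a Ha0).
    apply Rmult_lt_reg_r with (Cnorm a); auto.
    unfold Rdiv; rewrite Rmult_assoc, Rinv_l, Rmult_1_l, Rmult_1_r by lra; auto. }
  assert (E1 : (q * / k / / z = q * z / k)%C)
    by (field; repeat split; auto using Cone_neq0).
  assert (E2 : (q * / a / / z = q * z / a)%C)
    by (field; repeat split; auto using Cone_neq0).
  assert (Hs' : (/ s * / s)%C = (/ k)%C).
  { assert (s <> Czero) by (intros ->; apply Hk0; rewrite <- Hs; ring).
    rewrite <- Hs; field; auto. }
  assert (K' : (Cone - / k)%C <> Czero).
  { intros E; apply Hd2.
    replace (Cone - k)%C with (- k * (Cone - / k))%C by (field; auto); rewrite E; ring. }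
  pose proof (pair_series_lambert q a k z s Hq Hs Ha0 Hz0 X1 Hd2 F1 F2 F3 I2 F9
                _ _ HWP1 Hc1 Hc3) as P1.
  (* The inverted copy uses 1/s as the square root of 1/k; [E1] and [E2] bring its arguments to the
     form used in the theorem. *)
  pose proof (pair_series_lambert q (/ a)%C (/ k)%C (/ z)%C (/ s)%C Hq Hs' (Cinv_neq0 _ Ha0)
                (Cinv_neq0 _ Hz0)) as P2.
  unfold beta_weight, alpha_weight in P2; rewrite E1, E2 in P2.
  specialize (P2 X2 K' F5 F6 I8 F8 I6 _ _ HWP2 Hc2 Hc4).
  match type of P1 with Cvg _ (?u - ?v)%C => set (S1 := u) in *; set (S3 := v) in * end.
  match type of P2 with Cvg _ (?u - ?v)%C => set (S2 := u) in *; set (S4 := v) in * end.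
  match goal with |- ?l = _ => change l with (S1 - S2 - S3 + S4)%C end.
  change (Cvg (fun N => Csum N (fun i => lambert_term a k z (q ^ S i)%C)) (S1 - S3)%C) in P1.
  change (Cvg (fun N => Csum N (fun i => lambert_term (/ a)%C (/ k)%C (/ z)%C (q ^ S i)%C))
            (S2 - S4)%C) in P2.
  match goal with |- _ = (?r + ?t)%C => set (rat := r); change t with (theta_quotient q a k z) end.
  (* The theta argument divides by powers of q. For q = 0 every Lambert-type term is taken at x = 0
     and vanishes. *)
  destruct (classic (q = Czero)) as [Q0|Q0].
  - assert (Z : forall b c y L,
      Cvg (fun N => Csum N (fun i => lambert_term b c y (q ^ S i)%C)) L -> L = Czero).
    { intros b c y L H; apply (Cvg_unique _ _ _ H).
      apply Cvg_ext with (fun _ => Czero); [|apply Cvg_const].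
      intros n; rewrite (Csum_ext _ _ (fun _ => Czero * Czero)%C), Csum_scal; [ring|].
      intros i _; unfold lambert_term; rewrite Q0; simpl; unfold Cdiv; ring. }
    apply Z in P1, P2.
    transitivity ((S1 - S3) - (S2 - S4))%C; [ring|].
    rewrite P1, P2, Q0; unfold rat; rewrite theorem_rhs_base0 by auto; ring.
  - assert (P := ebil_series q a k z Hq Q0 Ha0 Hk0 Hz0 I5 I6 I7 I8 I3 I4 I1 I2).
    assert (N0 : forall i, (q ^ i)%C <> Czero) by (intros; apply Cpow_neq0; auto).
    (* A second evaluation of the same limit: the two one-sided series supply the positive and the
       negative exponents, and E(1) is the central term. *)
    assert (P' : Cvg (ebil_partial q a k z) (ebil a k z Cone + ((S1 - S3) - (S2 - S4)))%C).
    { apply Cvg_ext with (2 := Cvg_add _ _ _ _ (Cvg_const (ebil a k z Cone))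
                                 (Cvg_sub _ _ _ _ P1 P2)).
      intros N; unfold ebil_partial; f_equal; rewrite <- Csum_minus.
      apply Csum_ext; intros i _.
      rewrite lambert_term_eq, lambert_term_inv; auto; try (ring || idtac).
      - replace (/ k * q ^ S i)%C with (q / k * q ^ i)%C by (simpl; field; auto).
        apply qnz_factor; auto.
      - replace (/ a * q ^ S i)%C with (q / a * q ^ i)%C by (simpl; field; auto).
        apply qnz_factor; auto.
      - replace (/ a * q ^ S i / / z)%C with (q * z / a * q ^ i)%C
          by (simpl; field; repeat split; auto using Cone_neq0).
        apply qnz_factor; auto.
      - replace (/ k * q ^ S i / / z)%C with (q * z / k * q ^ i)%C
          by (simpl; field; repeat split; auto using Cone_neq0).
        apply qnz_factor; auto.
      - apply qnz_factor; auto.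
      - apply qnz_factor; auto.
      - replace (a * q ^ S i / z)%C with (q * a / z * q ^ i)%C by (simpl; field; auto).
        apply qnz_factor; auto.
      - replace (k * q ^ S i / z)%C with (q * k / z * q ^ i)%C by (simpl; field; auto).
        apply qnz_factor; auto. }
    pose proof (Cvg_unique _ _ _ P P') as U; rewrite U.
    rewrite <- lambert_term_eq; auto; unfold lambert_term, rat;
      replace (k * Cone)%C with k by ring; replace (a * Cone)%C with a by ring; auto.
    replace (a * k * Cone * Cone)%C with (a * k)%C by ring.
    set (A := (Cone - a)%C) in *; set (B := (Cone - k)%C) in *.
    set (C := (Cone - a / z)%C) in *; set (D := (Cone - k / z)%C) in *.
    set (F := (Cone - a * k / z)%C).
    field; repeat split; auto.
Qed.
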